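(* Let $d\ge 3$ and let $K$ be a $(d-1)$-dimensional simplicial complex with $n$ vertices which is $2$-CM (doubly Cohen-Macaulay) over some field. Then for all $0\le i\le d-1$, $f_i(K)\ge f_i(n,d)$, where $f_i(n,d)$ is the number of $i$-faces in a (equivalently, every) stacked $d$-polytope on $n$ vertices. (Explicitly, $f_{d-1}(n,d)=(d-1)n-(d+1)(d-2)$ and $f_i(n,d)=\binom{d}{i}n-\binom{d+1}{i+1}i$ for $1\le i\le d-2$.)
   Context: All simplicial complexes are finite abstract simplicial complexes; $f_i(K)$ is the number of $i$-dimensional faces of $K$. For a simplicial complex $L$ and a face $T\in L$ (including $T=\emptyset$), the link is $lk_L(T)=\{S\in L: T\cap S=\emptyset,\ T\cup S\in L\}$. $L$ is Cohen-Macaulay (CM) over a field $k$ if it is pure and for every face $T\in L$ (including the empty set) and every $i<\dim lk_L(T)$, the reduced homology $\tilde H_i(lk_L(T);k)$ vanishes. For a vertex $v$ of $K$, $K-v=\{T\in K: v\notin T\}$. $K$ is $2$-CM over $k$ if $K$ is CM over $k$ and for every vertex $v\in K$, $K-v$ is CM over $k$ of the same dimension as $K$. A stacked $d$-polytope is a polytope obtained from a $d$-simplex by repeatedly (possibly zero times) gluing a new $d$-simplex onto a facet so that the result remains convex with one additional vertex. Here $f_0(n,d)=n$.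
   Formalization: Stacking also requires that every facet other than the glued one stays a facet of the result; otherwise a square pyramid (two glued tetrahedra, 5 vertices, 8 edges) would be a stacked 3-polytope and contradict the formula f_1(5,3)=9. *)

(* Defs.v *)
From mathcomp Require Import all_boot all_order all_algebra.

Set Implicit Arguments.
Unset Strict Implicit.
Unset Printing Implicit Defensive.

Import Order.TTheory GRing.Theory Num.Theory.

(* A simplicial complex is given by its set of faces, the empty face included,
   over an ambient finite type V; its vertices are the v with [set v] \in K,
   so V may be larger than the vertex set. *)
Section Complexes.

Variable V : finType.
Implicit Types (K L : {set {set V}}) (S T : {set V}) (v : V).

Definition simplicial_complex K : Prop :=
  set0 \in K /\ (forall S T, S \in K -> T \subset S -> T \in K).

Definition fnum K (i : nat) : nat := #|[set S in K | #|S| == i.+1]|.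

(* dim K + 1, which is a natural number even for the complex {set0}. *)
Definition dim_succ K : nat := \max_(S in K) #|S|.

Definition pure K : Prop :=
  forall S, maxset (fun T => T \in K) S -> #|S| = dim_succ K.

Definition link K T : {set {set V}} :=
  [set S in K | (T :&: S == set0) && (T :|: S \in K)].

Definition deletion K v : {set {set V}} := [set T in K | v \notin T].

Section Homology.

Variable k : fieldType.
Local Open Scope ring_scope.
Implicit Types c z b : {ffun {set V} -> k}.

(* Chains are indexed by cardinality: a chain of cardinality m is supported on
   the faces of dimension m - 1, so m = 0 is the augmentation degree. *)
Definition chain L (m : nat) c : Prop :=
  forall S, c S != 0 -> (S \in L) && (#|S| == m).

(* Faces are oriented by the order of V given by enum_rank: the coefficient of
   T in the boundary of the face v |: T is (-1) to the position of v. *)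
Definition boundary c : {ffun {set V} -> k} :=
  [ffun T : {set V} => \sum_(v | v \notin T)
     (-1) ^+ #|[set u in T | (enum_rank u < enum_rank v)%N]| * c (v |: T)].

(* Vanishing of the reduced homology of L over k in dimension m - 1. *)
Definition homology_vanishes L (m : nat) : Prop :=
  forall z, chain L m z -> boundary z = 0 ->
  exists2 b, chain L m.+1 b & boundary b = z.

(* With m = i + 1, the condition i < dim (link L T) is m < dim_succ (link L T). *)
Definition cohen_macaulay L : Prop :=
  pure L /\
  forall T, T \in L ->
  forall m, (m < dim_succ (link L T))%N -> homology_vanishes (link L T) m.

Definition doubly_cohen_macaulay K : Prop :=
  cohen_macaulay K /\
  forall v, [set v] \in K ->
    cohen_macaulay (deletion K v) /\ dim_succ (deletion K v) = dim_succ K.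

End Homology.

End Complexes.

(* Required only here because classical_sets shadows the finset notations. *)
From mathcomp Require Import classical_sets cardinality reals convex.

Section Polytopes.

Variables (R : realType) (d : nat).
Local Open Scope ring_scope.
Local Open Scope classical_set_scope.
Implicit Types A P D F G : set 'rV[R]_d.

Definition affinely_independent (m : nat) (p : 'I_m -> 'rV[R]_d) : Prop :=
  forall a : 'I_m -> R,
    \sum_i a i = 0 -> \sum_i a i *: p i = 0 -> forall i, a i = 0.

Definition hull (m : nat) (p : 'I_m -> 'rV[R]_d) : set 'rV[R]_d :=
  [set x | exists a : 'I_m -> R,
     [/\ forall i, 0 <= a i, \sum_i a i = 1 & x = \sum_i a i *: p i]].

(* The affine hull of A has dimension i; no i satisfies this if A is empty. *)
Definition has_dim A (i : nat) : Prop :=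
  (exists2 p : 'I_i.+1 -> 'rV[R]_d,
     affinely_independent p & forall j, A (p j)) /\
  (forall p : 'I_i.+2 -> 'rV[R]_d,
     (forall j, A (p j)) -> ~ affinely_independent p).

Definition face P G : Prop :=
  exists (u : 'cV[R]_d) (c : R),
    (forall x, P x -> (x *m u) 0 0 <= c) /\
    G = P `&` [set x | (x *m u) 0 0 = c].

Definition has_face_number P (i m : nat) : Prop :=
  ([set G | face P G /\ has_dim G i] #= `I_m)%card.

Definition facet P G : Prop := face P G /\ has_dim G d.-1.

Definition full_simplex D : Prop :=
  exists2 p : 'I_d.+1 -> 'rV[R]_d, affinely_independent p & D = hull p.

(* The last condition of stacked_glue says that no facet of P merges with a
   coplanar facet of D.  It is part of the usual meaning of stacking (the new
   vertex is beyond F and strictly beneath every other facet of P) and does not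
   follow from the other conditions: a square pyramid is a convex union of two
   tetrahedra glued along a facet, with one additional vertex, but it is not
   simplicial. *)
Inductive stacked_polytope : set 'rV[R]_d -> Prop :=
| stacked_simplex D : full_simplex D -> stacked_polytope D
| stacked_glue P D F m :
    stacked_polytope P -> full_simplex D ->
    facet P F -> facet D F -> P `&` D = F ->
    convex_set (P `|` D : set (convex_lmodType 'rV[R]_d)) ->
    has_face_number P 0 m -> has_face_number (P `|` D) 0 m.+1 ->
    (forall G, facet P G \/ facet D G -> G <> F -> facet (P `|` D) G) ->
    stacked_polytope (P `|` D).

End Polytopes.

(* f_i(n,d) for d >= 3 and i < d; the case i = 0 gives n.  The truncated
   subtractions are exact as soon as d < n, which holds both for stacked
   d-polytopes and for (d-1)-dimensional 2-CM complexes on n vertices. *)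
Definition stacked_fnum (n d i : nat) : nat :=
  if i.+1 == d then (d - 1) * n - (d + 1) * (d - 2)
  else 'C(d, i) * n - 'C(d.+1, i.+1) * i.

(* Main.v *)
(* Lower bound.  Place the vertices generically in Q^(d+1) and call a graph rigid if
   every m with <m a, q b> + <m b, q a> = 0 on edges and vertices that vanishes on the
   vertices of one facet vanishes everywhere; counting equations in a rigid graph gives
   f_1 >= d n - C(d+1, 2).  By Fogelsanger's argument the 1-skeleton of the support of a
   minimal (d-1)-cycle (over any field) is rigid.  In a 2-CM complex a cycle y of the
   link of v extends to the cycle v * y - w, where w bounds y in K - v; by induction on d
   any two facets are therefore joined by a chain of minimal cycles, consecutive ones
   sharing a facet, so the 1-skeleton of K is rigid.  The bounds on f_i, i > 1, follow by
   summing the bounds for the vertex links, which are again 2-CM.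

   Stacked polytopes.  A face of a polytope is determined by the facet inequalities that
   are tight on it.  When D is stacked on P along F, the apex satisfies strictly every
   facet inequality of P other than that of F, so the proper faces of the union are those
   of P other than F together with those of D through the apex. *)

From HB Require Import structures.
Require Import Defs.
From mathcomp Require Import all_boot all_order all_algebra.
From mathcomp Require Import zify ring lra.
From mathcomp Require boolp.
Set Implicit Arguments.
Unset Strict Implicit.
Unset Printing Implicit Defensive.
Import Order.TTheory GRing.Theory Num.Theory.

(** * Simplicial chains *)

(** The equations say that m preserves, to first order, the norms of the points and the inner
    products along edges. This is rigidity on the d-sphere up to scaling of the points, so each
    vertex keeps d degrees of freedom. The trivial motions are [a |-> q a *m A] with A skew; a skew
    matrix of size d + 1 that kills d independent vectors is 0, so pinning the d vertices of a facet
    removes exactly these, whichever facet is taken. The contraction of an edge uv of a minimal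
    cycle need not be minimal, so it is split into minimal pieces and each is lifted back. A lifted
    piece may have faces through uv that are not faces of the cycle; but rigidity sees only edges,
    and these do belong to it. Vertex splitting produces its own placement for each piece, while the
    motions to be compared live at one placement; hence a single q is chosen at which everything
    that can be rigid is rigid. For polytopes the induction carries a system of inequalities each of
    which cuts out a facet, because the condition on stacking speaks of facets only. *)

Section Chains.
Variables (V : finType) (k : fieldType).
Local Open Scope ring_scope.
Implicit Types (c z a b : {ffun {set V} -> k}) (S T F : {set V}) (v w : V).

Definition orient v T : k :=
  (-1) ^+ #|[set u in T | (enum_rank u < enum_rank v)%N]|.
Definition del v c : {ffun {set V} -> k} :=
  [ffun T : {set V} => if v \in T then 0 else c T].
(** The sign makes [lnk v] anticommute with the boundary ([lnk_boundary]); [cone v] carries the same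
    sign and is therefore a section of [lnk v] on chains avoiding v. *)
Definition lnk v c : {ffun {set V} -> k} :=
  [ffun T : {set V} => if v \in T then 0 else orient v T * c (v |: T)].
Definition cone v c : {ffun {set V} -> k} :=
  [ffun T : {set V} => if v \in T then orient v (T :\ v) * c (T :\ v) else 0].
Definition avoids v c := forall T, v \in T -> c T = 0.
Definition supp c : {set {set V}} := [set T | c T != 0].
Definition scal (x : k) c : {ffun {set V} -> k} := [ffun T : {set V} => x * c T].

Lemma in_supp c T : (T \in supp c) = (c T != 0). Proof. by rewrite inE. Qed.

Lemma supp0P c : reflect (c = 0) (supp c == set0).
Proof.
apply: (iffP eqP) => [h|->]; last by apply/setP=> T; rewrite !inE ffunE eqxx.
apply/ffunP=> T; rewrite ffunE; apply/eqP/negPn.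
by rewrite -in_supp h inE.
Qed.

Lemma notin_supp c T : T \notin supp c -> c T = 0.
Proof. by rewrite in_supp negbK => /eqP. Qed.

Lemma boundaryE c T :
  boundary c T = \sum_(v | v \notin T) orient v T * c (v |: T).
Proof. by rewrite ffunE. Qed.

Fact boundary_is_additive : zmod_morphism (@boundary V k).
Proof.
move=> x y; apply/ffunP=> T; rewrite !(boundaryE, ffunE) -sumrB.
by apply: eq_bigr => v _; rewrite !ffunE mulrBr.
Qed.
HB.instance Definition _ :=
  GRing.isZmodMorphism.Build _ _ (@boundary V k) boundary_is_additive.

Fact del_is_additive v : zmod_morphism (del v).
Proof.
by move=> x y; apply/ffunP=> T; rewrite !ffunE; case: ifP; rewrite ?subr0.
Qed.
HB.instance Definition _ v :=
  GRing.isZmodMorphism.Build _ _ (del v) (del_is_additive v).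

Fact lnk_is_additive v : zmod_morphism (lnk v).
Proof.
by move=> x y; apply/ffunP=> T; rewrite !ffunE; case: ifP; rewrite ?subr0 ?mulrBr.
Qed.
HB.instance Definition _ v :=
  GRing.isZmodMorphism.Build _ _ (lnk v) (lnk_is_additive v).

Fact cone_is_additive v : zmod_morphism (cone v).
Proof.
by move=> x y; apply/ffunP=> T; rewrite !ffunE; case: ifP; rewrite ?subr0 ?mulrBr.
Qed.
HB.instance Definition _ v :=
  GRing.isZmodMorphism.Build _ _ (cone v) (cone_is_additive v).

Fact scal_is_additive x : zmod_morphism (scal x).
Proof. by move=> y z; apply/ffunP=> T; rewrite !ffunE mulrBr. Qed.
HB.instance Definition _ x :=
  GRing.isZmodMorphism.Build _ _ (scal x) (scal_is_additive x).

Lemma boundary_scal x c : boundary (scal x c) = scal x (boundary c).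
Proof.
apply/ffunP=> T; rewrite boundaryE ffunE boundaryE mulr_sumr.
by apply: eq_bigr => v _; rewrite ffunE mulrCA.
Qed.

Lemma orient_sqr v T : orient v T * orient v T = 1.
Proof. by rewrite -expr2 sqrr_sign. Qed.

Lemma orient_neq0 v T : orient v T != 0.
Proof. by rewrite signr_eq0. Qed.

Lemma orient_set0 v : orient v set0 = 1.
Proof.
by rewrite /orient (_ : [set u in _ | _] = set0) ?cards0 //; apply/setP=> u; rewrite !inE.
Qed.

Lemma orientU v w T : v \notin T ->
  orient w (v |: T) = (-1) ^+ (enum_rank v < enum_rank w)%N * orient w T.
Proof.
move=> vT; rewrite /orient -exprD; congr (_ ^+ _).
case vw: (enum_rank v < enum_rank w)%N => /=.
  rewrite (_ : [set u in v |: T | _] =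
    v |: [set u in T | (enum_rank u < enum_rank w)%N]).
    by rewrite cardsU1 inE (negbTE vT).
  by apply/setP=> x; rewrite !inE; case: eqVneq => [->|]//=; rewrite vw.
apply: eq_card => x; rewrite !inE; case: eqVneq => [->|]//=.
by rewrite vw andbF.
Qed.

Lemma orient_swap v w T : v != w -> v \notin T -> w \notin T ->
  orient v T * orient w (v |: T) = - (orient w T * orient v (w |: T)).
Proof.
move=> vw vT wT; rewrite !orientU // mulrCA (mulrCA (orient w T)) (mulrC (orient w T)) -mulNr.
congr (_ * _).
case: (ltngtP (enum_rank v) (enum_rank w)) => h //=; rewrite ?opprK //.
by move: vw; rewrite -(inj_eq enum_rank_inj) -val_eqE /= h eqxx.
Qed.

Lemma lnk_boundary v c : lnk v (boundary c) = - boundary (lnk v c).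
Proof.
apply/ffunP=> T; rewrite !ffunE -sumrN; case: ifP => vT.
  by rewrite big1 // => w _; rewrite ffunE in_setU vT orbT mulr0 oppr0.
rewrite [in RHS](bigD1 v) ?vT //= ffunE setU11 mulr0 oppr0 add0r mulr_sumr.
apply: eq_big => w; first by rewrite in_setU1 negb_or andbC.
rewrite in_setU1 negb_or => /andP[wv wT].
rewrite ffunE in_setU1 eq_sym (negbTE wv) vT /= !mulrA.
by rewrite -/(orient w _) -/(orient w T) orient_swap ?vT // 1?eq_sym // mulNr setUCA.
Qed.

Lemma del_boundary v c : del v (boundary c) = boundary (del v c) + lnk v c.
Proof.
apply/ffunP=> T; rewrite !ffunE; case: ifP => vT.
  by rewrite big1 ?addr0 // => w _; rewrite ffunE in_setU vT orbT mulr0.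
rewrite (bigD1 v) ?vT //= addrC; congr (_ + _).
rewrite [in RHS](bigD1 v) ?vT //= ffunE setU11 mulr0 add0r.
apply: eq_bigr => w /andP[wT wv].
by rewrite ffunE in_setU1 eq_sym (negbTE wv) vT.
Qed.

Lemma del_cone v c : del v (cone v c) = 0.
Proof. by apply/ffunP=> T; rewrite !ffunE; case: (v \in T). Qed.

Lemma lnk_cone v c : avoids v c -> lnk v (cone v c) = c.
Proof.
move=> h; apply/ffunP=> T; rewrite !ffunE; case: ifP => vT.
  by rewrite h.
by rewrite setU11 setU1K ?vT // mulrA orient_sqr mul1r.
Qed.

Lemma del_id v c : avoids v c -> del v c = c.
Proof. by move=> h; apply/ffunP=> T; rewrite ffunE; case: ifP => // /h. Qed.

Lemma lnk_avoids v c : avoids v c -> lnk v c = 0.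
Proof.
by move=> h; apply/ffunP=> T; rewrite !ffunE; case: ifP => // _; rewrite h ?setU11 ?mulr0.
Qed.

Lemma decomp v c : c = del v c + cone v (lnk v c).
Proof.
apply/ffunP=> T; rewrite !ffunE; case: ifP => vT; last by rewrite addr0.
by rewrite setD11 add0r setD1K // mulrA orient_sqr mul1r.
Qed.

Lemma avoids_del v c : avoids v (del v c).
Proof. by move=> T vT; rewrite ffunE vT. Qed.

Lemma avoids_lnk v c : avoids v (lnk v c).
Proof. by move=> T vT; rewrite ffunE vT. Qed.

Lemma avoids_boundary v c : avoids v c -> avoids v (boundary c).
Proof.
by move=> h T vT; rewrite boundaryE big1 // => w _; rewrite h ?mulr0 // in_setU vT orbT.
Qed.

Lemma avoidsD v a b : avoids v a -> avoids v b -> avoids v (a + b).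
Proof. by move=> ha hb T vT; rewrite ffunE ha ?hb ?addr0. Qed.

Lemma avoidsN v a : avoids v a -> avoids v (- a).
Proof. by move=> ha T vT; rewrite ffunE ha ?oppr0. Qed.

Lemma avoids_cone u v c : u != v -> avoids u c -> avoids u (cone v c).
Proof.
move=> uv h T uT; rewrite ffunE; case: ifP => // _.
by rewrite h ?mulr0 // !inE uv.
Qed.

Lemma boundary_cone v c : avoids v c ->
  boundary (cone v c) = c - cone v (boundary c).
Proof.
move=> h; rewrite [LHS](decomp v) lnk_boundary lnk_cone //.
by rewrite raddfN (del_boundary v (cone v c)) del_cone raddf0 add0r lnk_cone.
Qed.

(** Induction on the number of vertices that occur in c: splitting c at one vertex and applying
    [boundary_cone] replaces the cancellation of signs over pairs of removed vertices. *)
Lemma boundary_boundary c : boundary (boundary c) = 0.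
Proof.
have [n] := ubnP #|[set v : V | [exists T : {set V}, (v \in T) && (c T != 0)]]|.
elim: n c => // n IHn c; rewrite ltnS => hn.
have [v hv|c0] := pickP [pred v : V | [exists T : {set V}, (v \in T) && (c T != 0)]]; last first.
  apply/ffunP=> T; rewrite !ffunE big1 // => v _; rewrite boundaryE big1 ?mulr0 // => w _.
  have /existsPn/(_ (w |: (v |: T))) := c0 v.
  by rewrite !inE eqxx orbT /= negbK => /eqP ->; rewrite mulr0.
have hd x : avoids v x -> (forall w, avoids w c -> avoids w x) ->
    boundary (boundary x) = 0.
  move=> hx hcx; apply: IHn; apply: leq_trans hn; apply: proper_card.
  apply/properP; split.
    apply/subsetP=> w; rewrite !inE; apply: contraLR => /existsPn h.
    apply/existsPn=> T; rewrite negb_and -implybE; apply/implyP=> wT.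
    rewrite negbK (hcx w) // => S wS; apply/eqP; move: (h S).
    by rewrite wS /= negbK.
  exists v; first by rewrite inE.
  rewrite inE; apply/existsPn=> T; rewrite negb_and -implybE; apply/implyP=> vT.
  by rewrite negbK hx.
have h1 : boundary (boundary (del v c)) = 0.
  apply: hd; first exact: avoids_del.
  by move=> w hw T wT; rewrite ffunE hw // if_same.
have hl : avoids v (lnk v c) by exact: avoids_lnk.
have h2 : boundary (boundary (lnk v c)) = 0.
  apply: hd => // w hw T wT; rewrite ffunE hw ?mulr0 ?if_same //.
  by rewrite in_setU wT orbT.
rewrite (decomp v c) !raddfD /= h1 add0r boundary_cone // raddfB /=.
rewrite boundary_cone; last exact: avoids_boundary.
by rewrite h2 raddf0 subr0 subrr.
Qed.

End Chains.

(** * Generic rigidity *)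

Section Lines.
Local Open Scope ring_scope.

Lemma poly_nonroot (p : {poly rat}) : p != 0 -> exists t, p.[t] != 0.
Proof.
move=> p0.
have [t /andP[_ ht]|h] := pickP [pred i : 'I_(size p).+1 | true && (p.[(nat_of_ord i)%:R] != 0)].
  by exists (nat_of_ord t)%:R.
have : (size [seq (nat_of_ord i)%:R : rat | i <- enum 'I_(size p).+1] < size p)%N.
  apply: max_poly_roots => //.
    apply/allP=> x /mapP[i _ ->]; rewrite /root.
    by move/negbT: (h i); rewrite /= negbK.
  rewrite map_inj_uniq ?enum_uniq // => i j /eqP.
  by rewrite eqr_nat => /eqP/val_inj.
by rewrite size_map size_enum_ord ltnNge leqnSn.
Qed.

(** If L is a right inverse of A, the product of A + tB with L is 1 + tBL, whose determinant is a
    polynomial in t with value 1 at 0. *)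
Lemma row_free_line m n (A B : 'M[rat]_(m, n)) : row_free A ->
  exists2 p : {poly rat}, p != 0 & forall t, p.[t] != 0 -> row_free (A + t *: B).
Proof.
move=> /row_freeP[L AL]; pose C := B *m L.
pose P : 'M[{poly rat}]_m := map_mx polyC 1%:M + 'X *: map_mx polyC C.
have PE t : (\det P).[t] = \det (1%:M + t *: C).
  rewrite -[LHS]/(horner_eval t (\det P)) -det_map_mx; congr (\det _).
  by apply/matrixP=> i j; rewrite !mxE /= /horner_eval !hornerE.
exists (\det P).
  apply/eqP=> h; have := PE 0; rewrite h horner0 scale0r addr0 det1 => /eqP.
  by rewrite eq_sym oner_eq0.
move=> t; rewrite PE => ht; apply/row_freeP.
exists (L *m invmx (1%:M + t *: C)).
by rewrite mulmxA mulmxDl AL -scalemxAl mulmxV // unitmxE unitfE.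
Qed.

Definition cinj (I J : finType) (c : I -> J -> rat) :=
  forall m : I -> rat, (forall j, \sum_i m i * c i j = 0) -> forall i, m i = 0.

Lemma cinjP (I J : finType) (c : I -> J -> rat) :
  cinj c <->
  row_free (\matrix_(i < #|I|, j < #|J|) c (enum_val i) (enum_val j)).
Proof.
split=> [h|h m hm i].
  apply: inj_row_free => v /rowP hv; apply/rowP=> i; rewrite mxE.
  rewrite -[i]enum_valK; apply: (h (fun x => v 0 (enum_rank x))) => j.
  move: (hv (enum_rank j)); rewrite !mxE => e; rewrite -[RHS]e.
  rewrite (reindex (@enum_val I I)) /=; last exact: onW_bij (enum_val_bij _).
  by apply: eq_bigr => l _; rewrite mxE enum_valK enum_rankK.
have h0 : (\row_i m (enum_val i)) = 0 :> 'rV_#|I|.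
  apply: (row_free_inj h); rewrite mul0mx; apply/rowP=> j; rewrite !mxE.
  rewrite -[RHS](hm (enum_val j)).
  rewrite [RHS](reindex (@enum_val I I)) /=; last exact: onW_bij (enum_val_bij _).
  by apply: eq_bigr => l _; rewrite !mxE.
by have /rowP/(_ (enum_rank i)) := h0; rewrite !mxE enum_rankK.
Qed.

Lemma cinj_line (I J : finType) (c0 c1 : I -> J -> rat) : cinj c0 ->
  exists2 p : {poly rat}, p != 0 &
    forall t, p.[t] != 0 -> cinj (fun i j => c0 i j + t * c1 i j).
Proof.
move=> /cinjP/row_free_line h.
have [p p0 hp] := h (\matrix_(i, j) c1 (enum_val i) (enum_val j)).
exists p => // t /hp ht; apply/cinjP; congr (row_free _): ht.
by apply/matrixP=> i j; rewrite !mxE.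
Qed.

Lemma cinj_card (I J : finType) (c : I -> J -> rat) : cinj c -> (#|I| <= #|J|)%N.
Proof. by move/cinjP => /eqP <-; exact: rank_leq_col. Qed.

End Lines.

(** * Placements, motions and pinned graphs *)

Section Rigidity.
Variables (V : finType) (D : nat).
Local Open Scope ring_scope.
Notation placement := {ffun V -> 'rV[rat]_D}.
Implicit Types (q : placement) (m : V -> 'rV[rat]_D) (S F X : {set V}).
Implicit Types (Delta : {set {set V}}) (u v w : V).

Definition line q q' (t : rat) : placement := [ffun a => q a + t *: (q' a - q a)].

(* Stands for Zariski openness, without multivariate polynomials. *)
Definition line_open (P : placement -> Prop) := forall q q', P q ->
  exists2 p : {poly rat}, p != 0 & forall t, p.[t] != 0 -> P (line q q' t).

Lemma line_openI P Q : line_open P -> line_open Q ->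
  line_open (fun q => P q /\ Q q).
Proof.
move=> oP oQ q q' [Pq Qq].
have [p p0 hp] := oP _ q' Pq; have [r r0 hr] := oQ _ q' Qq.
exists (p * r); first by rewrite mulf_neq0.
by move=> t; rewrite hornerM mulf_eq0 negb_or => /andP[/hp ? /hr].
Qed.

(** Irreducibility of the space of placements: both conditions hold at all but finitely many points
    of the line through q and q'. *)
Lemma line_open_meet P Q q q' : line_open P -> line_open Q -> P q -> Q q' ->
  exists r, P r /\ Q r.
Proof.
move=> oP oQ Pq Qq'.
have [p p0 hp] := oP _ q' Pq; have [r r0 hr] := oQ _ q Qq'.
(* The second condition parametrises the line from q', so its polynomial is composed with 1 - X;
   this substitution is an involution and keeps it nonzero. *)
have s0 : r \Po (1%:P - 'X) != 0.
  apply: contra r0 => /eqP h; apply/eqP.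
  rewrite -[r]comp_polyXr (_ : 'X = (1%:P - 'X) \Po (1%:P - 'X) :> {poly rat}).
    by rewrite comp_polyA h comp_poly0.
  by rewrite comp_polyB comp_polyC comp_polyX opprB addrC subrK.
have [t] := poly_nonroot (mulf_neq0 p0 s0).
rewrite hornerM mulf_eq0 negb_or horner_comp => /andP[/hp Pt].
rewrite !hornerE => /hr Qt; exists (line q q' t); split => //.
congr Q: Qt; apply/ffunP=> a; rewrite !ffunE scalerBl scale1r.
apply/eqP; rewrite -subr_eq0.
by apply/eqP/rowP=> i; rewrite !mxE; ring.
Qed.

Lemma line_open_all (I : eqType) (s : seq I) (P : I -> placement -> Prop) :
  (forall i, line_open (P i)) -> line_open (fun q => {in s, forall i, P i q}).
Proof.
move=> oP; elim: s => [|i s IHs] q q' h; first by exists 1 => //; exact: oner_neq0.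
have [|p p0 hp] := line_openI (oP i) IHs q' (_ : P i q /\ _).
  by split=> [|j js]; apply: h; rewrite inE ?eqxx ?js ?orbT.
exists p => // t /hp[Pi Ps] j; rewrite inE => /predU1P[->//|]; exact: Ps.
Qed.

Lemma line_open_meet_all (I : finType) (P : I -> placement -> Prop) :
  (forall i, line_open (P i)) -> (forall i, exists q, P i q) ->
  exists q, forall i, P i q.
Proof.
move=> oP eP.
suff [q hq] : exists q, {in enum I, forall i, P i q}.
  by exists q => i; apply: hq; rewrite mem_enum.
elim: (enum I) => [|i s [q hq]]; first by exists 0.
have [q' hq'] := eP i.
have [r [Pi Ps]] := line_open_meet (oP i) (line_open_all oP) hq' hq.
by exists r => j; rewrite inE => /predU1P[->//|]; exact: Ps.
Qed.

Definition dot (x y : 'rV[rat]_D) : rat := (x *m y^T) 0 0.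

Lemma dotE x y : dot x y = \sum_k x 0 k * y 0 k.
Proof. by rewrite /dot !mxE; apply: eq_bigr => k _; rewrite mxE. Qed.

Lemma dotC x y : dot x y = dot y x.
Proof. by rewrite !dotE; apply: eq_bigr => k _; rewrite mulrC. Qed.

Lemma dotDl x y z : dot (x + y) z = dot x z + dot y z.
Proof. by rewrite /dot mulmxDl mxE. Qed.

Lemma dotDr x y z : dot z (x + y) = dot z x + dot z y.
Proof. by rewrite ![dot z _]dotC dotDl. Qed.

Lemma dotBl x y z : dot (x - y) z = dot x z - dot y z.
Proof. by rewrite /dot mulmxBl !mxE. Qed.

Lemma dotZr t x y : dot x (t *: y) = t * dot x y.
Proof. by rewrite /dot linearZ /= -scalemxAr mxE. Qed.

Lemma dot0l x : dot 0 x = 0.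
Proof. by rewrite /dot mul0mx mxE. Qed.

Definition skel Delta S := (#|S| <= 2)%N && [exists F in Delta, S \subset F].

(* Given the constraints of [set a] and [set b], that of [set a; b] reads
   dot (m a) (q b) + dot (m b) (q a) = 0. *)
Definition motion Delta q m := forall S, skel Delta S ->
  dot (\sum_(a in S) m a) (\sum_(a in S) q a) = 0.

Definition pinned Delta F q := forall m, motion Delta q m ->
  {in F, forall a, m a = 0} -> {in cover Delta, forall a, m a = 0}.

(* The matrix of the system that [pinned] declares nonsingular: one column for each S
   in the skeleton, and one for each coordinate set to 0, at the vertices of F and
   outside the cover. *)
Definition coef Delta F q (i : V * 'I_D) (j : {set V} + V * 'I_D) : rat :=
  match j with
  | inl T => if skel Delta T && (i.1 \in T) then (\sum_(b in T) q b) 0 i.2 else 0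
  | inr l => (((l.1 \in F) || (l.1 \notin cover Delta)) && (i == l))%:R
  end.

Lemma dot_sum_coord (S : {set V}) (mu : V * 'I_D -> rat) (x : 'rV[rat]_D) :
  \sum_i mu i * (if i.1 \in S then x 0 i.2 else 0) =
  dot (\sum_(a in S) \row_k mu (a, k)) x.
Proof.
transitivity (\sum_a \sum_k mu (a, k) * (if a \in S then x 0 k else 0)).
  by rewrite pair_bigA; apply: eq_bigr => -[].
rewrite dotE exchange_big; apply: eq_bigr => k _; rewrite summxE mulr_suml.
rewrite [RHS]big_mkcond; apply: eq_bigr => a _.
by case: ifP => _; rewrite ?mxE ?mulr0.
Qed.

Lemma skel_cover Delta S a : skel Delta S -> a \in S -> a \in cover Delta.
Proof.
move=> /andP[_ /exists_inP[F FD /subsetP h]] /h aF.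
by apply/bigcupP; exists F.
Qed.

Lemma sum_delta (I : finType) (mu : I -> rat) (b : bool) (l : I) :
  \sum_i mu i * (b && (i == l))%:R = if b then mu l else 0.
Proof.
rewrite (bigD1 l) //= eqxx andbT big1 ?addr0; last first.
  by move=> i /negbTE ->; rewrite andbF mulr0.
by case: b; rewrite ?mulr1 ?mulr0.
Qed.

Lemma pinnedP Delta F q : pinned Delta F q <-> cinj (coef Delta F q).
Proof.
split=> [h mu hmu [a k]|h m hm hF].
  have hpin l : (l.1 \in F) || (l.1 \notin cover Delta) -> mu l = 0.
    by move=> hl; have := hmu (inr l); rewrite /= sum_delta hl.
  have [aD|aD] := boolP (a \in cover Delta); last by rewrite hpin ?aD ?orbT.
  suff /rowP/(_ k) : \row_k mu (a, k) = 0 by rewrite !mxE.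
  apply: (h (fun a => \row_k mu (a, k)) _ _ a aD) => [S hS|b bF].
    by rewrite -dot_sum_coord -[RHS](hmu (inl S)) /= hS.
  by apply/rowP=> l; rewrite !mxE hpin ?bF.
move=> a aD.
pose mu (i : V * 'I_D) := if i.1 \in cover Delta then m i.1 0 i.2 else 0.
have mu0 : forall i, mu i = 0.
  apply: h => -[S|l] /=.
    have [hS|_] /= := boolP (skel Delta S); last by rewrite big1 // => i _; rewrite mulr0.
    rewrite dot_sum_coord -[RHS](hm S hS); congr dot; apply: eq_bigr => b bS.
    by apply/rowP=> l; rewrite mxE /mu /= (skel_cover hS bS).
  rewrite sum_delta /mu; case: ifP => //; case: ifP => // _; rewrite orbF.
  by move=> /hF ->; rewrite mxE.
by apply/rowP=> l; have := mu0 (a, l); rewrite /mu /= aD mxE.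
Qed.

Lemma coef_line Delta F q q' t i j : coef Delta F (line q q' t) i j =
  coef Delta F q i j + t * (coef Delta F q' i j - coef Delta F q i j).
Proof.
case: j => [S|l] /=; last by rewrite subrr mulr0 addr0.
case: ifP => _; last by rewrite subrr mulr0 addr0.
rewrite !summxE -sumrB mulr_sumr -big_split /=.
by apply: eq_bigr => b _; rewrite ffunE !mxE.
Qed.

Lemma line_open_pinned Delta F : line_open (pinned Delta F).
Proof.
move=> q q' /pinnedP hq.
have [p p0 hp] :=
  cinj_line (fun i j => coef Delta F q' i j - coef Delta F q i j) hq.
exists p => // t /hp ht; apply/pinnedP => m hm; apply: ht => j.
by rewrite -[RHS](hm j); apply: eq_bigr => i _; rewrite coef_line.
Qed.

Definition points q X : 'M[rat]_(#|X|, D) := \matrix_(i < #|X|) q (enum_val i).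

Lemma line_open_points X : line_open (fun q => row_free (points q X)).
Proof.
move=> q q' hq.
have [p p0 hp] := row_free_line (points q' X - points q X) hq.
exists p => // t /hp; congr (row_free _).
by apply/matrixP=> i j; rewrite !mxE ffunE !mxE.
Qed.

Lemma points_exists X : (#|X| <= D)%N -> exists q, row_free (points q X).
Proof.
move=> XD; exists [ffun a => \row_(k < D) (index a (enum X) == k)%:R].
apply: inj_row_free => v /rowP hv; apply/rowP=> i; rewrite [RHS]mxE.
have := hv (widen_ord XD i); rewrite !mxE (bigD1 i) //= !mxE ffunE !mxE.
rewrite /enum_val index_uniq ?enum_uniq -?cardE // eqxx mulr1 big1 ?addr0 //.
move=> j ji; rewrite !mxE ffunE mxE index_uniq ?enum_uniq -?cardE //=.
by rewrite val_eqE (negbTE ji) mulr0.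
Qed.

Definition general q := forall X, (#|X| <= D)%N -> row_free (points q X).

Lemma line_open_imp (A : Prop) P : line_open P -> line_open (fun q => A -> P q).
Proof.
move=> oP q q' AP; have [a|na] := boolp.EM A; last first.
  by exists 1 => [|t _ /na[]]; exact: oner_neq0.
by have [p p0 hp] := oP q q' (AP a); exists p => // t /hp.
Qed.

(** There are finitely many pairs [(Delta, F)], and each implication is line open and satisfiable.
    Afterwards a pinned placement found by any construction can be traded for the fixed q. *)
Lemma universal_placement : exists q, general q /\
  forall Delta F, (exists q', pinned Delta F q') -> pinned Delta F q.
Proof.
pose P (i : {set V} + {set {set V}} * {set V}) q := match i with
  | inl X => (#|X| <= D)%N -> row_free (points q X)
  | inr (Delta, F) => (exists q', pinned Delta F q') -> pinned Delta F q
  end.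
have [||q hq] := @line_open_meet_all _ P.
- case=> [X|[Delta F]]; apply: line_open_imp; first exact: line_open_points.
  exact: line_open_pinned.
- case=> [X|[Delta F]] /=.
    have [XD|XD] := boolP (#|X| <= D)%N; last by exists 0.
    by have [q hq] := points_exists XD; exists q.
  have [[q hq]|nq] := boolp.EM (exists q', pinned Delta F q'); first by exists q.
  by exists 0.
exists q; split=> [X|Delta F]; first exact: (hq (inl X)).
exact: (hq (inr (Delta, F))).
Qed.

End Rigidity.

(** * Change of the pinned facet and vertex splitting *)

Section RigidityMoves.
Variables (V : finType) (D : nat).
Local Open Scope ring_scope.
Notation placement := {ffun V -> 'rV[rat]_D}.
Implicit Types (q : placement) (m : V -> 'rV[rat]_D) (S F X : {set V}).
Implicit Types (Delta : {set {set V}}) (u v w a b : V).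

Lemma sum_set2 (W : nmodType) (f : V -> W) a b : a != b ->
  \sum_(x in [set a; b]) f x = f a + f b.
Proof. by move=> ab; rewrite big_setU1 ?inE //= big_set1. Qed.

Lemma skel2 Delta F a b : F \in Delta -> a \in F -> b \in F -> skel Delta [set a; b].
Proof.
move=> FD aF bF; apply/andP; split; first by rewrite cards2; case: eqP.
by apply/exists_inP; exists F => //; apply/subsetP=> x /set2P[]->.
Qed.

Lemma skel1 Delta F a : F \in Delta -> a \in F -> skel Delta [set a].
Proof. by move=> FD aF; rewrite -[[set a]]setUid; exact: (skel2 FD aF aF). Qed.

Lemma motion_self Delta q m F a : motion Delta q m -> F \in Delta -> a \in F ->
  dot (m a) (q a) = 0.
Proof. by move=> hm FD aF; have := hm _ (skel1 FD aF); rewrite !big_set1. Qed.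

Lemma motion_pair Delta q m F a b : motion Delta q m -> F \in Delta ->
  a \in F -> b \in F -> dot (m a) (q b) + dot (m b) (q a) = 0.
Proof.
move=> hm FD aF bF; have [->|ab] := eqVneq a b.
  by rewrite (motion_self hm FD bF) addr0.
have := hm _ (skel2 FD aF bF); rewrite !sum_set2 // !dotDl !dotDr.
by rewrite (motion_self hm FD aF) (motion_self hm FD bF) addr0 add0r.
Qed.

Lemma dot_points_eq0 q X (x : 'rV[rat]_D) : #|X| = D -> row_free (points q X) ->
  {in X, forall a, dot x (q a) = 0} -> x = 0.
Proof.
move=> XD /eqP rk h.
have /row_fullP[B BQ] : row_full (points q X) by rewrite /row_full rk XD.
apply: trmx_inj; rewrite -[x^T]mul1mx -BQ -mulmxA.
suff -> : points q X *m x^T = 0 by rewrite mulmx0 trmx0.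
apply/matrixP=> i j; rewrite ord1 [RHS]mxE.
have := h _ (enum_valP i); rewrite dotC dotE => <-.
by rewrite mxE; apply: eq_bigr => l _; rewrite !mxE.
Qed.

Lemma dot_skew (A : 'M[rat]_D) (x y : 'rV[rat]_D) : A^T = - A ->
  dot (x *m A) y = - dot (y *m A) x.
Proof.
move=> hA; rewrite /dot; have -> : y *m A *m x^T = (x *m A^T *m y^T)^T.
  by rewrite !trmx_mul !trmxK mulmxA.
by rewrite [X in - X]mxE hA mulmxN mulNmx [X in - X]mxE opprK.
Qed.

(** The maps [a |-> q a *m A] with A skew are the trivial motions; on an independent set whose pairs
    are all edges there are no others. *)
Lemma skew_extension q F m : row_free (points q F) ->
  {in F &, forall a b, dot (m a) (q b) + dot (m b) (q a) = 0} ->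
  exists2 A : 'M[rat]_D, A^T = - A & {in F, forall a, q a *m A = m a}.
Proof.
move=> /row_freeP[P QP] h; set Q := points q F in QP.
pose M : 'M[rat]_(#|F|, D) := \matrix_(i < #|F|) m (enum_val i).
have MQ : M *m Q^T = - (Q *m M^T).
  apply/eqP; rewrite -addr_eq0; apply/eqP/matrixP=> i j.
  rewrite [RHS]mxE -[RHS](h _ _ (enum_valP i) (enum_valP j)) [LHS]mxE; congr (_ + _).
    by rewrite dotE mxE; apply: eq_bigr => l _; rewrite !mxE.
  by rewrite dotC dotE mxE; apply: eq_bigr => l _; rewrite !mxE.
(* [P *m M] has the right values on F; subtracting its transpose makes it skew, and the last term,
   skew because [M *m Q^T] is, restores the values. *)
exists (P *m M - M^T *m P^T - P *m M *m Q^T *m P^T).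
  rewrite !raddfB /= !trmx_mul !trmxK.
  have -> : P *m (Q *m (M^T *m P^T)) = - (P *m M *m Q^T *m P^T).
    by rewrite -[P *m M *m Q^T]mulmxA MQ mulmxN mulNmx !mulmxA opprK.
  by rewrite !opprK [X in X + _ = _]addrC.
move=> a aF; have -> : q a = row (enum_rank_in aF a) Q.
  by apply/rowP=> l; rewrite !mxE enum_rankK_in.
rewrite -row_mul !mulmxBr !mulmxA QP mul1mx.
have -> : M *m Q^T *m P^T = - (Q *m M^T *m P^T) by rewrite MQ mulNmx.
rewrite opprK subrK.
by apply/rowP=> l; rewrite !mxE enum_rankK_in.
Qed.

(* The motion [a |-> q a *m A] that the pin F removes is skew, so its value at a
   further vertex w is orthogonal to q on F' and at w. *)
Lemma pinned_change Delta F F' q : general q -> F \in Delta -> F' \in Delta ->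
  #|F|.+1 = D -> #|F'|.+1 = D -> pinned Delta F q -> pinned Delta F' q.
Proof.
move=> gq FD FD' cF cF' pF m hm hF'.
have fF : row_free (points q F) by apply: gq; rewrite -cF.
have [A skA hA] := skew_extension fF (fun a b aF bF => motion_pair hm FD aF bF).
have mE : {in cover Delta, forall a, m a = q a *m A}.
  move=> a aD; apply/eqP; rewrite -subr_eq0; apply/eqP.
  apply: (pF (fun a => m a - q a *m A)) => // [S hS|b bF]; last by rewrite hA ?subrr.
  rewrite sumrB -mulmx_suml dotBl hm // sub0r.
  have := dot_skew (\sum_(a in S) q a) (\sum_(a in S) q a) skA.
  by move/eqP; rewrite -addr_eq0 -mulr2n mulrn_eq0 /= => /eqP->; rewrite oppr0.
move=> w wD; have [wF'|wF'] := boolP (w \in F'); first exact: hF'.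
have qA0 a : a \in F' -> q a *m A = 0.
  move=> aF'; rewrite -mE ?hF' //; apply/bigcupP; by exists F'.
have cX : #|w |: F'| = D by rewrite cardsU1 wF' add1n.
rewrite mE //; apply: (dot_points_eq0 cX); first by apply: gq; rewrite cX.
move=> a /setU1P[->|aF'].
  have := dot_skew (q w) (q w) skA.
  by move/eqP; rewrite -addr_eq0 -mulr2n mulrn_eq0 /= => /eqP.
by rewrite dot_skew // qA0 // dot0l oppr0.
Qed.

(** The vertex of X outside F is joined to all of F, where m vanishes, so its motion is orthogonal
    to a basis, the points of X. *)
Lemma simplex_rigid Delta q X F m : general q -> #|X| = D -> F \subset X ->
  #|F|.+1 = D -> {in X &, forall a b, skel Delta [set a; b]} ->
  motion Delta q m -> {in F, forall a, m a = 0} -> {in X, forall a, m a = 0}.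
Proof.
move=> gq cX FX cF edge hm hF w wX.
have [wF|wF] := boolP (w \in F); first exact: hF.
have hself a : a \in X -> dot (m a) (q a) = 0.
  by move=> aX; have := hm _ (edge a a aX aX); rewrite setUid !big_set1.
have XE : X = w |: F.
  apply/eqP; rewrite eq_sym eqEcard subUset sub1set wX FX /=.
  by rewrite cardsU1 wF cX add1n cF.
apply: (dot_points_eq0 cX); first by apply: gq; rewrite cX.
move=> a; rewrite XE => /setU1P[->|aF]; first exact: hself.
have wa : w != a by apply: contraNneq wF => ->.
have aX : a \in X := subsetP FX _ aF.
have := hm _ (edge w a wX aX); rewrite !sum_set2 // (hF a aF) addr0.
by rewrite dotDr hself // add0r.
Qed.

Lemma skelS Delta S S' : S' \subset S -> skel Delta S -> skel Delta S'.
Proof.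
move=> sS /andP[cS /exists_inP[F FD SF]]; apply/andP; split.
  exact: leq_trans (subset_leq_card sS) cS.
by apply/exists_inP; exists F => //; apply: subset_trans SF.
Qed.

Definition contract u v a := if a == v then u else a.

(* The placement [line q0 q1 t] puts v at [q u + t *: q v].  For t != 0 the constraint of
   the edge uv is, up to the factor t, orthogonality of [m u - m v] to [q v]; in
   this form it survives at t = 0, where the constraints from the common
   neighbours force [m u = m v] and leave a motion of the contraction. *)
Lemma vertex_split Delta Delta' q u v (W F : {set V}) :
  general q -> u != v -> u \notin W -> v \notin W -> #|W|.+2 = D ->
  skel Delta [set u; v] ->
  {in W, forall w, skel Delta [set u; w] /\ skel Delta [set v; w]} ->
  (forall F', F' \in Delta' -> exists2 G, G \in Delta &
     contract u v @: G = F' /\ ~~ ((u \in G) && (v \in G))) ->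
  {in cover Delta, forall x, contract u v x \in cover Delta'} ->
  pinned Delta' (contract u v @: F) q -> exists q', pinned Delta F q'.
Proof.
move=> gq uv uW vW cW euv eW lift cov pin; set f := contract u v in lift cov pin *.
have fv : f v = u by rewrite /f /contract eqxx.
have fN x : x != v -> f x = x by rewrite /f /contract => /negbTE->.
have vf x : f x != v by rewrite /f /contract; case: (eqVneq x v).
(* At t = 0 the vertex v sits on top of u; q1 moves it off in the direction [q v]. *)
pose q0 : placement := [ffun a => q (f a)].
pose q1 : placement := [ffun a => q (f a) + (a == v)%:R *: q v].
pose e (i : V * 'I_D) := (if i.1 \in [set u] then q v 0 i.2 else 0)
  - (if i.1 \in [set v] then q v 0 i.2 else 0).
have eE (mu : V * 'I_D -> rat) : \sum_i mu i * e i =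
    dot (\row_k mu (u, k) - \row_k mu (v, k)) (q v).
  under eq_bigr => i _ do rewrite mulrBr.
  by rewrite sumrB !dot_sum_coord !big_set1 dotBl.
pose uvj : {set V} + V * 'I_D := inl [set u; v].
(* Only the column of uv is altered, to what remains of it after division by t; that column is
   constant along the line. *)
pose c0 i j := if j == uvj then e i else coef Delta F q0 i j.
pose c1 i j := if j == uvj then 0 else coef Delta F q1 i j - coef Delta F q0 i j.
have inj0 : cinj c0.
  move=> mu hmu; pose m a := \row_k mu (a, k).
  have hpin l : (l.1 \in F) || (l.1 \notin cover Delta) -> mu l = 0.
    by move=> hl; have := hmu (inr l); rewrite /c0 /= sum_delta hl.
  have hm S : S != [set u; v] -> skel Delta S ->
      dot (\sum_(a in S) m a) (\sum_(a in S) q0 a) = 0.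
    move=> Suv hS; rewrite -dot_sum_coord -[RHS](hmu (inl S)) /c0 /=.
    by rewrite (_ : inl S == uvj = false) ?hS //; apply/negbTE.
  have huv : dot (m u - m v) (q v) = 0.
    by rewrite -eE -[RHS](hmu uvj) /c0 eqxx.
  have self a : skel Delta [set a] -> dot (m a) (q0 a) = 0.
    move=> ha; have := hm [set a]; rewrite !big_set1; apply => //.
    apply: contraNneq uv => /setP auv; move: (auv u) (auv v).
    by rewrite !inE !eqxx orbT /= => /eqP-> /eqP->.
  have mself a w : skel Delta [set a; w] -> w \in W -> a \in [set u; v] ->
      dot (m a) (q w) = - dot (m w) (q u).
    move=> ha wW auv.
    have [wu wv] : w != u /\ w != v by split; apply: contraTneq wW => ->.
    have aw : a != w by case/set2P: auv => ->; rewrite eq_sym.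
    have qa : q0 a = q u.
      by rewrite ffunE; case/set2P: auv => ->; rewrite ?fv ?fN.
    have qw : q0 w = q w by rewrite ffunE fN.
    have Suv : [set a; w] != [set u; v].
      apply: contraTneq wW => /setP/(_ w); rewrite !inE eqxx orbT.
      by rewrite (negbTE wu) (negbTE wv).
    have := hm _ Suv ha; rewrite !sum_set2 // !dotDl !dotDr.
    rewrite (self a) ?(self w).
    - by rewrite qa qw addr0 add0r => /eqP; rewrite addr_eq0 => /eqP.
    - by apply: skelS ha; rewrite sub1set !inE eqxx ?orbT.
    - by apply: skelS ha; rewrite sub1set !inE eqxx.
  (* [m u - m v] is orthogonal to q at u (vertex equations), at v (the altered equation) and on W
     (difference of edge equations): D vectors in all, since W has D - 2 elements. *)
  have muv : m u = m v.
    apply/eqP; rewrite -subr_eq0; apply/eqP.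
    have cX : #|u |: (v |: W)| = D.
      by rewrite !cardsU1 vW !inE negb_or uv uW !add1n.
    apply: (dot_points_eq0 cX); first by apply: gq; rewrite cX.
    move=> a /setU1P[->|/setU1P[->//|aW]].
      have := self v; rewrite ffunE fv => hv; have := self u; rewrite ffunE fN // => hu.
      by rewrite dotBl hu ?hv ?subrr //; apply: skelS euv; rewrite sub1set !inE eqxx ?orbT.
    have [h1 h2] := eW a aW.
    by rewrite dotBl (mself u a) ?(mself v a) ?subrr // !inE eqxx ?orbT.
  have mf a : m a = m (f a).
    by have [->|av] := eqVneq a v; rewrite ?fv ?fN.
  (* An equation of the contraction lifts to the vertices over it in a face G lacking u or v; there
     f is injective, and the altered column uv does not occur. *)
  have hm' : motion Delta' q m.
    move=> S' /andP[cS' /exists_inP[F' F'D' S'F']].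
    have [G GD [GE guv]] := lift F' F'D'.
    pose S := [set x in G | f x \in S'].
    have fS : f @: S = S'.
      apply/setP=> x; apply/imsetP/idP => [[y]|xS'].
        by rewrite inE => /andP[_ ?] ->.
      have := subsetP S'F' _ xS'; rewrite -GE => /imsetP[y yG yx].
      by exists y => //; rewrite inE yG -yx.
    have finj : {in S &, injective f}.
      move=> x y; rewrite !inE => /andP[xG _] /andP[yG _]; rewrite /f /contract.
      case: eqVneq => [xv|xv]; case: eqVneq => [yv|yv] //; first by rewrite xv yv.
        by move=> uy; move: guv; rewrite uy yG -xv xG.
      by move=> xu; move: guv; rewrite -xu xG -yv yG.
    rewrite -fS !big_imset //=.
    have -> : \sum_(a in S) m (f a) = \sum_(a in S) m a.
      by apply: eq_bigr => a _; rewrite -mf.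
    have -> : \sum_(a in S) q (f a) = \sum_(a in S) q0 a.
      by apply: eq_bigr => a _; rewrite ffunE.
    apply: hm.
      apply: contraNneq guv => /setP SE; move: (SE u) (SE v).
      by rewrite !inE !eqxx orbT /= => /andP[-> _] /andP[-> _].
    apply/andP; split; first by rewrite -(card_in_imset finj) fS.
    by apply/exists_inP; exists G => //; apply/subsetP=> x; rewrite inE => /andP[].
  have m0 : {in cover Delta', forall a, m a = 0}.
    apply: pin hm' _ => _ /imsetP[a aF ->]; rewrite -mf.
    by apply/rowP=> l; rewrite !mxE hpin ?aF.
  case=> a k; have [aD|aD] := boolP (a \in cover Delta); last by rewrite hpin ?aD ?orbT.
  have /rowP/(_ k) : m a = 0 by rewrite mf m0 ?cov.
  by rewrite !mxE.
have [p p0 hp] := cinj_line c1 inj0.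
have X0 : 'X != 0 :> {poly rat} by rewrite polyX_eq0.
have [t] := poly_nonroot (mulf_neq0 p0 X0).
rewrite hornerM hornerX mulf_eq0 negb_or => /andP[/hp injt t0] {p p0 hp}.
exists (line q0 q1 t); apply/pinnedP => mu hmu; apply: injt => j.
have [->|juv] := eqVneq j uvj; last first.
  rewrite -[RHS](hmu j); apply: eq_bigr => i _.
  by rewrite coef_line /c0 /c1 (negbTE juv).
rewrite /c0 /c1 eqxx; under eq_bigr => i _ do rewrite mulr0 addr0.
rewrite eE dotBl.
have hm S : skel Delta S ->
    dot (\sum_(a in S) \row_k mu (a, k)) (\sum_(a in S) line q0 q1 t a) = 0.
  by move=> hS; rewrite -dot_sum_coord -[RHS](hmu (inl S)) /= hS.
have hu := hm _ (skelS (_ : [set u] \subset _) euv).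
have hv := hm _ (skelS (_ : [set v] \subset _) euv).
have := hm _ euv; move: hu hv.
rewrite !sub1set !inE !eqxx orbT !big_set1 !sum_set2 //.
have -> : line q0 q1 t u = q u.
  by rewrite !ffunE fN // (negbTE uv) scale0r addr0 subrr scaler0 addr0.
have -> : line q0 q1 t v = q u + t *: q v.
  by rewrite !ffunE fv eqxx scale1r [q u + _ - _]addrC addKr.
(* The vertex equations at u and v turn the edge equation of uv into t times the equation of [e]. *)
move=> /(_ isT) hu /(_ isT); rewrite !dotDl !dotDr !dotZr hu add0r => hv huv.
apply: (mulfI t0); rewrite mulr0; lra.
Qed.

End RigidityMoves.

(** * Rigidity of minimal cycles *)

Section MinimalCycles.
Variables (V : finType) (k : fieldType).
Local Open Scope ring_scope.
Implicit Types (c z y a b : {ffun {set V} -> k}) (S T F G R : {set V}) (u v w : V).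

(** The supports of minimal cycles are the circuits of the matroid on faces given by the columns of
    the boundary map. *)
Definition minimal_cycle z := [/\ z != 0, boundary z = 0 &
  forall y, boundary y = 0 -> y != 0 -> supp y \subset supp z -> supp y = supp z].

Lemma supp_neq0 z : z != 0 -> exists F, F \in supp z.
Proof. by move=> z0; apply/set0Pn; apply: contra z0 => /supp0P ->. Qed.

Lemma minimal_cycle_exists z : boundary z = 0 -> z != 0 ->
  exists2 y, minimal_cycle y & supp y \subset supp z.
Proof.
have [n] := ubnP #|supp z|; elim: n z => // n IHn z; rewrite ltnS => zn bz z0.
have [[y [by0 y0 yz]]|h] :=
    boolp.EM (exists y, [/\ boundary y = 0, y != 0 & supp y \proper supp z]).
  have [x mx xy] := IHn y (leq_trans (proper_card yz) zn) by0 y0.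
  by exists x => //; apply: subset_trans xy (proper_sub yz).
exists z => //; split=> // y by0 y0 yz; apply/eqP; rewrite eqEproper yz.
by apply/negP=> yz'; apply: h; exists y.
Qed.

Lemma supp_scal x c : x != 0 -> supp (scal x c) = supp c.
Proof. by move=> x0; apply/setP=> T; rewrite !inE ffunE mulf_eq0 (negbTE x0). Qed.

(** Subtracting the multiple of a minimal cycle that cancels one face shrinks the support and adds
    no face, so every summand stays inside the support of z. *)
Lemma minimal_cycle_sum z : boundary z = 0 -> exists2 ys : seq {ffun {set V} -> k},
  z = \sum_(y <- ys) y &
  {in ys, forall y, minimal_cycle y /\ supp y \subset supp z}.
Proof.
have [n] := ubnP #|supp z|; elim: n z => // n IHn z; rewrite ltnS => zn bz.
have [->|z0] := eqVneq z 0; first by exists [::]; rewrite ?big_nil.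
have [y [y0 by0 my] yz] := minimal_cycle_exists bz z0.
have [F Fy] := supp_neq0 y0.
have yF : y F != 0 by rewrite -in_supp.
have zF : z F != 0 by rewrite -in_supp (subsetP yz).
pose x := z F / y F; have x0 : x != 0 by rewrite mulf_neq0 ?invr_neq0.
pose z' := z - scal x y.
have zz' : supp z' \subset supp z :\ F.
  apply/subsetP=> T; rewrite !inE !ffunE; case: (eqVneq T F) => [->|_] /=.
    by rewrite divfK // subrr eqxx.
  apply: contra => /eqP zT; have /eqP : y T = 0.
    by apply/notin_supp/negP => /(subsetP yz); rewrite in_supp zT eqxx.
  by move/eqP=> ->; rewrite zT mulr0 subrr.
have [||ys zE hys] := IHn z'.
- apply: leq_trans zn; rewrite (cardsD1 F (supp z)) in_supp zF ltnS.
  exact: subset_leq_card.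
- by rewrite raddfB /= boundary_scal bz by0 raddf0 subrr.
exists (scal x y :: ys); first by rewrite big_cons -zE addrC subrK.
move=> c; rewrite inE => /predU1P[->|/hys[mc cz]]; last first.
  split=> //; apply: subset_trans cz _; apply: subset_trans zz' _; exact: subD1set.
rewrite supp_scal //; split => //; split.
3: by move=> c' bc' c'0; rewrite supp_scal //; exact: my.
- by apply: contra y0 => /eqP/supp0P h; apply/eqP/supp0P; rewrite -(supp_scal _ x0).
- by rewrite boundary_scal by0 raddf0.
Qed.

End MinimalCycles.

Section Glue.
Variables (V : finType) (k : fieldType) (D : nat).
Local Open Scope ring_scope.
Implicit Types (z y : {ffun {set V} -> k}) (F G : {set V}).

(* The pieces on which m vanishes add up to a cycle supported inside the support
   of z, so by minimality they exhaust it. *)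
Lemma glue_pieces (q : {ffun V -> 'rV[rat]_D}) z (ys : seq {ffun {set V} -> k}) :
  minimal_cycle z -> z = \sum_(y <- ys) y -> {in ys, forall y, boundary y = 0} ->
  (forall y m, y \in ys -> motion (supp z) q m -> {in supp y &, forall F G,
     {in F, forall a, m a = 0} -> {in G, forall a, m a = 0}}) ->
  {in supp z, forall F, pinned (supp z) F q}.
Proof.
move=> [z0 bz minz] zE bys rig F Fz m hm hF.
pose van G := [forall a in G, m a == 0].
have vanP G : reflect {in G, forall a, m a = 0} (van G).
  by apply: (iffP forall_inP) => h a /h /eqP.
pose J y := [forall G in supp y, van G].
pose zJ := \sum_(y <- ys | J y) y.
(* By [rig], a piece containing a face on which m vanishes has m vanishing on all its faces, so it
   is among the summands of [zJ]. *)
have zJ1 G : van G -> zJ G = z G.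
  move=> vG; rewrite zE !sum_ffunE big_mkcond /= big_seq [RHS]big_seq.
  apply: eq_bigr => y yys; case: ifP => // /negbT.
  have [//|yG] := eqVneq (y G) 0; case/negP; apply/forall_inP => H Hy.
  apply/vanP; apply: (rig y m yys hm G H) => //; first by rewrite in_supp.
  exact/vanP.
have zJ0 G : ~~ van G -> zJ G = 0.
  move=> vG; rewrite sum_ffunE big1 // => y /forall_inP h.
  by apply/notin_supp; apply: contra vG => /h.
have szJ : supp zJ = supp z.
  apply: minz.
  - by rewrite raddf_sum big_seq_cond big1 // => y /andP[/bys].
  - apply/eqP=> zJz; move: Fz; rewrite in_supp -zJ1; last exact/vanP.
    by rewrite zJz ffunE eqxx.
  - apply/subsetP=> G; rewrite !in_supp; have [vG|vG] := boolP (van G).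
      by rewrite zJ1.
    by rewrite zJ0 ?eqxx.
move=> a /bigcupP[G Gz]; apply/vanP; apply: contraTT Gz => vG.
by rewrite -szJ in_supp zJ0 ?eqxx.
Qed.

End Glue.

(** * Cycles seen from an edge uv *)

Section Contraction.
Variables (V : finType) (k : fieldType) (u v : V).
Hypothesis uv : u != v.
Local Open Scope ring_scope.
Implicit Types (c z y a b : {ffun {set V} -> k}) (S T F G R : {set V}) (w : V).

Definition off c := avoids u c /\ avoids v c.

(* Every cycle has this form, where [c], [a], [b] avoid u and v; contracting v to u
   sends it to [c + cone u (a + b)]. *)
Definition assemble c a b := c + cone u a + cone v b - cone v (cone u (boundary b)).

(** The four terms of [assemble] have disjoint supports, told apart by which of u and v belong to
    the face. *)
Lemma assemble_neq0 c a b G : off c -> off a -> off b ->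
  (assemble c a b G != 0) =
  if v \in G then
    if u \in G then boundary b (G :\ v :\ u) != 0 else b (G :\ v) != 0
  else if u \in G then a (G :\ u) != 0 else c G != 0.
Proof.
move=> [cu cv] [au av] [bu bv]; rewrite !ffunE.
have [vG|vG] := boolP (v \in G); have [uG|uG] := boolP (u \in G).
- rewrite cu // av; last by rewrite !inE vG eq_sym uv.
  rewrite bu; last by rewrite !inE uG uv.
  rewrite !inE uv uG /= !mulr0 !add0r oppr_eq0 -boundaryE !mulf_eq0.
  by rewrite !(negbTE (orient_neq0 _ _ _)).
- rewrite cv // !inE (negbTE uG) andbF !mulr0 !addr0 add0r subr0 mulf_eq0.
  by rewrite (negbTE (orient_neq0 _ _ _)).
- rewrite cu // subr0 addr0 add0r mulf_eq0.
  by rewrite (negbTE (orient_neq0 _ _ _)).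
by rewrite subr0 !addr0.
Qed.

Lemma off_boundary c : off c -> off (boundary c).
Proof. by move=> [cu cv]; split; apply: avoids_boundary. Qed.

Lemma offD a b : off a -> off b -> off (a + b).
Proof. by move=> [? ?] [? ?]; split; apply: avoidsD. Qed.

Lemma offN a : off a -> off (- a).
Proof. by move=> [? ?]; split; apply: avoidsN. Qed.

(** Taking the boundary of the hypothesis gives [boundary a = - boundary b], which cancels the cones
    over u; the last term of [assemble] cancels those over v. *)
Lemma boundary_assemble c a b : off c -> off a -> off b -> boundary c + a + b = 0 ->
  boundary (assemble c a b) = 0.
Proof.
move=> oc oa ob e; have [bu bv] := off_boundary ob.
have ba : boundary a = - boundary b.
  have := congr1 (@boundary V k) e; rewrite !raddfD raddf0 /= boundary_boundary add0r.
  by move/eqP; rewrite addr_eq0 => /eqP.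
rewrite /assemble raddfB !raddfD /= boundary_cone; last by case: oa.
rewrite boundary_cone; last by case: ob.
rewrite boundary_cone; last by apply: avoids_cone => //; rewrite eq_sym.
rewrite boundary_cone // boundary_boundary raddf0 subr0.
rewrite ba raddfN opprK.
set x := cone u _; set y := cone v _.
rewrite -[RHS]e; set t := boundary c.
apply/ffunP=> T; rewrite !ffunE; ring.
Qed.

(** Here a is the link of u away from v and b that of v away from u; being a cycle forces the link
    of the edge uv to be [- boundary b]. *)
Lemma cycle_assemble z : boundary z = 0 ->
  exists c a b, [/\ off c, off a, off b, z = assemble c a b & boundary c + a + b = 0].
Proof.
move=> bz; pose c := del u (del v z); pose a := lnk u (del v z).
pose b := del u (lnk v z); pose e := lnk u (lnk v z).
have hv : boundary (del v z) = - lnk v z.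
  by apply/eqP; rewrite -addr_eq0 -del_boundary bz raddf0.
have hl : boundary (lnk v z) = 0.
  by rewrite -[LHS]opprK -lnk_boundary bz raddf0 oppr0.
have he : e = - boundary b.
  apply/eqP; rewrite -addr_eq0 addrC; apply/eqP.
  by rewrite -[LHS]del_boundary hl raddf0.
have hc : boundary c + a = - b by rewrite -[LHS]del_boundary hv raddfN.
have av (x : {ffun {set V} -> k}) : avoids v x -> avoids v (del u x) /\ avoids v (lnk u x).
  by move=> h; split=> T vT; rewrite ffunE h ?mulr0 ?if_same // in_setU vT orbT.
have [] := av _ (@avoids_del _ _ v z); have [] := av _ (@avoids_lnk _ _ v z).
move=> h1 h2 h3 h4; exists c, a, b; split; try by split=> //; [exact: avoids_del|..].
- by split=> //; exact: avoids_lnk.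
- rewrite {1}(decomp v z) {1}(decomp u (del v z)) {1}(decomp u (lnk v z)) -/c -/a -/b -/e.
  by rewrite he raddfN raddfB /= /assemble !addrA.
by rewrite hc addNr.
Qed.

End Contraction.

Section Pieces.
Variables (V : finType) (k : fieldType) (D : nat).
Local Open Scope ring_scope.
Implicit Types (c z y : {ffun {set V} -> k}) (S T F G R : {set V}) (u v w a b : V).
Implicit Types (q : {ffun V -> 'rV[rat]_D}) (Delta : {set {set V}}).

Lemma boundary_neq0 c T : boundary c T != 0 -> exists2 v, v \notin T & c (v |: T) != 0.
Proof.
move=> h; have [v /andP[vT cv]|h0] := pickP [pred v | (v \notin T) && (c (v |: T) != 0)].
  by exists v.
move: h; rewrite boundaryE big1 ?eqxx // => v vT.
by have /= := h0 v; rewrite vT /= => /negbFE/eqP ->; rewrite mulr0.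
Qed.

Lemma set_le2 S : S != set0 -> (#|S| <= 2)%N ->
  exists a b, [/\ a \in S, b \in S & S = [set a; b]].
Proof.
move=> /set0Pn[a aS] c2; have [S1|/set0Pn[b]] := eqVneq (S :\ a) set0.
  by exists a, a; split=> //; rewrite setUid -(setD1K aS) S1 setU0.
move=> bS; have bS' : b \in S by case/setD1P: bS.
exists a, b; split=> //; apply/eqP; rewrite eq_sym eqEcard.
rewrite cards2 eq_sym; case/setD1P: bS => -> _ /=; rewrite c2 andbT.
by apply/subsetP=> x /set2P[]->.
Qed.

Lemma motion_pairs Delta Delta' q m : motion Delta q m ->
  {in Delta', forall G, {in G &, forall a b, skel Delta [set a; b]}} ->
  motion Delta' q m.
Proof.
move=> hm h S /andP[cS /exists_inP[G GD SG]].
have [->|S0] := eqVneq S set0; first by rewrite !big_set0 dot0l.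
have [a [b [aS bS SE]]] := set_le2 S0 cS.
by rewrite SE; apply/hm/(h G GD); apply: (subsetP SG).
Qed.

Lemma contract_imset u v G : u != v ->
  contract u v @: G = if v \in G then u |: (G :\ v) else G.
Proof.
move=> uv; have mN x : x != v -> contract u v x = x by rewrite /contract => /negbTE->.
case: ifP => vG.
  apply/setP=> x; apply/imsetP/setU1P => [[y yG ->]|[->|/setD1P[xv xG]]].
  - have [->|yv] := eqVneq y v; first by left; rewrite /contract eqxx.
    by right; rewrite mN // !inE yv.
  - by exists v => //; rewrite /contract eqxx.
  - by exists x; rewrite ?mN.
have h x : x \in G -> contract u v x = x by move=> xG; rewrite mN //; apply: contraFneq vG => <-.
apply/setP=> x; apply/imsetP/idP => [[y yG ->]|xG]; first by rewrite h.
by exists x; rewrite ?h.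
Qed.

End Pieces.

(** * Lifting a minimal piece of the contraction *)

Section Fogelsanger.
Variables (V : finType) (k : fieldType) (d : nat).
Local Open Scope ring_scope.
Implicit Types (c z y a b : {ffun {set V} -> k}) (S T F G R : {set V}) (u v w : V).
Implicit Types (q : {ffun V -> 'rV[rat]_d.+1}) (Delta : {set {set V}}).

Section Piece.
Variables (q : {ffun V -> 'rV[rat]_d.+1}) (u v : V).
Variables (z c a b y : {ffun {set V} -> k}) (F0 : {set V}).
Hypotheses (hd : (2 < d)%N) (gq : general q) (uv : u != v).
Hypothesis univ : forall Delta F, (exists q', pinned Delta F q') -> pinned Delta F q.
Hypotheses (mz : minimal_cycle z) (zE : z = assemble u v c a b).
Hypotheses (oc : off u v c) (oa : off u v a) (ob : off u v b).
Hypotheses (F0z : F0 \in supp z) (uF0 : u \in F0) (vF0 : v \in F0).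
Hypotheses (my : minimal_cycle y) (yz : supp y \subset supp (c + cone u (a + b))).
Hypothesis dimy : {in supp y, forall F, #|F| = d}.
Hypothesis piny : {in supp y, forall F, pinned (supp y) F q}.

(* The link of y at u is split between u and v in the proportion in which z
   splits it. *)
Definition lift_v : {ffun {set V} -> k} :=
  [ffun S => lnk u y S * (b S / (a + b) S)].
Definition lift_u : {ffun {set V} -> k} := lnk u y - lift_v.
Definition lift_cycle := assemble u v (del u y) lift_u lift_v.

Let y_v G : v \in G -> y G = 0.
Proof.
move=> vG; apply/notin_supp/negP => /(subsetP yz); rewrite in_supp.
rewrite !ffunE; case: oc oa ob => _ cv [_ av] [_ bv].
case: ifP => uG; last by rewrite cv // addr0 eqxx.
have vG' : v \in G :\ u by rewrite !inE vG eq_sym uv.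
by rewrite cv // av // bv // !addr0 mulr0 addr0 => /eqP.
Qed.

(** This justifies the division in [lift_v]: the denominator is nonzero wherever the link of y
    is. *)
Let g_neq0 S : lnk u y S != 0 -> u \notin S /\ (a + b) S != 0.
Proof.
rewrite ffunE; case: ifP => uS; first by rewrite eqxx.
rewrite mulf_eq0 negb_or orient_neq0 -in_supp => /(subsetP yz).
rewrite in_supp 2!ffunE setU11 setU1K ?uS //.
have -> : c (u |: S) = 0 by case: oc => cu _; apply: cu; rewrite setU11.
by rewrite add0r mulf_eq0 negb_or => /andP[].
Qed.

Let g_supp S : lnk u y S != 0 -> u |: S \in supp y.
Proof.
rewrite ffunE; case: ifP => uS; first by rewrite eqxx.
by rewrite mulf_eq0 negb_or in_supp => /andP[].
Qed.

Let lift_vP S : lift_v S != 0 -> u |: S \in supp y /\ b S != 0.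
Proof. by rewrite ffunE !mulf_eq0 !negb_or => /and3P[/g_supp]. Qed.

Let lift_uP S : lift_u S != 0 -> u |: S \in supp y /\ a S != 0.
Proof.
rewrite ffunE [X in _ + X]ffunE [lift_v S]ffunE => h.
have g0 : lnk u y S != 0.
  by apply: contra h => /eqP ->; rewrite mul0r subr0.
have [uS ab0] := g_neq0 g0; split; first exact: g_supp.
apply: contra h => /eqP a0; move: ab0; rewrite ffunE a0 add0r => b0.
by rewrite divff // mulr1 subrr.
Qed.

Let off_lnk : off u v (lnk u y).
Proof.
split; first exact: avoids_lnk.
by move=> T vT; rewrite ffunE y_v ?mulr0 ?if_same // !inE vT orbT.
Qed.

Let off_lift_v : off u v lift_v.
Proof.
case: off_lnk => hu hv; split=> T xT; rewrite ffunE.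
  by rewrite hu // mul0r.
by rewrite hv // mul0r.
Qed.

Let off_lift_u : off u v lift_u.
Proof. by apply: offD => //; apply: offN. Qed.

Let off_del : off u v (del u y).
Proof.
split; first exact: avoids_del.
by move=> T vT; rewrite ffunE y_v ?if_same.
Qed.

Lemma boundary_lift : boundary lift_cycle = 0.
Proof.
apply: boundary_assemble => //; rewrite /lift_u -addrA subrK.
by rewrite -del_boundary; case: my => _ -> _; rewrite raddf0.
Qed.

Let in_z G : (G \in supp z) = if v \in G then
    if u \in G then boundary b (G :\ v :\ u) != 0 else b (G :\ v) != 0
  else if u \in G then a (G :\ u) != 0 else c G != 0.
Proof. by rewrite in_supp zE assemble_neq0. Qed.

Let in_lift G : (G \in supp lift_cycle) = if v \in G then
    if u \in G then boundary lift_v (G :\ v :\ u) != 0 else lift_v (G :\ v) != 0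
  else if u \in G then lift_u (G :\ u) != 0 else del u y G != 0.
Proof. by rewrite in_supp assemble_neq0. Qed.

Let vu : v != u. Proof. by rewrite eq_sym. Qed.

Let lift_edge G : G \in supp lift_cycle -> ~~ ((u \in G) && (v \in G)) ->
  G \in supp z /\ contract u v @: G \in supp y.
Proof.
rewrite in_lift contract_imset // in_z.
have [vG|vG] := boolP (v \in G); have [uG|uG] //= := boolP (u \in G).
- by move=> /lift_vP[].
- by move=> /lift_uP[]; rewrite setD1K.
rewrite ffunE (negbTE uG) => yG _; rewrite in_supp; split=> //.
have := subsetP yz G; rewrite !in_supp => /(_ yG).
by rewrite 2!ffunE (negbTE uG) addr0.
Qed.

(** A lifted face through u and v need not be a face of z. Since [lnk u y] is a cycle, the
    boundaries of [lift_u] and [lift_v] at the rest R of G are opposite and nonzero, so R extends by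
    some w' in [lift_u] and by some w in [lift_v]; this yields faces of z through u and R and
    through v and R. *)
Let lift_uv G : G \in supp lift_cycle -> u \in G -> v \in G ->
  exists w w', [/\ w \notin G, v |: (w |: (G :\ v :\ u)) \in supp z,
    u |: (w |: (G :\ v :\ u)) \in supp y & u |: (w' |: (G :\ v :\ u)) \in supp z].
Proof.
set R := G :\ v :\ u.
rewrite in_lift => + uG vG; rewrite uG vG => bR.
have uG1 x : u \in v |: (x |: R) -> u = x.
  by rewrite !inE (negbTE uv) eqxx /= orbF => /eqP.
have [w wR bw] := boundary_neq0 bR.
have [lu lv] := off_lift_v; have [lu' lv'] := off_lift_u.
have wu : w != u by apply: contraNneq bw => ->; rewrite lu ?setU11.
have wv : w != v by apply: contraNneq bw => ->; rewrite lv ?setU11.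
have [uy bz] := lift_vP bw.
have [w' w'R aw'] : exists2 w', w' \notin R & lift_u (w' |: R) != 0.
  apply: boundary_neq0; apply: contra bR; rewrite raddfB /= => /eqP.
  have -> : boundary (lnk u y) = 0.
    by rewrite -[LHS]opprK -lnk_boundary; case: my => _ -> _; rewrite raddf0 oppr0.
  by rewrite sub0r ffunE => /eqP; rewrite oppr_eq0.
have w'u : w' != u by apply: contraNneq aw' => ->; rewrite lu' ?setU11.
have w'v : w' != v by apply: contraNneq aw' => ->; rewrite lv' ?setU11.
have [_ az] := lift_uP aw'.
exists w, w'; split=> //.
- by move: wR; rewrite !inE wu wv.
- rewrite in_z setU11 setU1K; last by rewrite !inE eq_sym (negbTE wv) eqxx andbF.
  by rewrite !inE (negbTE uv) eq_sym (negbTE wu) eqxx.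
rewrite in_z setU11 setU1K; last by rewrite !inE eq_sym (negbTE w'u) eqxx.
by rewrite !inE (negbTE vu) eq_sym (negbTE w'v) eqxx andbF.
Qed.

Let card_lift : {in supp lift_cycle, forall G, #|G| = d}.
Proof.
move=> G Gl; have [/andP[uG vG]|guv] := boolP ((u \in G) && (v \in G)); last first.
  have [_] := lift_edge Gl guv; rewrite contract_imset //.
  case: ifP => vG; last exact: dimy.
  move/dimy <-; rewrite (cardsD1 v G) vG cardsU1 !inE.
  by move: guv; rewrite vG andbT => /negbTE->; rewrite andbF.
have [w [w' [wG _ wy _]]] := lift_uv Gl uG vG.
rewrite -(dimy wy) !cardsU1 !inE eqxx (negbTE wG) !andbF orbF.
have -> : u != w by apply: contraNneq wG => <-.
by rewrite (cardsD1 v G) (cardsD1 u) !inE vG uG uv.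
Qed.

(** The faces of [lift_uv] contain all edges of G except uv, which comes from F0. *)
Let lift_pairs : {in supp lift_cycle, forall G, {in G &, forall x x', skel (supp z) [set x; x']}}.
Proof.
move=> G Gl x x' xG x'G; have [/andP[uG vG]|guv] := boolP ((u \in G) && (v \in G)); last first.
  have [Gz _] := lift_edge Gl guv; exact: skel2 Gz xG x'G.
have [w [w' [_ wz _ w'z]]] := lift_uv Gl uG vG.
have inv t : t \in G -> t != u -> t \in v |: (w |: (G :\ v :\ u)).
  by rewrite !inE => -> ->; rewrite andbT; case: (t == v); rewrite ?orbT.
have inu t : t \in G -> t != v -> t \in u |: (w' |: (G :\ v :\ u)).
  by rewrite !inE => -> ->; rewrite !andbT; case: (t == u); rewrite ?orbT.
have [xu|xu] := eqVneq x u; have [x'u|x'u] := eqVneq x' u.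
- by apply: (skel2 F0z); rewrite ?xu ?x'u.
- have [x'v|x'v] := eqVneq x' v; first by apply: (skel2 F0z); rewrite ?xu ?x'v.
  by apply: (skel2 w'z); apply: inu => //; rewrite xu.
- have [xv|xv] := eqVneq x v; first by apply: (skel2 F0z); rewrite ?x'u ?xv.
  by apply: (skel2 w'z); apply: inu => //; rewrite x'u.
by apply: (skel2 wz); apply: inv.
Qed.

Let lift_exists F' : F' \in supp y -> exists2 G, G \in supp lift_cycle &
  contract u v @: G = F' /\ ~~ ((u \in G) && (v \in G)).
Proof.
move=> F'y; have vF' : v \notin F'.
  by move: F'y; rewrite in_supp; apply: contra => /y_v ->.
have [uF'|uF'] := boolP (u \in F'); last first.
  exists F'; last by rewrite contract_imset // (negbTE vF') (negbTE uF').
  by rewrite in_lift (negbTE vF') (negbTE uF') ffunE (negbTE uF') -in_supp.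
have g0 : lnk u y (F' :\ u) != 0.
  by rewrite ffunE setD11 setD1K // mulf_neq0 ?orient_neq0 // -in_supp.
have [b0|b0] := eqVneq (lift_v (F' :\ u)) 0.
  exists F'; last by rewrite contract_imset // (negbTE vF') andbF.
  by rewrite in_lift (negbTE vF') uF' ffunE [X in _ + X]ffunE b0 subr0.
have vF'u : v \notin F' :\ u by rewrite !inE (negbTE vF') andbF.
exists (v |: (F' :\ u)).
  by rewrite in_lift setU11 setU1K // !inE (negbTE uv) eqxx.
rewrite contract_imset // setU11 setU1K // setD1K //; split=> //.
by rewrite !inE (negbTE uv) eqxx.
Qed.

(** Otherwise every lifted face would be a face of z; by minimality the lift would have the support
    of z, which contains F0. *)
Let lift_has_uv : exists G, [/\ G \in supp lift_cycle, u \in G & v \in G].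
Proof.
have [y0 _ _] := my; have [F' F'y] := supp_neq0 y0.
have [G Gl _] := lift_exists F'y.
have [[H [Hl uH vH]]|h] := boolp.EM (exists G, [/\ G \in supp lift_cycle, u \in G & v \in G]).
  by exists H.
have [z0 bz minz] := mz.
have lz : supp lift_cycle = supp z.
  apply: minz; first exact: boundary_lift.
    by apply/eqP => /supp0P/eqP l0; rewrite l0 inE in Gl.
  apply/subsetP=> H Hl; have [/andP[uH vH]|guv] := boolP ((u \in H) && (v \in H)).
    by case: h; exists H.
  by have [] := lift_edge Hl guv.
by exists F0; rewrite lz.
Qed.

Let lift_cover : {in cover (supp lift_cycle), forall x, contract u v x \in cover (supp y)}.
Proof.
move=> x /bigcupP[G Gl xG].
have [/andP[uG vG]|guv] := boolP ((u \in G) && (v \in G)); last first.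
  have [_ Gy] := lift_edge Gl guv; apply/bigcupP; exists (contract u v @: G) => //.
  exact: imset_f.
have [w [w' [_ _ wy _]]] := lift_uv Gl uG vG.
apply/bigcupP; exists (u |: (w |: (G :\ v :\ u))) => //.
rewrite /contract; case: eqVneq => [_|xv]; first exact: setU11.
by rewrite !inE xv xG andbT; case: eqVneq => //=; rewrite orbT.
Qed.

(* The link of uv in [lift_cycle] is a nonzero cycle of dimension d - 3, hence has at least
   d - 1 vertices. *)
Let lift_neighbours : exists W : {set V}, [/\ #|W|.+2 = d.+1, u \notin W, v \notin W &
  {in W, forall w, exists2 G, G \in supp lift_cycle & [/\ u \in G, v \in G & w \in G]}].
Proof.
have [G [Gl uG vG]] := lift_has_uv.
set R := G :\ v :\ u.
have uvR x : x \in R -> [/\ x != u, x != v & x \in G].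
  by rewrite !inE => /and3P[].
have uR : u \notin R by apply/negP => /uvR[/eqP].
have vR : v \notin R by apply/negP => /uvR[_ /eqP].
have cR : #|R|.+2 = d.
  by rewrite -(card_lift Gl) (cardsD1 v G) (cardsD1 u (G :\ v)) !inE vG uG uv.
(* The bound 2 < d enters here: R has d - 2 elements and must be nonempty. *)
have [x xR] : exists x, x \in R.
  by apply/set0Pn; rewrite -card_gt0; move: hd; rewrite -cR; case: #|R|.
have eR : boundary lift_v R != 0 by move: Gl; rewrite in_lift uG vG.
(* [boundary lift_v] is itself a cycle, so the contribution of R to its boundary at [R :\ x] is
   cancelled by another face, which supplies one more neighbour t. *)
have [t [tR tx et]] : exists t, [/\ t \notin R :\ x, t != x &
    boundary lift_v (t |: (R :\ x)) != 0].
  have := boundary_boundary lift_v => /ffunP/(_ (R :\ x)); rewrite [RHS]ffunE.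
  rewrite boundaryE (bigD1 x) ?setD11 //= setD1K // => /eqP; rewrite addr_eq0 => /eqP h.
  have [t /and3P[h1 h2 h3]|h0] := pickP [pred t | [&& t \notin R :\ x, t != x &
    boundary lift_v (t |: (R :\ x)) != 0]]; first by exists t.
  move: h; rewrite big1 => [/eqP|t /andP[h1 h2]].
    by rewrite oppr0 mulf_eq0 (negbTE eR) (negbTE (orient_neq0 _ _ _)).
  by have /negbT := h0 t; rewrite /= h1 h2 /= negbK => /eqP ->; rewrite mulr0.
have [lu lv] := off_boundary off_lift_v.
have tu : t != u by apply: contraNneq et => ->; rewrite lu ?setU11.
have tv : t != v by apply: contraNneq et => ->; rewrite lv ?setU11.
have tR' : t \notin R by move: tR; rewrite !in_setD1 tx.
pose G' := u |: (v |: (t |: (R :\ x))).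
have G'l : G' \in supp lift_cycle.
  rewrite in_lift !inE !eqxx !orbT /= (_ : G' :\ v :\ u = t |: (R :\ x)) //.
  apply/setP=> s; rewrite !inE; case: (eqVneq s u) => [->|su] /=.
    by rewrite eq_sym (negbTE tu) ?eqxx ?andbF.
  case: (eqVneq s v) => [->|sv] //=.
  by rewrite eq_sym (negbTE tv) ?eqxx ?andbF.
exists (t |: R); split.
- by rewrite cardsU1 tR' add1n -cR.
- by rewrite in_setU1 eq_sym (negbTE tu).
- by rewrite in_setU1 eq_sym (negbTE tv).
move=> w /setU1P[->|wR].
  by exists G' => //; rewrite !inE !eqxx !orbT.
by have [_ _ wG] := uvR w wR; exists G.
Qed.

(** A motion of z is one of the lift, whose edges lie in z. The lift splits the vertex u of y, so
    [vertex_split] pins it at some placement, and [univ] at q. *)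
Lemma lift_rigid m : motion (supp z) q m -> {in supp lift_cycle &, forall F G,
  {in F, forall x, m x = 0} -> {in G, forall x, m x = 0}}.
Proof.
move=> hm F G Fl Gl hF x xG.
have {}hm : motion (supp lift_cycle) q m := motion_pairs hm lift_pairs.
have [y0 _ _] := my; have [F' F'y] := supp_neq0 y0.
have [F1 F1l [F1y guv]] := lift_exists F'y.
have [W [cW uW vW hW]] := lift_neighbours.
have [H [Hl uH vH]] := lift_has_uv.
have pF1 : pinned (supp lift_cycle) F1 q.
  apply: univ; apply: (@vertex_split _ _ (supp lift_cycle) (supp y) q u v W F1) => //.
  - exact: skel2 Hl uH vH.
  - move=> w /hW[H' H'l [uH' vH' wH']].
    by split; [apply: (skel2 H'l)|apply: (skel2 H'l)].
  - by rewrite F1y; exact: piny.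
have pF : pinned (supp lift_cycle) F q.
  by apply: pinned_change pF1; rewrite ?card_lift.
by apply: (pF m hm hF); apply/bigcupP; exists G.
Qed.

End Piece.
End Fogelsanger.

(** * Assembling a cycle from lifts and simplex boundaries *)

Section Assembly.
Variables (V : finType) (k : fieldType) (u v : V).
Local Open Scope ring_scope.
Implicit Types (c z y a b : {ffun {set V} -> k}) (S T F G R : {set V}) (w : V).

Lemma assembleD c c' a a' b b' : assemble u v (c + c') (a + a') (b + b') =
  assemble u v c a b + assemble u v c' a' b'.
Proof.
rewrite /assemble !raddfD /=.
set x := cone v (cone u _); set x' := cone v (cone u _).
by apply/ffunP=> T; rewrite !ffunE; ring.
Qed.

Lemma assemble0 : assemble u v 0 0 0 = 0 :> {ffun {set V} -> k}.
Proof. by rewrite /assemble !raddf0 !addr0. Qed.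

Lemma assemble_sum (I : Type) (r : seq I) (c a b : I -> {ffun {set V} -> k}) :
  assemble u v (\sum_(i <- r) c i) (\sum_(i <- r) a i) (\sum_(i <- r) b i) =
  \sum_(i <- r) assemble u v (c i) (a i) (b i).
Proof.
by elim: r => [|i r IHr]; rewrite ?big_nil ?assemble0 // !big_cons assembleD IHr.
Qed.

Definition single S (x : k) : {ffun {set V} -> k} :=
  [ffun T : {set V} => if T == S then x else 0].

Lemma single_neq0 S x T : single S x T != 0 -> T = S /\ x != 0.
Proof. by rewrite ffunE; case: (T =P S) => [->|_]; rewrite ?eqxx. Qed.

Lemma sum_single c : c = \sum_S single S (c S).
Proof.
apply/ffunP=> T; rewrite sum_ffunE (bigD1 T) //= ffunE eqxx big1 ?addr0 //.
by move=> S ST; rewrite ffunE eq_sym (negbTE ST).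
Qed.

(** Up to sign, x times the boundary of the simplex on u, v and S; the contraction sends it to 0,
    because here a + b = 0. *)
Definition simplex_boundary S x := assemble u v 0 (- single S x) (single S x).

End Assembly.

Section Fogelsanger.
Variables (V : finType) (k : fieldType) (d : nat).
Local Open Scope ring_scope.
Implicit Types (c z y a b : {ffun {set V} -> k}) (S T F G R : {set V}) (u v w : V).

Lemma off_single u v S (x : k) : (x != 0 -> u \notin S /\ v \notin S) ->
  off u v (single S x).
Proof.
move=> h; split=> T xT; apply/eqP; apply: contraTT xT => /single_neq0[-> /h[]] //.
Qed.

Lemma simplex_boundary_cycle u v S (x : k) : u != v ->
  (x != 0 -> u \notin S /\ v \notin S) -> boundary (simplex_boundary u v S x) = 0.
Proof.
move=> uv h; apply: boundary_assemble => //; first by split=> T; rewrite ffunE.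
- by apply: offN; exact: off_single.
- exact: off_single.
by rewrite raddf0 add0r addNr.
Qed.

(** The simplex on u, v, S has all its edges in z: as a and b are nonzero at S, the sets u + S and v
    + S are faces of z, and uv lies in F0. *)
Lemma simplex_boundary_rigid (q : {ffun V -> 'rV[rat]_d.+1}) u v z c a b F0 S (x : k) m :
  (2 < d)%N -> general q -> u != v ->
  z = assemble u v c a b -> off u v c -> off u v a -> off u v b ->
  F0 \in supp z -> u \in F0 -> v \in F0 ->
  {in supp z, forall F, #|F| = d} -> (x != 0 -> a S != 0 /\ b S != 0) ->
  motion (supp z) q m -> {in supp (simplex_boundary u v S x) &, forall F G,
  {in F, forall x, m x = 0} -> {in G, forall x, m x = 0}}.
Proof.
move=> hd gq uv zE oc oa ob F0z uF0 vF0 dimz hx hm F G.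
have [au av] := oa; have [bu bv] := ob.
have hS : x != 0 -> u \notin S /\ v \notin S.
  move=> /hx[a0 _]; split; apply: contraNN a0 => h; first by rewrite au.
  by rewrite av.
have [x0|x0] := eqVneq x 0.
  rewrite in_supp (_ : simplex_boundary _ _ _ _ = 0) ?ffunE ?eqxx //.
  rewrite /simplex_boundary (_ : single S x = 0) ?oppr0 ?assemble0 //.
  by apply/ffunP=> T; rewrite !ffunE x0 if_same.
have [uS vS] := hS x0; have [aS bS] := hx x0.
have vu : v != u by rewrite eq_sym.
have uSz : u |: S \in supp z.
  by rewrite in_supp zE assemble_neq0 // setU11 in_setU1 (negbTE vu) (negbTE vS) setU1K.
have vSz : v |: S \in supp z.
  by rewrite in_supp zE assemble_neq0 // setU11 in_setU1 (negbTE uv) (negbTE uS) setU1K.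
have cS : #|S|.+1 = d by rewrite -(dimz _ uSz) cardsU1 uS.
pose X := u |: (v |: S).
have cX : #|X| = d.+1 by rewrite !cardsU1 !inE negb_or uv uS vS !add1n cS.
have pairs : {in X &, forall s t, skel (supp z) [set s; t]}.
  move=> s t; rewrite !inE.
  have [->|su] := eqVneq s u; have [->|tu] := eqVneq t u => /=.
  - by move=> _ _; exact: (skel2 F0z).
  - have [->|tv] := eqVneq t v => /=; first by move=> _ _; exact: (skel2 F0z).
    by move=> _ tS; apply: (skel2 uSz); rewrite !inE ?eqxx ?tS ?orbT.
  - have [->|sv] := eqVneq s v => /=; first by move=> _ _; exact: (skel2 F0z).
    by move=> sS _; apply: (skel2 uSz); rewrite !inE ?eqxx ?sS ?orbT.
  by move=> hs ht; apply: (skel2 vSz); rewrite !inE.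
have sub H : H \in supp (simplex_boundary u v S x) -> H \subset X /\ #|H| = d.
  rewrite in_supp assemble_neq0 //; last first.
  - exact: off_single.
  - by apply: offN; exact: off_single.
  - by split=> T; rewrite ffunE.
  have [vH|vH] := boolP (v \in H); have [uH|uH] := boolP (u \in H).
  - move=> /boundary_neq0[w wR /single_neq0[RS _]].
    have sH : H \subset X.
      apply/subsetP=> s sH; rewrite /X -RS !inE sH andbT.
      by case: (s == u); case: (s == v); rewrite ?orbT.
    split=> //; move: (congr1 (fun T : {set V} => #|T|.+1) RS); rewrite cS cardsU1 wR.
    by rewrite (cardsD1 v H) (cardsD1 u (H :\ v)) !inE vH uH uv !add1n.
  - move=> /single_neq0[HS _]; split; last by rewrite -cS -HS (cardsD1 v H) vH.
    by rewrite /X -HS setD1K // subsetU1.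
  - rewrite ffunE oppr_eq0 => /single_neq0[HS _]; split.
      by rewrite -(setD1K uH) HS setUS // subsetU1.
    by rewrite (cardsD1 u H) uH HS -cS.
  by rewrite ffunE eqxx.
move=> /sub[FX cF] /sub[GX _] hF t /(subsetP GX).
by apply: (simplex_rigid gq cX FX _ pairs hm hF); rewrite cF.
Qed.

(* Fogelsanger's theorem: induction on the number of vertices by contracting an edge uv
   of z.  Minimal cycles of the contraction lift_cycle to cycles [lift_cycle] containing uv; what
   remains is a combination of boundaries of the simplices on u, v, S for which the
   contraction cancels u+S against v+S. *)
Theorem minimal_cycle_rigid (q : {ffun V -> 'rV[rat]_d.+1}) z :
  (2 < d)%N -> general q ->
  (forall Delta F,
     (exists q' : {ffun V -> 'rV[rat]_d.+1}, pinned Delta F q') -> pinned Delta F q) ->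
  minimal_cycle z -> {in supp z, forall F, #|F| = d} ->
  {in supp z, forall F, pinned (supp z) F q}.
Proof.
move=> hd gq univ; have [n] := ubnP #|cover (supp z)|.
elim: n z => // n IHn z; rewrite ltnS => zn mz dimz.
have [z0 bz _] := mz; have [F0 F0z] := supp_neq0 z0.
have [u uF0 [v vF0 vu]] : exists2 u, u \in F0 & exists2 v, v \in F0 & v != u.
  have [u uF0] : exists u, u \in F0.
    by apply/set0Pn; rewrite -card_gt0 (dimz _ F0z) (ltn_trans _ hd).
  exists u => //; have [v] : exists v, v \in F0 :\ u.
    by apply/set0Pn; rewrite -card_gt0 -(ltn_add2l (u \in F0)) -cardsD1 uF0
      (dimz _ F0z) (ltn_trans _ hd).
  by rewrite !inE => /andP[? ?]; exists v.
have uv : u != v by rewrite eq_sym.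
have [c [a [b [oc oa ob zE abc]]]] := cycle_assemble u v bz.
have [cu cv] := oc; have [au av] := oa; have [bu bv] := ob.
pose g := a + b; pose z' := c + cone u g.
have gu : avoids u g by apply: avoidsD.
have bg : boundary g = 0.
  have := congr1 (@boundary V k) abc; rewrite -addrA -/g raddfD raddf0 /=.
  by rewrite boundary_boundary add0r.
have bz' : boundary z' = 0.
  by rewrite raddfD /= boundary_cone // bg raddf0 subr0 addrA.
have [ys z'E hys] := minimal_cycle_sum bz'.
have z'_v T : T \in supp z' -> v \notin T.
  rewrite in_supp; apply: contraNN => vT; rewrite !ffunE cv // add0r.
  case: ifP => // _; rewrite av ?bv ?addr0 ?mulr0 //; by rewrite !inE vT vu.
have z'_z T : T \in supp z' -> #|T| = d /\ T \subset u |: cover (supp z).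
  move=> Tz'; have vT := z'_v T Tz'.
  have [uT|uT] := boolP (u \in T); last first.
    have Tz : T \in supp z.
      move: Tz'; rewrite !in_supp zE assemble_neq0 // (negbTE vT) (negbTE uT).
      by rewrite 2!ffunE (negbTE uT) addr0.
    split; first exact: dimz.
    by apply/subsetP=> t tT; rewrite in_setU1; apply/orP; right; apply/bigcupP; exists T.
  have vTu : v \notin T :\ u by rewrite !inE (negbTE vT) andbF.
  have : g (T :\ u) != 0.
    move: Tz'; rewrite in_supp 2!ffunE uT cu // add0r mulf_eq0 negb_or.
    by case/andP.
  have [a0|a0 _] := eqVneq (a (T :\ u)) 0; last first.
    have Tz : T \in supp z.
      by rewrite in_supp zE assemble_neq0 // (negbTE vT) uT.
    split; first exact: dimz.
    by apply/subsetP=> t tT; rewrite in_setU1; apply/orP; right; apply/bigcupP; exists T.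
  rewrite ffunE a0 add0r => b0.
  have Tz : v |: (T :\ u) \in supp z.
    by rewrite in_supp zE assemble_neq0 // setU11 !inE (negbTE uv) eqxx /= setU1K.
  split; first by rewrite -(dimz _ Tz) cardsU1 vTu (cardsD1 u T) uT.
  apply/subsetP=> t tT; rewrite in_setU1; case: eqVneq => //= tu.
  by apply/bigcupP; exists (v |: (T :\ u)); rewrite // !inE tu tT orbT.
have u_cov : u \in cover (supp z) by apply/bigcupP; exists F0.
have v_cov : v \in cover (supp z) by apply/bigcupP; exists F0.
have dimy y : y \in ys -> {in supp y, forall F, #|F| = d}.
  by move=> /hys[_ yz'] F /(subsetP yz')/z'_z[].
(* The contraction loses v and gains no vertex, so the induction applies to its minimal pieces. *)
have piny y : y \in ys -> {in supp y, forall F, pinned (supp y) F q}.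
  move=> yys; have [my yz'] := hys y yys; apply: IHn => //; last exact: dimy.
  apply: leq_trans zn; apply: proper_card; apply/properP; split.
    apply/subsetP=> t /bigcupP[T /(subsetP yz')/z'_z[_ /subsetP h] /h].
    by rewrite in_setU1 => /predU1P[->|].
  exists v => //; apply/negP=> /bigcupP[T /(subsetP yz')/z'_v/negP]; exact.
(* What the lifts leave over of b. Their links add up to a + b, so r S is b S where a S + b S = 0,
   and 0 elsewhere. *)
pose r := b - \sum_(y <- ys) lift_v u a b y.
have sum_g : \sum_(y <- ys) lnk u y = g.
  by rewrite -raddf_sum -z'E raddfD /= lnk_cone // lnk_avoids // add0r.
have sum_c : \sum_(y <- ys) del u y = c.
  by rewrite -raddf_sum -z'E raddfD /= del_cone del_id // addr0.
have sum_a : \sum_(y <- ys) lift_u u a b y = a + r.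
  by rewrite sumrB sum_g /r addrA.
have rE S : r S != 0 -> a S != 0 /\ b S != 0.
  rewrite ffunE [X in _ + X]ffunE sum_ffunE.
  rewrite (eq_bigr (fun y => lnk u y S * (b S / (a + b) S))); last first.
    by move=> y _; rewrite ffunE.
  rewrite -mulr_suml -sum_ffunE sum_g -/g.
  have [g0|g0] := eqVneq (g S) 0; last by rewrite mulrC divfK // subrr eqxx.
  rewrite g0 mul0r subr0 => b0; split=> //.
  by move: g0; rewrite ffunE => /eqP; rewrite addr_eq0 => /eqP ->; rewrite oppr_eq0.
have zsum : z = \sum_(y <- [seq lift_cycle u v a b y | y <- ys] ++
    [seq simplex_boundary u v T (r T) | T <- index_enum {set V}]) y.
  rewrite big_cat /= !big_map /lift_cycle /simplex_boundary -!assemble_sum sum_c sum_a.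
  rewrite big1_eq sumrN -sum_single -assembleD addr0 addrK [_ + r]addrC /r subrK.
  exact: zE.
have rS S : r S != 0 -> u \notin S /\ v \notin S.
  move=> /rE[a0 _]; split; apply: contraNN a0 => h; first by rewrite au.
  by rewrite av.
apply: (glue_pieces mz zsum) => [y|y m]; rewrite mem_cat.
  case/orP => /mapP[y' h ->]; last by apply: simplex_boundary_cycle => //; exact: rS.
  have [my yz'] := hys y' h.
  exact: (boundary_lift uv oc oa ob my yz').
case/orP => /mapP[y' h ->] hm.
  have [my yz'] := hys y' h.
  exact: (lift_rigid hd gq uv univ mz zE oc oa ob F0z uF0 vF0 my yz' (dimy _ h) (piny _ h) hm).
exact: (simplex_boundary_rigid hd gq uv zE oc oa ob F0z uF0 vF0 dimz (@rE y') hm).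
Qed.

End Fogelsanger.

(** * Cohen-Macaulay complexes *)

Section LinksDeletions.
Variable V : finType.
Implicit Types (K L : {set {set V}}) (S T F G : {set V}) (v w : V).

Lemma in_link K T S : (S \in link K T) = [&& S \in K, T :&: S == set0 & T :|: S \in K].
Proof. by rewrite inE. Qed.

Lemma link0 K : link K set0 = K.
Proof. by apply/setP=> S; rewrite in_link set0I eqxx set0U andbb. Qed.

Lemma simplicial_link K T : simplicial_complex K -> T \in K -> simplicial_complex (link K T).
Proof.
move=> [K0 Kc] TK; split; first by rewrite in_link K0 setI0 eqxx setU0.
move=> S S'; rewrite !in_link => /and3P[SK TS TSK] sS; apply/and3P; split.
- exact: Kc SK sS.
- by rewrite -subset0 -(eqP TS) setIS.
- by apply: Kc TSK _; rewrite setUS.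
Qed.

Lemma link_link K T S : simplicial_complex K -> S \in link K T ->
  link (link K T) S = link K (T :|: S).
Proof.
move=> [K0 Kc]; rewrite in_link => /and3P[SK /eqP TS TSK].
apply/setP=> U; rewrite !in_link setIUl setU_eq0 setIUr TS set0U setUA.
apply/idP/idP => [/andP[/and3P[-> -> _] /and4P[-> _ _ ->]] //|].
move=> /and3P[-> /andP[TU ->] h]; rewrite TU h /= andbT.
rewrite (Kc _ _ h) //=; last by rewrite setSU // subsetUl.
by rewrite (Kc _ _ h) // setSU // subsetUr.
Qed.

Lemma simplicial_deletion K v : simplicial_complex K -> simplicial_complex (deletion K v).
Proof.
move=> [K0 Kc]; split; first by rewrite !inE K0.
move=> S S'; rewrite !inE => /andP[SK vS] sS; rewrite (Kc _ _ SK sS) /=.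
by apply: contra vS; apply: (subsetP sS).
Qed.

Lemma deletion_link K v w : v != w ->
  deletion (link K [set v]) w = link (deletion K w) [set v].
Proof.
move=> vw; apply/setP=> S; rewrite !inE [w == v]eq_sym (negbTE vw) /=.
by case: (S \in K); case: (_ == set0); case: (_ \in K); case: (w \in S).
Qed.

Lemma card_le_dim K S : S \in K -> #|S| <= dim_succ K.
Proof. by move=> SK; rewrite /dim_succ (bigD1 S) //= leq_maxl. Qed.

Lemma pure_facet K S : pure K -> S \in K ->
  exists F, [/\ F \in K, S \subset F & #|F| = dim_succ K].
Proof.
move=> pK SK; have [F mF SF] := @maxset_exists _ (fun T => T \in K) S SK.
by exists F; split=> //; [have [] := maxsetP mF|exact: pK].
Qed.

Lemma card_link_face K T S : S \in link K T -> #|T :|: S| = #|T| + #|S|.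
Proof. by rewrite in_link => /and3P[_ /eqP TS _]; rewrite cardsU TS cards0 subn0. Qed.

Lemma link_compl K T F : simplicial_complex K -> F \in K -> T \subset F ->
  F :\: T \in link K T.
Proof.
move=> [_ Kc] FK TF; rewrite in_link (Kc _ _ FK) ?subsetDl //=.
by rewrite setIDA setIC -setIDA setDv setI0 eqxx /= -{1}(setIidPr TF) setID.
Qed.

Lemma dim_link K T : simplicial_complex K -> pure K -> T \in K ->
  #|T| + dim_succ (link K T) = dim_succ K.
Proof.
move=> sK pK TK; have [F [FK TF cF]] := pure_facet pK TK.
have cl : dim_succ (link K T) = #|F :\: T|.
  apply/eqP; rewrite eqn_leq; apply/andP; split; last first.
    by apply: card_le_dim; exact: link_compl.
  apply/bigmax_leqP => S SL; rewrite -(leq_add2l #|T|) -(card_link_face SL).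
  have TSK : T :|: S \in K by move: SL; rewrite in_link => /and3P[].
  rewrite (leq_trans (card_le_dim TSK)) // -cF -[X in X <= _](cardsID T F).
  by rewrite (setIidPr TF).
by rewrite cl -cF -(cardsID T F) (setIidPr TF).
Qed.

Lemma pure_link K T : simplicial_complex K -> pure K -> T \in K -> pure (link K T).
Proof.
move=> sK pK TK S /maxsetP[SL mS].
have TSK : T :|: S \in K by move: SL; rewrite in_link => /and3P[].
have [F [FK TSF cF]] := pure_facet pK TSK.
have TF : T \subset F := subset_trans (subsetUl _ _) TSF.
have <- : F :\: T = S.
  apply: mS; first exact: link_compl.
  apply/subsetP=> x xS; rewrite inE (subsetP TSF) ?inE ?xS ?orbT // andbT.
  move: SL; rewrite in_link => /and3P[_ /eqP TS _]; apply/negP=> xT.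
  by have := in_set0 x; rewrite -TS inE xT xS.
have := dim_link sK pK TK; rewrite -cF -(cardsID T F) (setIidPr TF).
by move/eqP; rewrite eqn_add2l => /eqP.
Qed.

End LinksDeletions.

(** * Homology of links and deletions *)

Section CohenMacaulay.
Variables (V : finType) (k : fieldType).
Implicit Types (K L : {set {set V}}) (S T F G : {set V}) (v w : V).
Implicit Types (z y : {ffun {set V} -> k}).

Lemma cohen_macaulay_link K T : simplicial_complex K -> cohen_macaulay k K ->
  T \in K -> cohen_macaulay k (link K T).
Proof.
move=> sK [pK hK] TK; split; first exact: pure_link.
move=> S SL; rewrite link_link //; apply: hK.
by move: SL; rewrite in_link => /and3P[].
Qed.

(** Deleting w commutes with taking the link of v, so the link inherits homology and dimension from
    [deletion K w]. *)
Lemma doubly_cohen_macaulay_link K v : simplicial_complex K ->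
  doubly_cohen_macaulay k K -> [set v] \in K ->
  [/\ simplicial_complex (link K [set v]), doubly_cohen_macaulay k (link K [set v])
    & (dim_succ (link K [set v])).+1 = dim_succ K].
Proof.
move=> sK [cK hK] vK.
have dimL : (dim_succ (link K [set v])).+1 = dim_succ K.
  by rewrite -(dim_link sK _ vK) ?cards1 //; case: cK.
split=> //; first exact: simplicial_link.
split; first exact: cohen_macaulay_link.
move=> w; rewrite in_link => /and3P[wK vw _].
have {}vw : v != w.
  by apply: contraTneq vw => ->; rewrite setIid -card_gt0 cards1.
have [cKw dKw] := hK w wK.
have vKw : [set v] \in deletion K w by rewrite inE vK inE eq_sym.
have sKw := simplicial_deletion w sK.
rewrite deletion_link //; split; first exact: cohen_macaulay_link.
apply: succn_inj; rewrite dimL -dKw.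
by rewrite -(dim_link sKw _ vKw) ?cards1 //; case: cKw.
Qed.

Local Open Scope ring_scope.

Lemma boundary_point v : boundary (single [set v] 1) = single set0 1 :> {ffun {set V} -> k}.
Proof.
have -> : single [set v] 1 = cone v (single set0 1) :> {ffun {set V} -> k}.
  apply/ffunP=> T; rewrite !ffunE; case: ifP => [/eqP->|].
    by rewrite inE eqxx setDv eqxx orient_set0 mulr1.
  case: ifP => vT // Tv; rewrite ifF ?mulr0 //.
  by apply: contraFF Tv => /eqP h; rewrite -(setD1K vT) h setU0.
rewrite boundary_cone; last by move=> T vT; rewrite ffunE; case: eqP vT => // ->; rewrite inE.
have -> : boundary (single set0 1) = 0 :> {ffun {set V} -> k}; last by rewrite raddf0 subr0.
apply/ffunP=> T; rewrite boundaryE big1 ?ffunE // => w _.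
by rewrite ffunE (negbTE (_ : w |: T != set0)) ?mulr0 //; apply/set0Pn; exists w; rewrite setU11.
Qed.

(** Vanishing homology in dimension 0 gives a 1-chain w with boundary a - b. No edge leaves X, so
    the part of w inside X would have boundary a alone, which is not a reduced cycle. *)
Lemma cohen_macaulay_connected K (X : {set V}) a b : simplicial_complex K ->
  cohen_macaulay k K -> (2 <= dim_succ K)%N ->
  (forall s t, [set s; t] \in K -> s \in X -> t \in X) ->
  [set a] \in K -> [set b] \in K -> a \in X -> b \in X.
Proof.
move=> sK [_ hK] dK closed aK bK aX; apply/negPn/negP => bX.
have [||||w cw bw] := hK set0 _ 1%N _ (single [set a] 1 - single [set b] 1).
- by case: sK.
- by rewrite link0.
- rewrite link0 => T; rewrite !ffunE => h.
  have [/eqP ->|Ta] := boolP (T == [set a]); first by rewrite aK cards1.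
  have [/eqP ->|Tb] := boolP (T == [set b]); first by rewrite bK cards1.
  by move: h; rewrite (negbTE Ta) (negbTE Tb) subrr eqxx.
- by rewrite raddfB /= !boundary_point subrr.
rewrite link0 in cw.
pose wX : {ffun {set V} -> k} := [ffun T : {set V} => if T \subset X then w T else 0].
suff : boundary wX = single [set a] 1.
  move=> /(congr1 (@boundary V k)); rewrite boundary_boundary boundary_point.
  by move=> /ffunP/(_ set0)/eqP; rewrite !ffunE eqxx eq_sym oner_eq0.
apply/ffunP=> T; have [TX|TX] := boolP (T \subset X); last first.
  rewrite boundaryE big1 ?ffunE => [|v vT].
    by case: eqP TX => // ->; rewrite sub1set aX.
  by rewrite ffunE subUset (negbTE TX) andbF mulr0.
rewrite -[RHS]subr0 -[X in _ - X](_ : single [set b] 1 T = 0); last first.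
  by rewrite ffunE; case: eqP TX => // ->; rewrite sub1set (negbTE bX).
rewrite -[RHS](_ : (single [set a] 1 - single [set b] 1) T = _); last by rewrite !ffunE.
rewrite -bw !boundaryE; apply: eq_bigr => v vT; congr (_ * _).
rewrite ffunE; case: ifP => // /negP vTX; apply/esym/eqP/negP => /negP w0.
have /andP[vTK] := cw _ w0; rewrite cardsU1 vT eqSS => /cards1P[t Tt].
apply: vTX; rewrite subUset TX andbT sub1set.
apply: (closed t); last by move: TX; rewrite Tt sub1set.
by rewrite setUC -Tt.
Qed.

Lemma extend_link_cycle K v d y : simplicial_complex K -> doubly_cohen_macaulay k K ->
  dim_succ K = d.+1 -> [set v] \in K -> chain (link K [set v]) d y -> boundary y = 0 ->
  exists z, [/\ chain K d.+1 z, boundary z = 0 & lnk v z = y].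
Proof.
move=> sK [_ hK] dK vK cy by0; have [[_ hD] dD] := hK v vK.
have [sD0 _] := simplicial_deletion v sK.
have av : avoids v y.
  move=> T vT; apply/eqP; apply: contraTT vT => /cy/andP[]; rewrite in_link.
  move=> /and3P[_ /eqP vT _] _; apply/negP=> vT'.
  by have := in_set0 v; rewrite -vT !inE eqxx vT'.
(* Since K - v has the dimension of K, the cycle y lies one dimension below its top, where homology
   vanishes. *)
have [|||w cw bw] := hD set0 sD0 d _ y.
- by rewrite link0 dD dK.
- rewrite link0 => T T0; have /andP[] := cy T T0; rewrite in_link => /and3P[TK _ _] ->.
  by rewrite inE TK andbT; apply: contra T0 => /av ->.
- by [].
rewrite link0 in cw.
have aw : avoids v w.
  by move=> T vT; apply/eqP; apply: contraTT vT => /cw/andP[]; rewrite inE => /andP[].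
exists (cone v y - w); split.
- move=> T; rewrite !ffunE; case: ifP => [vT|_]; last first.
    by rewrite sub0r oppr_eq0 => /cw/andP[]; rewrite inE => /andP[-> _] ->.
  rewrite (aw T vT) subr0 mulf_eq0 negb_or => /andP[_ /cy/andP[]].
  rewrite in_link setD1K // => /and3P[_ _ ->] /eqP <-.
  by rewrite (cardsD1 v T) vT add1n eqxx.
- by rewrite raddfB /= boundary_cone // by0 raddf0 subr0 bw subrr.
by rewrite raddfB /= lnk_cone // lnk_avoids // subr0.
Qed.

(* Induction on the dimension: a minimal cycle of the link of v extends to a cycle of
   K, one of whose minimal summands restricts to it. *)
Lemma facets_connected d K (J : pred {set V}) : simplicial_complex K ->
  doubly_cohen_macaulay k K -> dim_succ K = d.+1 ->
  (forall z, minimal_cycle z -> chain K d.+1 z -> {in supp z &, forall F G, J F -> J G}) ->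
  forall F G, F \in K -> #|F| = d.+1 -> G \in K -> #|G| = d.+1 -> J F -> J G.
Proof.
elim: d K J => [|d IHd] K J sK dcK dK closed F G FK cF GK cG JF.
  move/eqP/cards1P: cF => [a Fa]; move/eqP/cards1P: cG => [b Gb].
  have [<-//|FG] := eqVneq F G.
  (* The difference of two points is a cycle; evaluating boundaries at the empty face shows that a
     minimal cycle inside it contains both. *)
  pose z : {ffun {set V} -> k} := single F 1 - single G 1.
  have z0 : z != 0.
    apply/eqP=> /ffunP/(_ F)/eqP; rewrite !ffunE eqxx (negbTE FG) subr0.
    by rewrite oner_eq0.
  have bz : boundary z = 0.
    by rewrite raddfB /= Fa Gb !boundary_point subrr.
  have [y my yz] := minimal_cycle_exists bz z0.
  have zFG T : T \in supp z -> T = F \/ T = G.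
    rewrite in_supp !ffunE; case: (T =P F) => [|_]; first by left.
    by case: (T =P G) => [|_]; [right|rewrite subrr eqxx].
  have [y0 by0 _] := my.
  have yFG : y F + y G = 0.
    have := congr1 (fun c : {ffun {set V} -> k} => c set0) by0.
    rewrite boundaryE [RHS]ffunE => <-.
    have ab : a != b by apply: contraNneq FG => ab; rewrite Fa Gb ab.
    rewrite (bigD1 a) ?inE //= (bigD1 b) ?inE 1?eq_sym //= !orient_set0 !mul1r !setU0 -Fa -Gb.
    rewrite big1 ?addr0 // => t /andP[/andP[_ ta] tb].
    rewrite setU0 orient_set0 mul1r; apply/notin_supp/negP => /(subsetP yz)/zFG.
    by rewrite Fa Gb => -[] /set1_inj/eqP; rewrite ?(negbTE ta) ?(negbTE tb).
  have [H Hy] := supp_neq0 y0.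
  have yF : y F != 0.
    have [HF|HG] := zFG H (subsetP yz _ Hy); first by rewrite -HF -in_supp.
    apply: contraTneq Hy => yF; rewrite in_supp HG.
    by move: yFG; rewrite yF add0r => ->; rewrite eqxx.
  have yG : y G != 0.
    by apply: contraNneq yF => yG; move: yFG; rewrite yG addr0 => ->.
  apply: (closed y my _ F G); rewrite ?in_supp // => T; rewrite -in_supp.
  by move=> /(subsetP yz)/zFG[]->; rewrite ?FK ?GK ?Fa ?Gb ?cards1.
have star v F' G' : v \in F' -> v \in G' -> F' \in K -> #|F'| = d.+2 ->
    G' \in K -> #|G'| = d.+2 -> J F' -> J G'.
  move=> vF vG F'K cF' G'K cG' JF'.
  have [K0 Kc] := sK.
  have vK : [set v] \in K by apply: Kc F'K _; rewrite sub1set.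
  have [sL dcL dL] := doubly_cohen_macaulay_link sK dcK vK.
  rewrite -(setD1K vG).
  apply: (IHd (link K [set v]) (fun T => J (v |: T)) sL dcL _ _ (F' :\ v)).
  - by apply: succn_inj; rewrite dL.
  - move=> y my cy S S' Sy S'y JS.
    have [y0 by0 miny] := my.
    have [z [cz bz zy]] := extend_link_cycle sK dcK dK vK cy by0.
    have [zs zE hzs] := minimal_cycle_sum bz.
    (* Minimality of y forces the link at v of such a summand x to have all of [supp y] as
       support. *)
    have [x xzs lx0] : exists2 x, x \in zs & lnk v x != 0.
      have [[x [? ?]]|h] := boolp.EM (exists x, x \in zs /\ lnk v x != 0).
        by exists x.
      case/negP: y0; rewrite -zy zE raddf_sum big_seq big1 // => x xzs.
      by apply/eqP/negPn/negP => lx; apply: h; exists x.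
    have [mx xz] := hzs x xzs; have [_ bx _] := mx.
    have sx : supp (lnk v x) = supp y.
      apply: miny => //; first by rewrite -[LHS]opprK -lnk_boundary bx raddf0 oppr0.
      apply/subsetP=> T; rewrite -zy !in_supp !ffunE.
      case: ifP => // _; rewrite !mulf_eq0 !negb_or orient_neq0 /= => h.
      by have := subsetP xz (v |: T); rewrite !in_supp; apply.
    have inx T : T \in supp y -> v |: T \in supp x.
      rewrite -sx !in_supp ffunE; case: ifP => _; first by rewrite eqxx.
      by rewrite mulf_eq0 negb_or => /andP[].
    apply: (closed x mx _ (v |: S)); rewrite ?inx // => T; rewrite -in_supp.
    by move=> /(subsetP xz); rewrite in_supp; exact: cz.
  - by apply: link_compl; rewrite ?sub1set.
  - by move: cF'; rewrite (cardsD1 v) vF => -[].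
  - by apply: link_compl; rewrite ?sub1set.
  - by move: cG'; rewrite (cardsD1 v) vG => -[].
  - by rewrite setD1K.
(* The vertices all of whose facets satisfy J; since each edge lies in a facet, [star] closes this
   set along edges. *)
pose X := [set v | [forall H in K, (v \in H) && (#|H| == d.+2) ==> J H]].
have XP v : reflect (forall H, H \in K -> v \in H -> #|H| = d.+2 -> J H) (v \in X).
  rewrite inE; apply: (iffP forall_inP) => h H HK.
    by move=> vH cH; have := h H HK; rewrite vH cH eqxx.
  by apply/implyP=> /andP[vH /eqP cH]; exact: h.
have [a aF] : exists a, a \in F by apply/set0Pn; rewrite -card_gt0 cF.
have [b bG] : exists b, b \in G by apply/set0Pn; rewrite -card_gt0 cG.
have [_ Kc] := sK.
suff /XP : b \in X by exact.
apply: (@cohen_macaulay_connected K X a b) => //.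
- by case: dcK.
- by rewrite dK.
- move=> s t stK /XP sX; apply/XP => H HK tH cH.
  have [pK _] := dcK.1; have [H' [H'K stH' cH']] := pure_facet pK stK.
  apply: (star t H' H) => //; rewrite ?cH' //.
    by rewrite (subsetP stH') // !inE eqxx orbT.
  by apply: sX; rewrite ?cH' // (subsetP stH') // !inE eqxx.
- by apply: Kc FK _; rewrite sub1set.
- by apply: Kc GK _; rewrite sub1set.
by apply/XP => H HK aH cH; apply: (star a F H).
Qed.

End CohenMacaulay.

(** * Lower bounds for face numbers *)

Section EdgeBound.
Variable V : finType.
Implicit Types (K Delta : {set {set V}}) (S T F G : {set V}) (v w : V).

Lemma cinj_card_sub (I J : finType) (c : I -> J -> rat) (B : {set J}) :
  (forall m, {in B, forall j, \sum_i m i * c i j = 0}%R -> forall i, m i = 0%R) ->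
  #|I| <= #|B|.
Proof.
move=> h; have := @cinj_card I {j | j \in B} (fun i j => c i (val j)).
rewrite card_sig; apply=> m hm; apply: h => j jB.
exact: (hm (exist _ j jB)).
Qed.

(** Once m is pinned on F, the equations of faces inside F hold by themselves; the other equations
    and the coordinates set to 0 must still outnumber the unknowns. *)
Lemma pinned_edge_count D Delta F (q : {ffun V -> 'rV[rat]_D}) : F \in Delta ->
  pinned Delta F q ->
  #|cover Delta| * D + #|[set S : {set V} | [&& S != set0, #|S| <= 2 & S \subset F]]| <=
  #|[set S : {set V} | (S != set0) && skel Delta S]| + #|F| * D.
Proof.
move=> FD pF.
pose A := [set S : {set V} | [&& S != set0, skel Delta S & ~~ (S \subset F)]].
pose P := [set a | (a \in F) || (a \notin cover Delta)].
pose B : {set {set V} + V * 'I_D} :=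
  (@inl _ (V * 'I_D)%type @: A) :|: (@inr {set V} _ @: setX P [set: 'I_D]).
have cB : #|B| = #|A| + #|P| * D.
  rewrite cardsU (_ : _ :&: _ = set0) ?cards0 ?subn0.
    by rewrite !card_imset ?cardsX ?cardsT ?card_ord // => x y [].
  apply/setP=> j; rewrite !inE; apply/negbTE/negP => /andP[/imsetP[x _ ->] /imsetP[y _]].
  by [].
have FV : F \subset cover Delta by apply: (bigcup_max F).
have cP : #|P| + #|cover Delta| = #|F| + #|V|.
  rewrite (_ : P = F :|: ~: cover Delta); last by apply/setP=> a; rewrite !inE.
  rewrite cardsU (_ : _ :&: _ = set0) ?cards0 ?subn0.
    by rewrite -addnA [#|~: _| + _]addnC cardsC.
  by apply/eqP; rewrite setI_eq0 disjoints_subset setCK.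
have cA : #|A| + #|[set S : {set V} | [&& S != set0, #|S| <= 2 & S \subset F]]| =
    #|[set S : {set V} | (S != set0) && skel Delta S]|.
  rewrite -(cardsID [set S : {set V} | S \subset F]
    [set S : {set V} | (S != set0) && skel Delta S]) addnC.
  congr (_ + _); apply: eq_card => S; rewrite !inE.
    rewrite /skel -!andbA; congr (_ && (_ && _)); apply/idP/idP => [SF|/andP[] //].
    by rewrite SF andbT; apply/exists_inP; exists F.
  by case: (S != set0); case: (skel _ _); case: (S \subset F).
have h : #|{: V * 'I_D}| <= #|B|.
  move/pinnedP: pF => injF; apply: (@cinj_card_sub _ _ (coef Delta F q)) => m hm.
  have pin l : l.1 \in P -> m l = 0%R.
    move=> lP; have := hm (inr l); rewrite /= sum_delta; move: (lP); rewrite inE => ->.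
    by apply; rewrite inE; apply/orP; right; apply: imset_f; rewrite !inE in lP *; rewrite lP.
  apply: injF => -[S|l]; last first.
    rewrite /= sum_delta; case: ifP => // lP; by apply: pin; rewrite inE.
  have [SA|] := boolP (S \in A).
    by apply: hm; rewrite inE imset_f.
  rewrite /=; have [hS|nS] /= := boolP (skel Delta S); last first.
    by rewrite big1 // => i _; rewrite mulr0.
  rewrite inE hS /= negb_and !negbK => SF; apply: big1 => i _.
  case: ifP => iS; last by rewrite mulr0.
  rewrite pin ?mul0r // inE; case/orP: SF => [/eqP S0|/subsetP SF]; last by rewrite SF.
  by rewrite S0 inE in iS.
move: h; rewrite card_prod card_ord cB; nia.
Qed.

Lemma card_vertices K : #|[set v | [set v] \in K]| = fnum K 0.
Proof.
rewrite -(card_imset _ (@set1_inj V)); apply: eq_card => S; rewrite inE.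
apply/imsetP/andP => [[a]|[SK /cards1P[a Sa]]].
  by rewrite inE => aK ->; rewrite cards1.
by exists a; rewrite // inE -Sa.
Qed.

Lemma edge_bound d K (k : fieldType) : 2 < d -> simplicial_complex K ->
  doubly_cohen_macaulay k K -> dim_succ K = d ->
  d * fnum K 0 <= fnum K 1 + 'C(d.+1, 2).
Proof.
move=> d3 sK dcK dK; have [pK _] := dcK.1.
have [q [gq univ]] := universal_placement V d.+1.
pose Delta := [set F in K | #|F| == d].
have [K0 Kc] := sK.
have skelK S : skel Delta S = (#|S| <= 2) && (S \in K).
  rewrite /skel; congr (_ && _); apply/exists_inP/idP => [[F]|SK].
    by rewrite inE => /andP[FK _] SF; exact: Kc FK SF.
  have [F [FK SF cF]] := pure_facet pK SK.
  by exists F => //; rewrite inE FK cF dK eqxx.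
have [F [FK _ cF]] := pure_facet pK K0; rewrite dK in cF.
have FD : F \in Delta by rewrite inE FK cF eqxx.
have coverE : cover Delta = [set a | [set a] \in K].
  apply/setP=> a; rewrite inE; apply/bigcupP/idP => [[G]|aK].
    by rewrite inE => /andP[GK _] aG; apply: Kc GK _; rewrite sub1set.
  have [G [GK aG cG]] := pure_facet pK aK.
  by exists G; [rewrite inE GK cG dK eqxx|rewrite -sub1set].
have pF : pinned Delta F q.
  move=> m hm hF a /bigcupP[G]; rewrite inE => /andP[GK /eqP cG].
  pose J (H : {set V}) := [forall b in H, m b == 0%R].
  have JP (H : {set V}) : reflect {in H, forall b, m b = 0%R} (J H).
    by apply: (iffP forall_inP) => h b /h /eqP.
  apply/JP; have [d' dd'] : exists d', d = d'.+1 by exists d.-1; lia.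
  apply: (@facets_connected V k d' K J sK dcK _ _ F) => //; rewrite -?dd' //; last exact/JP.
  move=> z mz cz H H' Hz H'z /JP hH; apply/JP => b bH'.
  have dimz : {in supp z, forall T, #|T| = d}.
    by move=> T; rewrite in_supp => /cz/andP[_ /eqP].
  apply: (@minimal_cycle_rigid _ _ _ q z d3 gq _ mz dimz H Hz m) => //.
    move=> S /andP[cS /exists_inP[T Tz ST]]; apply: hm; rewrite skelK cS /=.
    by move: Tz; rewrite in_supp => /cz/andP[TK _]; exact: Kc TK ST.
  by apply/bigcupP; exists H'.
(* With D = d + 1 and n vertices the count reads (d + 1) n + d + C(d, 2) <= n + f_1 + d (d + 1). *)
have := pinned_edge_count FD pF; rewrite coverE cF card_vertices.
have -> : #|[set S : {set V} | (S != set0) && skel Delta S]| = fnum K 0 + fnum K 1.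
  rewrite /fnum -cardsUI [X in _ + X](_ : _ = 0) ?addn0; last first.
    by apply: eq_card0 => S; rewrite !inE; case: (#|S| =P 1) => [->|]; rewrite ?andbF.
  apply: eq_card => S; rewrite !inE skelK -card_gt0.
  by case: (S \in K); rewrite ?andbF ?andbT //; case: #|S| => [|[|[|]]].
have -> : #|[set S : {set V} | [&& S != set0, #|S| <= 2 & S \subset F]]| = d + 'C(d, 2).
  rewrite -[X in X + _]bin1 -cF -!cards_draws.
  rewrite -cardsUI [X in _ = _ + X](_ : _ = 0) ?addn0; last first.
    by apply: eq_card0 => S; rewrite !inE; case: (#|S| =P 1) => [->|]; rewrite ?andbF.
  apply: eq_card => S; rewrite !inE -card_gt0.
  by case: (S \subset F); rewrite ?andbF //=; case: #|S| => [|[|[|]]].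
rewrite binS bin1.
have : 2 * 'C(d, 2) = d * d.-1 by rewrite -mul_bin_diag bin1 mulnC.
nia.
Qed.

End EdgeBound.

(** * From edges to faces of all dimensions *)

Section FaceNumbers.
Variables (V : finType) (k : fieldType).
Implicit Types (K : {set {set V}}) (S T F : {set V}) (v w : V).

Lemma fnum_link K v i : simplicial_complex K ->
  fnum (link K [set v]) i = #|[set T in K | (#|T| == i.+2) && (v \in T)]|.
Proof.
move=> [_ Kc]; rewrite /fnum.
have vS S : S \in link K [set v] -> v \notin S.
  rewrite in_link => /and3P[_ /eqP vS _]; apply/negP=> h.
  by have := in_set0 v; rewrite -vS !inE eqxx h.
rewrite -(@card_in_imset _ _ (fun S => v |: S)); last first.
  move=> S S'; rewrite !inE -!in_link => /andP[/vS h _] /andP[/vS h' _] e.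
  by rewrite -(setU1K h) e setU1K.
apply: eq_card => T; rewrite inE; apply/imsetP/and3P => [[S]|[TK /eqP cT vT]].
  rewrite inE => /andP[SL /eqP cS] ->; rewrite cardsU1 vS // cS setU11.
  by move: SL; rewrite in_link => /and3P[].
exists (T :\ v); last by rewrite setD1K.
rewrite inE in_link setD1K // TK (Kc _ _ TK) ?subD1set //=.
rewrite (_ : _ :&: _ == set0); last first.
  by apply/eqP/setP=> x; rewrite !inE; case: (x == v).
by rewrite -eqSS -cT [in X in _ == X](cardsD1 v T) vT /= add1n.
Qed.

Lemma sum_fnum_link K i : simplicial_complex K ->
  \sum_v fnum (link K [set v]) i = i.+2 * fnum K i.+1.
Proof.
move=> sK; under eq_bigr => v _ do rewrite fnum_link // -sum1dep_card.
rewrite (exchange_big_dep (fun T => (T \in K) && (#|T| == i.+2))) /=; last first.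
  by move=> v T _ /and3P[-> -> _].
rewrite mulnC /fnum -sum1dep_card big_distrl /=; apply: eq_bigr => T /andP[TK cT].
rewrite mul1n sum1dep_card -(eqP cT); apply: eq_card => v.
by rewrite inE TK eqxx.
Qed.

Lemma fnum_link_non_vertex K v i : simplicial_complex K -> [set v] \notin K ->
  fnum (link K [set v]) i = 0.
Proof.
move=> sK vK; rewrite fnum_link //; apply: eq_card0 => T; rewrite inE.
apply: contraNF vK => /and3P[TK _ vT]; have [_ Kc] := sK.
by apply: Kc TK _; rewrite sub1set.
Qed.

(** Double counting: the sums over vertex links are 2 f_1 and (i + 2) f_(i+1). *)
Lemma sum_link_bound K i A B : simplicial_complex K ->
  (forall v, [set v] \in K ->
     A * fnum (link K [set v]) 0 <= fnum (link K [set v]) i + B) ->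
  A * (2 * fnum K 1) <= i.+2 * fnum K i.+1 + fnum K 0 * B.
Proof.
move=> sK h; rewrite -!sum_fnum_link // big_distrr /= -card_vertices.
rewrite -sum1dep_card big_distrl /= [X in _ + X]big_mkcond -big_split /=.
apply: leq_sum => v _; case: ifP => [/h|/negbT vK]; first by rewrite mul1n.
by rewrite !fnum_link_non_vertex // muln0.
Qed.

(** Deleting an only vertex would lower the dimension. *)
Lemma two_vertices K : doubly_cohen_macaulay k K -> dim_succ K = 1 -> 2 <= fnum K 0.
Proof.
move=> [[pK _] hK] dK; rewrite -card_vertices.
have vertex (L : {set {set V}}) : L \subset K -> dim_succ L = 1 ->
    exists2 v, [set v] \in K & [set v] \in L.
  move=> LK dL; have [S SL cS] : exists2 S, S \in L & 0 < #|S|.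
    apply/exists_inP; apply: contraT => /exists_inPn h.
    suff : dim_succ L <= 0 by rewrite dL.
    by apply/bigmax_leqP => S /h; rewrite lt0n negbK => /eqP->.
  have : #|S| == 1 by rewrite eqn_leq cS -dL card_le_dim.
  by move/cards1P=> [v Sv]; exists v; rewrite -Sv // (subsetP LK).
have [v vK _] := vertex K (subxx _) dK.
have [cD dD] := hK v vK; rewrite dK in dD.
have [|w wK] := vertex (deletion K v) _ dD.
  by apply/subsetP=> S; rewrite inE => /andP[].
rewrite !inE wK /= eq_sym => wv.
rewrite (cardsD1 v) (cardsD1 w) !inE vK wK wv /=; lia.
Qed.

(** The induction passes to vertex links and so starts at d = 2, where the top bound reads f_1 >= n:
    by [two_vertices] every vertex of a 2-CM graph has at least two neighbours. *)
Lemma fnum_lower_bound d K i : 1 < d -> i < d -> simplicial_complex K ->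
  doubly_cohen_macaulay k K -> dim_succ K = d -> stacked_fnum (fnum K 0) d i <= fnum K i.
Proof.
elim: d K i => // d IHd K i d1 id sK dcK dK.
case: i id => [|i] id.
  by rewrite /stacked_fnum ifF ?bin0 ?mul1n ?muln0 ?subn0 //; lia.
have linkb v : [set v] \in K -> 1 < d -> i < d ->
    stacked_fnum (fnum (link K [set v]) 0) d i <= fnum (link K [set v]) i.
  move=> vK d2 id'; have [sL dcL dL] := doubly_cohen_macaulay_link sK dcK vK.
  by apply: IHd => //; apply: succn_inj; rewrite dL.
have [d3|] := ltnP 2 d.+1; last first.
  move=> d2; have {d1 d2}d1 : d = 1 by lia.
  subst d; have i0 : i = 0 by lia.
  subst i; rewrite /stacked_fnum eqxx /= !subn1 subnn muln0 subn0 mul1n.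
  have h : forall v, [set v] \in K -> 2 <= fnum (link K [set v]) 0.
    move=> v vK; have [sL dcL dL] := doubly_cohen_macaulay_link sK dcK vK.
    by apply: two_vertices => //; apply: succn_inj; rewrite dL.
  rewrite -(leq_pmul2l (isT : 0 < 2)) -(sum_fnum_link 0 sK) -card_vertices.
  rewrite -sum1dep_card big_distrr big_mkcond /=.
  by apply: leq_sum => v _; case: ifP => // /h.
have eb := edge_bound d3 sK dcK dK.
case: i id linkb => [|i] id linkb.
  by rewrite /stacked_fnum ifF ?bin1 ?muln1 ?leq_subLR 1?addnC //; lia.
have choose2 : 2 * 'C(d.+2, 2) = d.+2 * d.+1 by rewrite -mul_bin_diag bin1.
rewrite /stacked_fnum; case: ifP => [/eqP[dE]|dE].
  subst d.
  have := @sum_link_bound K i.+1 i.+1 (i.+3 * i) sK.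
  have h v : [set v] \in K ->
      i.+1 * fnum (link K [set v]) 0 <= fnum (link K [set v]) i.+1 + i.+3 * i.
    move=> vK; have := linkb v vK (isT : 1 < i.+2) (leqnn _).
    rewrite /stacked_fnum eqxx leq_subLR; congr (_ <= _); lia.
  move=> /(_ h); rewrite leq_subLR -(leq_pmul2l (isT : 0 < i.+3)).
  move: eb choose2; set f := fnum K i.+2; set n := fnum K 0; set f1 := fnum K 1.
  set c := 'C(_, 2); clearbody f n f1 c => eb choose2.
  have -> : i.+3 - 1 = i.+2 by lia.
  have -> : i.+3 - 2 = i.+1 by lia.
  nia.
have := @sum_link_bound K i.+1 'C(d, i.+1) ('C(d.+1, i.+2) * i.+1) sK.
have h v : [set v] \in K -> 'C(d, i.+1) * fnum (link K [set v]) 0 <=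
    fnum (link K [set v]) i.+1 + 'C(d.+1, i.+2) * i.+1.
  move=> vK; have := linkb v vK; rewrite /stacked_fnum ifF; last by lia.
  by rewrite leq_subLR addnC; apply; lia.
move=> /(_ h); rewrite leq_subLR -(leq_pmul2l (isT : 0 < i.+3)).
(* These absorption identities turn the constants of the links into those of K. *)
have e1 := mul_bin_diag d.+1 i.+1; have e2 := mul_bin_diag d.+2 i.+2.
move: eb choose2 e1 e2; set f := fnum K i.+2; set n := fnum K 0; set f1 := fnum K 1.
rewrite /=.
set a := 'C(d, i.+1); set b := 'C(d.+1, i.+2); set c := 'C(d.+2, i.+3); set c2 := 'C(d.+2, 2).
clearbody a b c c2 f n f1 => eb choose2 e1 e2 e3.
have e4 : 2 * (a * (d.+1 * n)) <= 2 * (a * (f1 + c2)) by rewrite leq_mul2l leq_mul2l eb !orbT.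
have e5 : a * (d.+1 * n) = i.+2 * b * n by rewrite mulnA [a * _]mulnC e1.
have e6 : a * (2 * c2) = i.+2 * (i.+3 * c).
  by rewrite choose2 [d.+2 * _]mulnC mulnA [a * _]mulnC e1 -mulnA [b * _]mulnC e2.
nia.
Qed.

End FaceNumbers.

(** * Affine geometry of polytopes *)

Definition subsets_of_size n i : {set {set 'I_n}} := [set S : {set 'I_n} | #|S| == i].

Lemma in_subsets_of_size n i (S : {set 'I_n}) : (S \in subsets_of_size n i) = (#|S| == i).
Proof. by rewrite inE. Qed.

Lemma card_subsets_of_size n i : #|subsets_of_size n i| = 'C(n, i).
Proof. by rewrite card_draws card_ord. Qed.

Definition subsets_through n i (a : 'I_n) : {set {set 'I_n}} :=
  [set S : {set 'I_n} | (#|S| == i) && (a \in S)].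

Lemma in_subsets_through n i (a : 'I_n) (S : {set 'I_n}) :
  (S \in subsets_through i a) = (#|S| == i) && (a \in S).
Proof. by rewrite inE. Qed.

Lemma card_subsets_through n i (a : 'I_n.+1) : #|subsets_through i.+1 a| = 'C(n, i).
Proof.
have := cardsID (subsets_through i.+1 a) (subsets_of_size n.+1 i.+1).
rewrite card_subsets_of_size binS addnC => /eqP.
have -> : #|subsets_of_size n.+1 i.+1 :\: subsets_through i.+1 a| = 'C(n, i.+1).
  have <- : 'C(#|[set~ a]|, i.+1) = 'C(n, i.+1) by rewrite cardsC1 card_ord.
  rewrite -cards_draws; apply: eq_card => S; rewrite !inE.
  have -> : (S \subset [set~ a]) = (a \notin S).
    apply/subsetP/idP => [h|aS x xS]; first by apply/negP=> /h; rewrite !inE eqxx.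
    by rewrite !inE; apply: contraNneq aS => <-.
  by case: (#|S| == i.+1); case: (a \in S).
rewrite eqn_add2l => /eqP <-; apply: eq_card => S; rewrite !inE.
by case: (#|S| == i.+1).
Qed.

Definition all_but n (a : 'I_n.+1) : {set 'I_n.+1} := [set~ a].

Lemma in_all_but n (a i : 'I_n.+1) : (i \in all_but a) = (i != a).
Proof. by rewrite !inE. Qed.

Lemma card_all_but n (a : 'I_n.+1) : #|all_but a| = n.
Proof. by rewrite cardsC1 card_ord. Qed.

Lemma card_eq_all_but n (S : {set 'I_n.+1}) : #|S| = n -> exists a, S = all_but a.
Proof.
move=> cS; have /eqP/cards1P[a Sa] : #|~: S| = 1 by rewrite cardsCs setCK cS card_ord subSnn.
by exists a; rewrite -[S]setCK Sa.
Qed.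

From mathcomp Require Import boolp classical_sets cardinality finmap reals convex.

Local Open Scope classical_set_scope.

(** Face numbers become sizes of duplicate-free lists, in which removing F and appending new faces
    are easy to count. *)
Lemma card_seqP (T : choiceType) (A : set T) n : (A #= `I_n)%card <->
  exists s : seq T, [/\ uniq s, size s = n & A = [set x | x \in s]].
Proof.
split=> [h|[s [us <- ->]]].
  have fA : finite_set A by exists n.
  exists (fset_set A); split; first exact: fset_uniq.
    by have := card_fset_set h.
  apply/seteqP; split=> x /=; first by move=> Ax; rewrite in_fset_set // mem_set.
  by rewrite in_fset_set // => /set_mem.
have E x : (x \in seq_fset tt s) = (x \in s) by rewrite seq_fsetE.
have -> : [set x | x \in s] = [set` seq_fset tt s].
  by apply/predeqP => x; rewrite /mkset E.
by apply/card_eq_fsetP; rewrite size_seq_fset undup_id.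
Qed.

Section Affine.
Variables (R : realType) (d : nat).
Local Open Scope ring_scope.
Implicit Types (A B P D F G : set 'rV[R]_d) (w : 'cV[R]_(d + 1)) (x y : 'rV[R]_d).

(* The column w of height d + 1 encodes an affine functional, constant term last. *)
Definition aff w x : R := (row_mx x (1%:M : 'M[R]_1) *m w) 0 0.

Lemma affE u (c : R) x : aff (col_mx u (- c)%:M) x = (x *m u) 0 0 - c.
Proof. by rewrite /aff mul_row_col mul1mx !mxE eqxx mulr1n. Qed.

Lemma affD w w' x : aff (w + w') x = aff w x + aff w' x.
Proof. by rewrite /aff mulmxDr mxE. Qed.

Lemma affZ t w x : aff (t *: w) x = t * aff w x.
Proof. by rewrite /aff -scalemxAr mxE. Qed.

Lemma affN w x : aff (- w) x = - aff w x.
Proof. by rewrite /aff mulmxN mxE. Qed.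

Lemma aff0 x : aff 0 x = 0.
Proof. by rewrite /aff mulmx0 mxE. Qed.

Lemma aff_sum (I : Type) (r : seq I) (Q : pred I) (f : I -> 'cV_(d + 1)) x :
  aff (\sum_(i <- r | Q i) f i) x = \sum_(i <- r | Q i) aff (f i) x.
Proof. by rewrite /aff mulmx_sumr summxE. Qed.

Lemma aff_comb (I : finType) (a : I -> R) (p : I -> 'rV[R]_d) w :
  \sum_i a i = 1 -> aff w (\sum_i a i *: p i) = \sum_i a i * aff w (p i).
Proof.
move=> a1; rewrite /aff; have -> : row_mx (\sum_i a i *: p i) 1%:M =
    \sum_i a i *: row_mx (p i) (1%:M : 'M[R]_1).
  under [RHS]eq_bigr => i _ do rewrite scale_row_mx.
  apply/rowP=> j; rewrite summxE; case: (splitP j) => l jl.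
    have -> : j = lshift 1 l by apply: val_inj.
    rewrite row_mxEl summxE; apply: eq_bigr => i _; by rewrite row_mxEl.
  have -> : j = rshift d l by apply: val_inj.
  transitivity (\sum_i a i); first by rewrite a1 row_mxEr !mxE ord1 eqxx.
  by apply: eq_bigr => i _; rewrite row_mxEr !mxE ord1 eqxx mulr1.
by rewrite mulmx_suml summxE; apply: eq_bigr => i _; rewrite -scalemxAl mxE.
Qed.

Lemma aff_move w x y t : aff w (x + t *: (y - x)) = aff w x + t * (aff w y - aff w x).
Proof.
pose a (b : bool) := if b then t else 1 - t.
pose p (b : bool) := if b then y else x.
have <- : \sum_b a b *: p b = x + t *: (y - x).
  by rewrite big_bool /= scalerBl scale1r scalerBr addrC -addrA [- _ + _]addrC.
rewrite aff_comb ?big_bool /=; first by ring.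
by rewrite /a addrC subrK.
Qed.

Lemma faceP P G : face P G <->
  exists2 w, (forall x, P x -> aff w x <= 0) & G = P `&` [set x | aff w x = 0].
Proof.
split=> [[u [c [Pu ->]]]|[w Pw ->]].
  exists (col_mx u (- c)%:M) => [x Px|]; first by rewrite affE subr_le0 Pu.
  by apply/seteqP; split=> x [Px /eqP h]; split=> //=; apply/eqP; move: h;
    rewrite affE subr_eq0.
exists (usubmx w), (- dsubmx w 0 0).
have E x : aff w x = (x *m usubmx w) 0 0 - (- dsubmx w 0 0).
  by rewrite -affE opprK -mx11_scalar vsubmxK.
split=> [x /Pw|]; first by rewrite E subr_le0.
by apply/seteqP; split=> x [Px /eqP h]; split=> //=; apply/eqP; move: h;
  rewrite E subr_eq0.
Qed.

Definition lifted m (p : 'I_m -> 'rV[R]_d) : 'M[R]_(m, d + 1) :=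
  \matrix_(i < m) row_mx (p i) (1%:M : 'M[R]_1).

Lemma affinely_independentP m (p : 'I_m -> 'rV[R]_d) :
  affinely_independent p <-> row_free (lifted p).
Proof.
have E (a : 'rV[R]_m) : a *m lifted p = row_mx (\sum_i a 0 i *: p i) (\sum_i a 0 i)%:M.
  apply/rowP=> j; have [l ->|l ->] := split_ordP j.
    rewrite row_mxEl mxE summxE; apply: eq_bigr => i _.
    by rewrite mxE row_mxEl mxE.
  rewrite row_mxEr mxE [RHS]mxE ord1 eqxx mulr1n; apply: eq_bigr => i _.
  by rewrite mxE row_mxEr mxE eqxx mulr1.
split=> [h|h a a0 ap i].
  apply: inj_row_free => a; rewrite E => ha.
  have [h1 h2] : \sum_i a 0 i *: p i = 0 /\ (\sum_i a 0 i)%:M = 0 :> 'M[R]_1.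
    by apply: eq_row_mx; rewrite ha row_mx0.
  apply/rowP=> i; rewrite [RHS]mxE; apply: h => //.
  by have /matrixP/(_ 0 0) := h2; rewrite !mxE eqxx mulr1n.
have a0' : (\row_i a i) = 0.
  apply: (row_free_inj h); rewrite mul0mx E.
  under eq_bigr => j _ do rewrite mxE.
  rewrite ap; under eq_bigr => j _ do rewrite mxE.
  by rewrite a0 raddf0 row_mx0.
by have /rowP/(_ i) := a0'; rewrite !mxE.
Qed.

Lemma lifted_mul m (p : 'I_m -> 'rV[R]_d) w i : (lifted p *m w) i 0 = aff w (p i).
Proof. by have /matrixP/(_ 0 0) := row_mul i (lifted p) w; rewrite rowK mxE. Qed.

End Affine.

(** * Dimension and hyperplanes *)

Section Dimension.
Variables (R : realType) (d : nat).
Local Open Scope ring_scope.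
Implicit Types (A B P D F G : set 'rV[R]_d) (w : 'cV[R]_(d + 1)) (x y : 'rV[R]_d).

Lemma affinely_independent_inj m m' (p : 'I_m -> 'rV[R]_d) (f : 'I_m' -> 'I_m) :
  affinely_independent p -> injective f -> affinely_independent (p \o f).
Proof.
move=> hp fI a a0 ap i.
pose b j := \sum_(i | f i == j) a i.
have part (W : nmodType) (g : 'I_m' -> W) : \sum_j \sum_(i | f i == j) g i = \sum_i g i.
  by rewrite [RHS](partition_big f xpredT).
have := hp b; rewrite part => /(_ a0).
have -> : \sum_j b j *: p j = \sum_i a i *: (p \o f) i.
  rewrite -part; apply: eq_bigr => j _; rewrite scaler_suml.
  by apply: eq_bigr => l /eqP <-.
move=> /(_ ap)/(_ (f i)); rewrite /b (bigD1 i) //= big1 ?addr0 // => l /andP[/eqP/fI->].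
by rewrite eqxx.
Qed.

Definition full P := exists2 p : 'I_d.+1 -> 'rV[R]_d,
  affinely_independent p & forall i, P (p i).

Lemma fullS P A : P `<=` A -> full P -> full A.
Proof. by move=> PA [p hp Pp]; exists p => // i; apply: PA. Qed.

Lemma full_aff P w : full P -> w != 0 -> exists2 x, P x & aff w x != 0.
Proof.
move=> [p /affinely_independentP hp Pp] w0.
apply: contrapT => h; case/negP: w0; apply/eqP.
have /row_fullP[B BM] : row_full (lifted p) by rewrite /row_full (eqP hp) addn1.
rewrite -[w]mul1mx -BM -mulmxA (_ : lifted p *m w = 0) ?mulmx0 //.
apply/matrixP=> i j; rewrite ord1 [RHS]mxE; apply/eqP/negPn/negP => hi.
apply: h; exists (p i) => //; by rewrite -lifted_mul.
Qed.

Lemma full_dim P i : full P -> has_dim P i -> (d <= i)%N.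
Proof.
move=> [p hp Pp] [_ h]; rewrite leqNgt; apply/negP => id.
apply: (h (p \o widen_ord (id : i.+1 < d.+1)%N)) => [j|]; first exact: Pp.
by apply: affinely_independent_inj => // j j' /(congr1 val) /= /val_inj.
Qed.

Lemma has_dim_leq A i j : has_dim A i -> has_dim A j -> (i <= j)%N.
Proof.
move=> [[p hp Ap] _] [_ h]; rewrite leqNgt; apply/negP => ji.
apply: (h (p \o widen_ord (ji : j.+1 < i.+1)%N)) => [l|]; first exact: Ap.
by apply: affinely_independent_inj => // l l' /(congr1 val) /= /val_inj.
Qed.

Lemma has_dim_unique A i j : has_dim A i -> has_dim A j -> i = j.
Proof. by move=> hi hj; apply/eqP; rewrite eqn_leq !(has_dim_leq hi hj, has_dim_leq hj hi). Qed.

Lemma has_dim_nonempty A i : has_dim A i -> exists x, A x.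
Proof. by move=> [[p _ Ap] _]; exists (p ord0). Qed.

(** The functionals vanishing at d affinely independent points form a line in a space of dimension d
    + 1. *)
Lemma hyperplane_unique m (q : 'I_m -> 'rV[R]_d) w w' : m = d ->
  affinely_independent q -> w != 0 -> (forall i, aff w (q i) = 0) ->
  (forall i, aff w' (q i) = 0) -> exists s, w' = s *: w.
Proof.
move=> md /affinely_independentP hq w0 hw hw'.
have ker (v : 'cV[R]_(d + 1)) : (forall i, aff v (q i) = 0) ->
    (v^T <= kermx (lifted q)^T)%MS.
  move=> hv; apply/sub_kermxP; rewrite -trmx_mul (_ : lifted q *m v = 0) ?trmx0 //.
  by apply/matrixP=> i j; rewrite ord1 [RHS]mxE lifted_mul hv.
have rk : \rank (kermx (lifted q)^T) = 1%N.
  by rewrite mxrank_ker mxrank_tr (eqP hq) md addKn.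
have rw : \rank w^T = 1%N by rewrite rank_rV -(inj_eq trmx_inj) trmxK trmx0 w0.
have kw : (kermx (lifted q)^T <= w^T)%MS.
  by rewrite -(mxrank_leqif_sup (ker w hw)) rk rw.
have /sub_rVP[s hs] := submx_trans (ker w' hw') kw.
by exists s; apply: trmx_inj; rewrite hs linearZ.
Qed.

(* w and the functional that cuts G out of A vanish at d affinely independent points of
   G, hence are proportional. *)
Lemma facet_extends A B G w : (0 < d)%N -> B `<=` A -> full B ->
  (forall x, B x -> aff w x <= 0) -> G = B `&` [set x | aff w x = 0] ->
  facet A G -> (exists2 x, A x & ~ G x) ->
  (forall x, A x -> aff w x <= 0) /\ A `&` [set x | aff w x = 0] = G.
Proof.
move=> d0 BA fB Bw GE [/faceP[w' Aw' GE'] dG] [x0 Ax0 Gx0].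
have w0 : w != 0.
  apply/eqP => w0; have GB : G = B.
    by rewrite GE w0; apply/seteqP; split=> x; [case|split=> //=; rewrite aff0].
  by move: dG; rewrite GB => /(full_dim fB); lia.
have w'0 : w' != 0.
  by apply/eqP => w'0; apply: Gx0; rewrite GE' w'0; split=> //=; rewrite aff0.
have [[q hq Gq] _] := dG.
have [|||s sE] := @hyperplane_unique _ q w w' _ hq w0; first by rewrite prednK.
- by move=> i; have := Gq i; rewrite GE => -[].
- by move=> i; have := Gq i; rewrite GE' => -[].
have [x1 Bx1 wx1] := full_aff fB w0.
have s0 : s != 0 by apply: contraNneq w'0 => s0; rewrite sE s0 scale0r.
have s_gt0 : 0 < s.
  have := Aw' _ (BA _ Bx1); rewrite sE affZ.
  have wx1' : aff w x1 < 0 by rewrite lt_neqAle wx1 Bw.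
  by rewrite lt_neqAle eq_sym s0 /=; nra.
have E x : aff w' x = s * aff w x by rewrite sE affZ.
split=> [x /Aw'|]; first by rewrite E pmulr_rle0.
rewrite GE'; apply/seteqP; split=> x [Ax /= h]; split=> //=; first by rewrite E h mulr0.
by apply/eqP; move/eqP: h; rewrite E mulf_eq0 (negbTE s0).
Qed.

End Dimension.

(** * Faces of a simplex in barycentric coordinates *)

Section Simplex.
Variables (R : realType) (d : nat).
Local Open Scope ring_scope.
Implicit Types (A B P D F G : set 'rV[R]_d) (w : 'cV[R]_(d + 1)) (x y : 'rV[R]_d).
Implicit Types (S T : {set 'I_d.+1}).

(** The second clause is interpolation of an affine functional from its values at the vertices. *)
Definition barycentric (p : 'I_d.+1 -> 'rV[R]_d) (l : 'I_d.+1 -> 'cV[R]_(d + 1)) :=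
  (forall i j, aff (l i) (p j) = (i == j)%:R) /\
  (forall w x, aff w x = \sum_i aff w (p i) * aff (l i) x).

Lemma barycentric_exists p : affinely_independent p -> exists l, barycentric p l.
Proof.
move=> /affinely_independentP hp.
have /row_fullP[C CM] : row_full (lifted p) by rewrite /row_full (eqP hp) addn1.
have /row_freeP[B MB] := hp.
have BM : B *m lifted p = 1%:M by rewrite -[B]mul1mx -CM -!mulmxA (mulmxA (lifted p)) MB mul1mx.
have lE i x : aff (col i B) x = (row_mx x (1%:M : 'M_1) *m B) 0 i.
  by rewrite /aff colE mulmxA -colE mxE.
exists (fun i => col i B); split=> [i j|w x].
  rewrite lE eq_sym; have -> : row_mx (p j) 1%:M = row j (lifted p).
    by apply/rowP=> l; rewrite !mxE.
  by rewrite -row_mul MB mxE mxE.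
rewrite {1}/aff -[row_mx x _]mulmx1 -BM mulmxA -mulmxA mxE.
apply: eq_bigr => i _; rewrite lE mulrC; congr (_ * _).
by rewrite lifted_mul.
Qed.

Section Faces.
Variables (p : 'I_d.+1 -> 'rV[R]_d) (l : 'I_d.+1 -> 'cV[R]_(d + 1)).
Hypotheses (hp : affinely_independent p) (hl : barycentric p l).

Lemma bary_vertex i j : aff (l i) (p j) = (i == j)%:R.
Proof. by case: hl. Qed.

Lemma aff_bary w x : aff w x = \sum_i aff w (p i) * aff (l i) x.
Proof. by case: hl. Qed.

Lemma bary_sum1 x : \sum_i aff (l i) x = 1.
Proof.
have aff1 y : aff (col_mx 0 (- (- 1))%:M) y = 1.
  by rewrite affE mulmx0 mxE opprK add0r.
rewrite -[RHS](aff1 x) aff_bary; apply: eq_bigr => i _.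
by rewrite aff1 mul1r.
Qed.

Lemma bary_comb x : x = \sum_i aff (l i) x *: p i.
Proof.
apply/rowP=> j; rewrite summxE.
have affj y : aff (col_mx (delta_mx j 0) (- 0)%:M) y = y 0 j.
  rewrite affE subr0 -colE mxE //.
rewrite -[LHS]affj aff_bary; apply: eq_bigr => i _.
by rewrite affj mxE mulrC.
Qed.

Lemma hullP x : hull p x <-> forall i, 0 <= aff (l i) x.
Proof.
split=> [[a [a0 a1 ->]] i|h]; last first.
  exists (fun i => aff (l i) x); split=> //; first exact: bary_sum1.
  exact: bary_comb.
rewrite aff_comb // (bigD1 i) //= bary_vertex eqxx mulr1 big1 ?addr0 // => j ji.
by rewrite bary_vertex eq_sym (negbTE ji) mulr0.
Qed.

Lemma hull_vertex i : hull p (p i).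
Proof. by apply/hullP => j; rewrite bary_vertex ler0n. Qed.

Lemma full_hull : full (hull p).
Proof. by exists p => // i; exact: hull_vertex. Qed.

Definition simplex_face S : set 'rV[R]_d :=
  hull p `&` [set x | forall i, i \notin S -> aff (l i) x = 0].

Lemma simplex_face_vertex S i : simplex_face S (p i) <-> i \in S.
Proof.
split=> [[_ h]|iS].
  apply: contraT => /h/eqP; rewrite bary_vertex eqxx oner_eq0 //.
split; first exact: hull_vertex.
by move=> j jS; rewrite bary_vertex; case: eqVneq => // ji; rewrite ji iS in jS.
Qed.

Lemma simplex_face_inj : injective simplex_face.
Proof.
move=> S T ST; apply/setP=> i; apply/idP/idP => /simplex_face_vertex.
  by rewrite ST => /simplex_face_vertex.
by rewrite -ST => /simplex_face_vertex.
Qed.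

Lemma aff_le0_tight w x : (forall i, aff w (p i) <= 0) -> hull p x ->
  aff w x <= 0 /\ (aff w x = 0 -> forall i, aff w (p i) != 0 -> aff (l i) x = 0).
Proof.
move=> hw /hullP hx; rewrite aff_bary.
have t i : aff w (p i) * aff (l i) x <= 0 by rewrite mulr_le0_ge0.
split=> [|h i wi]; first by rewrite sumr_le0.
have /eqP : aff w (p i) * aff (l i) x = 0.
  apply/eqP; rewrite -oppr_eq0; apply/eqP.
  have h' : \sum_i - (aff w (p i) * aff (l i) x) = 0 by rewrite sumrN h oppr0.
  by apply: (psumr_eq0P _ h') => // j _; rewrite oppr_ge0.
by rewrite mulf_eq0 (negbTE wi) => /eqP.
Qed.

Lemma simplex_faceP G : face (hull p) G -> (exists x, G x) ->
  exists2 S, G = simplex_face S & forall i, (i \in S) = `[< G (p i) >].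
Proof.
move=> /faceP[w Dw GE] [x0 Gx0].
pose S := finset (fun i => `[< G (p i) >]).
exists S => [|i]; last by rewrite inE.
have vw i : aff w (p i) <= 0 by apply: Dw; exact: hull_vertex.
rewrite {1}GE; apply/seteqP; split=> x [Dx /= h]; split=> //=.
  move=> i; rewrite inE => /asboolPn hi.
  apply: (aff_le0_tight vw Dx).2 => //.
  by apply/eqP => wi; apply: hi; rewrite GE; split=> //; exact: hull_vertex.
rewrite aff_bary big1 // => i _; have [iS|/h->] := boolP (i \in S); last by rewrite mulr0.
by move: iS; rewrite inE => /asboolP; rewrite GE => -[_ /= ->]; rewrite mul0r.
Qed.

Definition outer S : 'cV[R]_(d + 1) := \sum_(i | i \notin S) - l i.

Lemma aff_outer S x : aff (outer S) x = - \sum_(i | i \notin S) aff (l i) x.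
Proof. by rewrite aff_sum -sumrN; apply: eq_bigr => i _; rewrite affN. Qed.

Lemma face_simplex_face S : face (hull p) (simplex_face S).
Proof.
apply/faceP; exists (outer S) => [x /hullP hx|].
  by rewrite aff_outer oppr_le0 sumr_ge0.
apply/seteqP; split=> x [Dx /= h]; split=> //=; first by rewrite aff_outer big1 ?oppr0.
move/eqP: h; rewrite aff_outer oppr_eq0 => /eqP h i iS.
by have /hullP hx := Dx; exact: (psumr_eq0P (fun i _ => hx i) h).
Qed.

Lemma dim_simplex_face S i : #|S| = i.+1 -> has_dim (simplex_face S) i.
Proof.
move=> cS; split.
  exists (p \o (fun j : 'I_i.+1 => enum_val (cast_ord (esym cS) j))) => [|j] /=.
    by apply: affinely_independent_inj => // j j' /enum_val_inj/cast_ord_inj.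
  by apply/simplex_face_vertex; exact: enum_valP.
move=> y hy /affinely_independentP /eqP ry.
(* The points y only involve the vertices in S, so [lifted y] factors through i + 1 dimensions, too
   few for i + 2 independent rows. *)
pose C : 'M[R]_(i.+2, #|S|) := \matrix_(a, b) aff (l (enum_val b)) (y a).
pose M := lifted (p \o (@enum_val _ (mem S))).
have yE : lifted y = C *m M.
  apply/row_matrixP=> a; rewrite row_mul rowK.
  have [_ hya] := hy a.
  have E (w : 'cV[R]_(d + 1)) : row_mx (y a) (1%:M : 'M_1) *m w = row a C *m M *m w.
    apply/matrixP=> s t; rewrite !ord1 -[LHS]/(aff w (y a)) aff_bary.
    rewrite (bigID (fun b => b \in S)) /= [X in _ + X]big1 ?addr0; last first.
      by move=> b /hya ->; rewrite mulr0.
    rewrite -mulmxA mxE big_enum_val /=; apply: eq_bigr => b _.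
    by rewrite lifted_mul !mxE mulrC.
  by apply/rowP=> c; have := E (delta_mx c 0); rewrite -!colE => /matrixP/(_ 0 0); rewrite !mxE.
have := mxrankM_maxl C M; rewrite -yE ry => /leq_trans/(_ (rank_leq_col C)).
by rewrite cS ltnn.
Qed.

Lemma dim_simplex_faceP S i : has_dim (simplex_face S) i <-> #|S| = i.+1.
Proof.
split=> [h|]; last exact: dim_simplex_face.
have [x [_ hx]] := has_dim_nonempty h.
case cS : #|S| => [|c].
  have := bary_sum1 x; rewrite big1 => [/eqP|i' _]; first by rewrite eq_sym oner_eq0.
  by apply: hx; rewrite (cards0_eq cS) inE.
by rewrite (has_dim_unique h (dim_simplex_face cS)).
Qed.

Lemma faces_of_simplex i :
  [set G | face (hull p) G /\ has_dim G i] =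
  [set simplex_face S | S in [set S | S \in subsets_of_size d.+1 i.+1]].
Proof.
apply/seteqP; split=> G /= [].
  move=> fG dG; have [S GE _] := simplex_faceP fG (has_dim_nonempty dG).
  exists S; last by rewrite GE.
  by rewrite in_subsets_of_size; apply/eqP/dim_simplex_faceP; rewrite -GE.
move=> S; rewrite in_subsets_of_size => /eqP/dim_simplex_faceP dS <-.
by split=> //; exact: face_simplex_face.
Qed.

Lemma faces_of_simplex_through i a :
  [set G | [/\ face (hull p) G, has_dim G i & G (p a)]] =
  [set simplex_face S | S in [set S | S \in subsets_through i.+1 a]].
Proof.
apply/seteqP; split=> G /= [].
  move=> fG dG Ga; have [S GE SP] := simplex_faceP fG (has_dim_nonempty dG).
  exists S; last by rewrite GE.
  rewrite in_subsets_through SP; apply/andP; split; last exact/asboolP.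
  by apply/eqP/dim_simplex_faceP; rewrite -GE.
move=> S; rewrite in_subsets_through => /andP[/eqP/dim_simplex_faceP dS aS] <-.
by split=> //; [exact: face_simplex_face|exact/simplex_face_vertex].
Qed.

End Faces.
End Simplex.

(** * Faces of intersections of half-spaces *)

Section HalfSpaces.
Variables (R : realType) (d : nat).
Local Open Scope ring_scope.
Implicit Types (A B P D F G : set 'rV[R]_d) (w : 'cV[R]_(d + 1)) (x y : 'rV[R]_d).
Implicit Types (r : seq 'cV[R]_(d + 1)).

(** Gives room to move a point in any direction without violating finitely many constraints that are
    strict at it. *)
Lemma small_step (I : eqType) (s : seq I) (a b : I -> R) :
  {in s, forall i, a i < 0} -> exists e, [/\ 0 < e, e <= 1 &
    forall t, 0 <= t <= e -> {in s, forall i, a i + t * b i < 0}].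
Proof.
elim: s => [|i s IHs] h; first by exists 1; split.
have [j js|e [e0 e1 he]] := IHs; first by apply: h; rewrite inE js orbT.
have ai : a i < 0 by apply: h; rewrite inE eqxx.
have b1 : 0 < `|b i| + 1 by rewrite ltr_pwDr.
(* The summand 1 keeps the denominator positive when b i = 0. *)
pose e' := - a i / (`|b i| + 1).
have e'0 : 0 < e' by rewrite divr_gt0 // oppr_gt0.
exists (Num.min e e'); split; first by rewrite lt_min e0.
  by rewrite ge_min e1.
move=> t /andP[t0]; rewrite le_min => /andP[te te'] j.
rewrite inE => /predU1P[->|js]; last by apply: he => //; rewrite t0.
have : t * b i <= e' * `|b i|.
  apply: le_trans (ler_wpM2l t0 (ler_norm _)) _.
  by rewrite ler_wpM2r.
have : e' * (`|b i| + 1) = - a i by rewrite divfK // gt_eqF.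
by rewrite mulrDr mulr1; lra.
Qed.

Lemma aff_move_le0 w x y t : 0 <= t <= 1 -> aff w x <= 0 -> aff w y <= 0 ->
  aff w (x + t *: (y - x)) <= 0.
Proof. by rewrite aff_move => /andP[t0 t1] hx hy; nra. Qed.

Definition halfspaces r : set 'rV[R]_d := [set x | forall w, w \in r -> aff w x <= 0].

Lemma halfspaces_convex r x y t : 0 <= t <= 1 -> halfspaces r x -> halfspaces r y ->
  halfspaces r (x + t *: (y - x)).
Proof. by move=> ht hx hy w wr; apply: aff_move_le0 => //; [exact: hx|exact: hy]. Qed.

(* A point of G that is strict for every constraint not tight on all of G can be
   moved slightly away from any x satisfying the tight constraints; so the functional
   cutting out G vanishes at x. *)
Lemma face_tight r G : face (halfspaces r) G -> (exists x, G x) ->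
  G = halfspaces r `&`
    [set x | forall w, w \in r -> (forall y, G y -> aff w y = 0) -> aff w x = 0].
Proof.
move=> /faceP[w0 Pw0 GE] [x0 Gx0].
have [y Gy hy] : exists2 y, G y &
    forall w, w \in r -> ~ (forall y, G y -> aff w y = 0) -> aff w y < 0.
  suff h (s : seq 'cV[R]_(d + 1)) : {subset s <= r} -> exists2 y, G y &
      forall w, w \in s -> ~ (forall y, G y -> aff w y = 0) -> aff w y < 0.
    by apply: h.
  elim: s => [|w s IHs] sr; first by exists x0.
  have [v vs|y Gy hy] := IHs; first by apply: sr; rewrite inE vs orbT.
  have [tw|tw] := pselect (forall y, G y -> aff w y = 0).
    by exists y => // v; rewrite inE => /predU1P[->|/hy].
  have [z Gz wz] : exists2 z, G z & aff w z != 0.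
    apply: contrapT => h; apply: tw => z Gz; apply: contrapT => wz.
    by apply: h; exists z => //; apply/eqP.
  have rG v u : v \in w :: s -> G u -> aff v u <= 0.
    by move=> vs; rewrite GE => -[hu _]; apply/hu/sr.
  have half : 0 <= (2^-1 : R) <= 1 by lra.
  exists (y + 2^-1 *: (z - y)).
    move: Gy Gz; rewrite GE => -[Py /= y0] [Pz /= z0].
    by split; [exact: halfspaces_convex|rewrite /= aff_move y0 z0; lra].
  move=> v; rewrite inE => /predU1P[-> _|vs nv].
    have wy := rG w y (mem_head _ _) Gy.
    have wz' : aff w z < 0 by rewrite lt_neqAle wz (rG w z (mem_head _ _) Gz).
    by rewrite aff_move; lra.
  have vws : v \in w :: s by rewrite inE vs orbT.
  have := hy v vs nv; have := rG v z vws Gz.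
  by rewrite aff_move; lra.
apply/seteqP; split=> [x Gx|x [Px /= tx]].
  split; first by move: Gx; rewrite GE => -[].
  by move=> w wr; apply.
have [Py /= wy] : halfspaces r y /\ aff w0 y = 0 by move: Gy; rewrite GE => -[].
pose s := [seq w <- r | ~~ `[< forall y, G y -> aff w y = 0 >]].
have [w|e [e0 e1 he]] := @small_step _ s (fun w => aff w y) (fun w => aff w y - aff w x).
  by rewrite mem_filter => /andP[/asboolPn hw wr]; exact: hy.
have yE : y + e *: (y - x) = y + (- e) *: (x - y).
  by rewrite scaleNr -scalerN opprB.
have Pz : halfspaces r (y + e *: (y - x)).
  move=> w wr; rewrite yE aff_move.
  have [tw|tw] := pselect (forall y, G y -> aff w y = 0).
    by rewrite tw // tx //; lra.
  have := he e _ w _; rewrite lexx ltW //= mem_filter wr andbT.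
  by move=> /(_ isT); case: asboolP => // _ /(_ isT); lra.
have := Pw0 _ Pz; rewrite yE aff_move wy => h.
rewrite GE; split=> //=; apply/eqP; rewrite eq_le Pw0 //=; nra.
Qed.

End HalfSpaces.

(** * Stacking *)

Lemma half_range (R : realFieldType) (e : R) : (0 < e -> 0 <= e / 2 <= e)%R.
Proof. lra. Qed.

Lemma half_step_lt0 (R : realFieldType) (e x y : R) :
  (0 < e -> e <= 1 -> x <= 0 -> y < 0 -> x + e / 2 * (y - x) < 0)%R.
Proof. nra. Qed.

Section Gluing.
Variables (R : realType) (d : nat).
Local Open Scope ring_scope.
Implicit Types (A B P D F G : set 'rV[R]_d) (w : 'cV[R]_(d + 1)) (x y : 'rV[R]_d).
Implicit Types (r : seq 'cV[R]_(d + 1)).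

Definition cut A w : set 'rV[R]_d := A `&` [set x | aff w x = 0].

(** The invariant of the stacking induction. Each inequality must cut a facet, because it is facets
    that [stacked_glue] preserves. *)
Definition facet_presentation r P :=
  P = halfspaces r /\ forall w, w \in r -> facet P (cut P w).

Section SimplexFacets.
Variables (p : 'I_d.+1 -> 'rV[R]_d) (l : 'I_d.+1 -> 'cV[R]_(d + 1)).
Hypotheses (d0 : (0 < d)%N) (hp : affinely_independent p) (hl : barycentric p l).

Lemma cut_simplex i : cut (hull p) (- l i) = simplex_face p l (all_but i).
Proof.
apply/seteqP; split=> x [Dx /= h]; split=> //=.
  move=> j; rewrite in_all_but negbK => /eqP->.
  by apply/eqP; rewrite -oppr_eq0 -affN h.
by rewrite affN h ?oppr0 // in_all_but eqxx.
Qed.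

Lemma facet_simplex i : facet (hull p) (cut (hull p) (- l i)).
Proof.
rewrite cut_simplex; split; first exact: face_simplex_face.
by apply: dim_simplex_face => //; rewrite card_all_but prednK.
Qed.

Lemma facet_presentation_simplex :
  facet_presentation [seq - l i | i <- enum 'I_d.+1] (hull p).
Proof.
split=> [|_ /mapP[i _ ->]]; last exact: facet_simplex.
apply/seteqP; split=> x.
  by move=> /(hullP hl) hx _ /mapP[i _ ->]; rewrite affN oppr_le0.
move=> hx; apply/(hullP hl) => i; rewrite -oppr_le0 -affN; apply: hx.
by apply: map_f; rewrite mem_enum.
Qed.

Lemma face_number_simplex i : has_face_number (hull p) i 'C(d.+1, i.+1).
Proof.
apply/card_seqP.
exists [seq simplex_face p l T | T <- enum (subsets_of_size d.+1 i.+1)]; split.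
- by rewrite map_inj_uniq ?enum_uniq //; exact: simplex_face_inj.
- by rewrite size_map -cardE card_subsets_of_size.
rewrite (faces_of_simplex hp hl); apply/seteqP; split=> G /=.
  by move=> [S S_i <-]; apply: map_f; rewrite mem_enum.
by move=> /mapP[S]; rewrite mem_enum => S_i ->; exists S.
Qed.

End SimplexFacets.

(** * A single stacking step *)

Section Step.
Variables (P F : set 'rV[R]_d) (r : seq 'cV[R]_(d + 1)).
Variables (p : 'I_d.+1 -> 'rV[R]_d) (l : 'I_d.+1 -> 'cV[R]_(d + 1)) (a : 'I_d.+1).
Notation D := (hull p).
Notation Q := (P `|` D).
Hypotheses (d0 : (0 < d)%N) (hp : affinely_independent p) (hl : barycentric p l).
Hypotheses (rP : facet_presentation r P) (fullP : full P).
Hypotheses (FE : F = simplex_face p l (all_but a)) (fPF : facet P F) (PDF : P `&` D = F).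
Hypothesis fQ : forall G, facet P G \/ facet D G -> G <> F -> facet Q G.

Let FP : F `<=` P. Proof. by rewrite -PDF => x []. Qed.
Let FD : F `<=` D. Proof. by rewrite -PDF => x []. Qed.
Let PQ : P `<=` Q. Proof. by move=> x; left. Qed.
Let DQ : D `<=` Q. Proof. by move=> x; right. Qed.

Let bary_F x : F x -> aff (l a) x = 0.
Proof. by rewrite FE => -[_]; apply; rewrite in_all_but eqxx. Qed.

Let in_F x : D x -> aff (l a) x = 0 -> F x.
Proof.
by move=> Dx xa; rewrite FE; split=> // i; rewrite in_all_but negbK => /eqP->.
Qed.

Let vertex_F i : i != a -> F (p i).
Proof. by move=> ia; rewrite FE; apply/simplex_face_vertex; rewrite ?in_all_but. Qed.

Lemma apex_notin : ~ P (p a).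
Proof.
move=> Pa; have : F (p a) by rewrite -PDF; split=> //; exact: hull_vertex hl a.
by move/bary_F/eqP; rewrite (bary_vertex hl) eqxx oner_eq0.
Qed.

(** If a point of P lay on the apex side, the segment from the centroid of F towards it would enter
    D outside F, although P and D meet only in F. *)
Let P_le x : P x -> aff (l a) x <= 0.
Proof.
move=> Px; rewrite leNgt; apply/negP=> xa.
(* Coordinates of the centroid of F; being positive off a, they stay positive after a short step. *)
pose c (j : 'I_d.+1) : R := if j == a then 0 else d%:R^-1.
have dR : (d%:R : R) != 0 by rewrite pnatr_eq0 -lt0n.
have c1 : \sum_j c j = 1.
  rewrite (bigD1 a) //= {1}/c eqxx add0r.
  rewrite (eq_bigr (fun=> d%:R^-1)); last by move=> j /negbTE ja; rewrite /c ja.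
  by rewrite sumr_const cardC1 card_ord /= -[_ *+ d]mulr_natr mulVf.
pose y := \sum_j c j *: p j.
have yE i : aff (l i) y = c i.
  rewrite aff_comb // (bigD1 i) //= (bary_vertex hl) eqxx mulr1 big1 ?addr0 // => j ji.
  by rewrite (bary_vertex hl) eq_sym (negbTE ji) mulr0.
have Fy : F y.
  apply: in_F; last by rewrite yE /c eqxx.
  by apply/(hullP hl) => i; rewrite yE /c; case: ifP => // _; rewrite invr_ge0 ler0n.
have [i|e [e0 e1 he]] := @small_step _ _ [seq i <- enum 'I_d.+1 | i != a]
    (fun i => - aff (l i) y) (fun i => - (aff (l i) x - aff (l i) y)).
  rewrite mem_filter yE /c => /andP[/negbTE-> _].
  by rewrite oppr_lt0 invr_gt0 ltr0n.
pose z := y + e *: (x - y).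
have Pz : P z.
  move: (FP Fy) Px; rewrite rP.1 => Py Px; apply: halfspaces_convex => //.
  by rewrite ltW.
have za : aff (l a) z = e * aff (l a) x by rewrite aff_move yE /c eqxx; ring.
have Dz : D z.
  apply/(hullP hl) => i; have [->|ia] := eqVneq i a; first by rewrite za; nra.
  have := he e _ i _; rewrite lexx ltW // mem_filter ia mem_enum => /(_ isT isT).
  by rewrite aff_move; nra.
have : F z by rewrite -PDF.
by move/bary_F => h; move: za; rewrite h; nra.
Qed.

Let aff_F w x : (forall y, F y -> aff w y = 0) -> aff w x = aff w (p a) * aff (l a) x.
Proof.
move=> hw; rewrite (aff_bary hl) (bigD1 a) //= big1 ?addr0 // => i ia.
by rewrite hw ?mul0r //; exact: vertex_F.
Qed.

Let la_neq0 : l a != 0.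
Proof.
by apply/eqP=> l0; have /eqP := bary_vertex hl a a; rewrite l0 aff0 eqxx eq_sym oner_eq0.
Qed.

Let P_lt : exists2 x, P x & aff (l a) x < 0.
Proof.
have [x Px xa] := full_aff fullP la_neq0; exists x => //.
by rewrite lt_neqAle xa P_le.
Qed.

Let F_cut : F = cut P (l a).
Proof.
have [/faceP[w Pw FE'] _] := fPF; have [x1 Px1 x1a] := P_lt.
have wF y : F y -> aff w y = 0 by rewrite FE' => -[].
apply/seteqP; split=> [x Fx|x [Px /= xa]]; first by split; [exact: FP|exact: bary_F].
by rewrite FE'; split=> //=; rewrite (aff_F _ wF) xa mulr0.
Qed.

Let r_le w x : w \in r -> P x -> aff w x <= 0.
Proof. by move=> wr; rewrite rP.1; apply. Qed.

(** An inequality of P that cuts F is [l a] up to a positive factor, so the apex violates it. *)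
Let r_F w : w \in r -> cut P w = F ->
  0 < aff w (p a) /\ forall x, aff w x = aff w (p a) * aff (l a) x.
Proof.
move=> wr wF; have wF0 y : F y -> aff w y = 0 by rewrite -wF => -[].
have wE x := aff_F x wF0; split=> //.
have [x1 Px1 x1a] := P_lt.
have wx1 : aff w x1 != 0.
  apply/eqP => w0; have : F x1 by rewrite -wF.
  by move/bary_F => h; move: x1a; rewrite h ltxx.
have := r_le wr Px1; rewrite le_eqVlt (negbTE wx1) /= wE => h.
by rewrite -(nmulr_llt0 _ x1a).
Qed.

Let r_other w : w \in r -> cut P w <> F ->
  (forall x, Q x -> aff w x <= 0) /\ cut Q w = cut P w.
Proof.
move=> wr wF; apply: (@facet_extends _ _ Q P) => //.
- by move=> x; exact: r_le.
- by apply: fQ => //; left; exact: rP.2.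
by exists (p a); [apply: DQ; exact: hull_vertex hl a|case=> /apex_notin].
Qed.

(** The cut of w is the same in Q as in P, and P misses the apex. *)
Let r_other_apex w : w \in r -> cut P w <> F -> aff w (p a) < 0.
Proof.
move=> wr wF; have [h1 h2] := r_other wr wF.
have Qa : Q (p a) by apply: DQ; exact: hull_vertex hl a.
rewrite lt_neqAle h1 // andbT; apply/eqP => wa.
by have : cut P w (p a); [rewrite -h2|case=> /apex_notin].
Qed.

Let D_other i : i != a -> (forall x, Q x -> aff (- l i) x <= 0) /\ cut Q (- l i) = cut D (- l i).
Proof.
move=> ia; apply: (@facet_extends _ _ Q D) => //.
- exact: full_hull hp hl.
- by move=> x /(hullP hl) hx; rewrite affN oppr_le0.
- apply: fQ; first by right; exact: facet_simplex.
  move=> h; have := vertex_F ia; rewrite -h => -[_ /=].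
  by rewrite affN (bary_vertex hl) eqxx => /eqP; rewrite oppr_eq0 oner_eq0.
have [x1 Px1 x1a] := P_lt; exists x1; first exact: PQ.
by case=> /(hullP hl) /(_ a); rewrite leNgt x1a.
Qed.

(** For i != a, [- l i] cuts the facet of D opposite [p i], which contains the apex; the
    inequalities of P that cut F are dropped. *)
Definition glued_presentation :=
  [seq w <- r | `[< cut P w <> F >]] ++ [seq - l i | i <- enum (all_but a)].

Lemma facet_presentation_glue : facet_presentation glued_presentation Q.
Proof.
have [x1 Px1 x1a] := P_lt.
have gE w : w \in glued_presentation <->
    (w \in r /\ cut P w <> F) \/ exists2 i, i != a & w = - l i.
  rewrite mem_cat mem_filter; split=> [/orP[/andP[/asboolP]|/mapP[i]]|].
  - by move=> h wr; left.
  - by rewrite mem_enum in_all_but => ia ->; right; exists i.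
  case=> [[wr wF]|[i ia ->]]; first by rewrite wr andbT; apply/orP; left; exact/asboolP.
  by apply/orP; right; apply: map_f; rewrite mem_enum in_all_but.
split=> [|w /gE[[wr wF]|[i ia ->]]]; last first.
- by rewrite (D_other ia).2; apply: fQ; [right; exact: facet_simplex|move=> h;
    have := vertex_F ia; rewrite -h => -[_ /=]; rewrite affN (bary_vertex hl) eqxx;
    move=> /eqP; rewrite oppr_eq0 oner_eq0].
- by rewrite (r_other wr wF).2; apply: fQ => //; left; exact: rP.2.
apply/seteqP; split=> x.
  by move=> Qx w /gE[[wr wF]|[i ia ->]]; [exact: (r_other wr wF).1|exact: (D_other ia).1].
(* The hyperplane of F decides: on the apex side all inequalities of D hold, on the other side all
   those of P. *)
move=> hx; have [xa|xa] := leP 0 (aff (l a) x).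
  right; apply/(hullP hl) => i; have [->//|ia] := eqVneq i a.
  by rewrite -oppr_le0 -affN; apply: hx; apply/gE; right; exists i.
left; rewrite rP.1 => w wr; have [wF|wF] := pselect (cut P w = F).
  by have [wa ->] := r_F wr wF; rewrite pmulr_rle0 // ltW.
by apply: hx; apply/gE; left.
Qed.

Lemma full_glue : full Q. Proof. exact: fullS fullP. Qed.

Let face_not_full A G i w : full A -> G = cut A w -> has_dim G i -> (i < d)%N -> w != 0.
Proof.
move=> fA GE dG id; apply/eqP => w0; have GA : G = A.
  by rewrite GE w0; apply/seteqP; split=> x; [case|split=> //=; rewrite aff0].
by move: dG; rewrite GA => /(full_dim fA); lia.
Qed.

(* Since p a lies strictly beneath every facet of P other than F, a supporting
   hyperplane of Q through p a and a point of P outside F would meet the interior of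
   P. *)
Let face_Q_apex G i w : (forall x, Q x -> aff w x <= 0) -> G = cut Q w -> has_dim G i ->
  (i < d)%N -> G (p a) -> G = cut D w.
Proof.
move=> Qw GE dG id Ga.
have w0 := face_not_full full_glue GE dG id.
have wa : aff w (p a) = 0 by move: Ga; rewrite GE => -[].
rewrite GE; apply/seteqP; split=> x [Qx /= wx]; split=> //=; last by right.
case: Qx => // Px; apply: FD; rewrite F_cut; split=> //=.
apply/eqP; rewrite eq_le P_le //= leNgt; apply/negP => xa.
have [[]|e [e0 e1 he]] := @small_step _ unit [:: tt] (fun=> aff (l a) x)
    (fun=> aff (l a) (p a) - aff (l a) x) => //.
(* A point a short way from x towards the apex, strictly inside P. *)
pose z := x + (e / 2) *: (p a - x).
have zr v : v \in r -> aff v z < 0.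
  move=> vr; have [vF|vF] := pselect (cut P v = F).
    have [va vE] := r_F vr vF; rewrite vE pmulr_rlt0 // aff_move.
    by apply: (he (e / 2) _ tt) => //; exact: half_range.
  rewrite aff_move; apply: half_step_lt0 => //; first exact: r_le.
  exact: r_other_apex.
have wz : aff w z = 0 by rewrite aff_move wa wx; ring.
(* Moving from z away from a point of P where w is negative stays in P and makes w positive. *)
have [x2 Px2 wx2] := full_aff fullP w0.
have wx2' : aff w x2 < 0 by rewrite lt_neqAle wx2 Qw //; exact: PQ.
have [v|e2 [e20 e21 he2]] := @small_step _ _ r (fun v => aff v z) (fun v => aff v z - aff v x2).
  exact: zr.
have Pz2 : P (z + (- e2) *: (x2 - z)).
  rewrite rP.1 => v vr; rewrite aff_move.
  by have := he2 e2 _ v vr; rewrite lexx ltW //= => /(_ isT)/ltW;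
    rewrite mulNr -mulrN opprB.
by have := Qw _ (PQ Pz2); rewrite aff_move wz subr0 add0r mulNr oppr_le0
  pmulr_rge0 // leNgt wx2'.
Qed.

(** Here w is negative at the apex, so on D it vanishes only inside F. If it cut out F itself, it
    would be a negative multiple of [l a], hence positive somewhere on P. *)
Let face_Q_no_apex G w : (forall x, Q x -> aff w x <= 0) -> G = cut Q w ->
  ~ G (p a) -> G = cut P w /\ G <> F.
Proof.
move=> Qw GE Ga; have Qa : Q (p a) by apply: DQ; exact: hull_vertex hl a.
have wa : aff w (p a) < 0.
  rewrite lt_neqAle Qw // andbT; apply/eqP => wa; apply: Ga.
  by rewrite GE.
split; last first.
  move=> GF; have [x1 Px1 x1a] := P_lt.
  have wF0 y : F y -> aff w y = 0 by rewrite -GF GE => -[].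
  by have := Qw _ (PQ Px1); rewrite (aff_F _ wF0) nmulr_rle0 // leNgt x1a.
rewrite GE; apply/seteqP; split=> x [Qx /= wx]; split=> //=; last by left.
case: Qx => // Dx; apply/FP/in_F => //.
have vw i : aff w (p i) <= 0 by apply: Qw; apply: DQ; exact: hull_vertex hl i.
by apply: (aff_le0_tight hl vw Dx).2 => //; rewrite lt_eqF.
Qed.

(* G is cut out on Q by the sum of the tight facet constraints of P, with small weight
   on those that define F, so that the sum is negative at p a. *)
Let face_P_extends G i : face P G -> has_dim G i -> (i < d)%N -> G <> F -> face Q G.
Proof.
move=> fG dG id GF.
have [w0 Pw0 GE0] := (faceP P G).1 fG.
have GE : G = P `&` [set x | forall w, w \in r -> (forall y, G y -> aff w y = 0) -> aff w x = 0].
  by rewrite {1}rP.1; apply: face_tight; [rewrite -rP.1|exact: has_dim_nonempty dG].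
pose J := [seq w <- r | `[< forall y, G y -> aff w y = 0 >]].
have JP w : w \in J <-> w \in r /\ (forall y, G y -> aff w y = 0).
  rewrite mem_filter; split=> [/andP[/asboolP]|[wr h]] //.
  by rewrite wr andbT; exact/asboolP.
have {}GE : G = P `&` [set x | forall w, w \in J -> aff w x = 0].
  rewrite GE; apply/seteqP; split=> x [Px /= h]; split=> //= w.
    by move=> /JP[wr wG]; apply: h => // y; rewrite -GE; exact: wG.
  by move=> wr wG; apply: h; apply/JP; split=> // y Gy; apply: wG; rewrite -GE.
pose isF w := `[< cut P w = F >].
pose W1 := \sum_(w <- J | ~~ isF w) w.
pose W2 := \sum_(w <- J | isF w) w.
(* With no tight inequality at all G would be P, which is full-dimensional; with only those cutting
   F it would be F. *)
have [w1 w1J w1F] : exists2 w, w \in J & ~~ isF w.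
  apply: contrapT => h; apply: GF.
  have hF w : w \in J -> cut P w = F.
    by move=> wJ; apply/asboolP; apply: contrapT => /negP nF; apply: h; exists w.
  have [J0|[w wJ]] : J = [::] \/ exists w, w \in J.
    by case EJ : J => [|w J']; [left|right; exists w; rewrite ?EJ inE eqxx].
    have GP : G = P by rewrite GE J0; apply/seteqP; split=> x; [case|split].
    by have := full_dim fullP; rewrite -{1}GP => /(_ i dG); lia.
  rewrite GE -(hF w wJ); apply/seteqP; split=> x [Px /= hx]; split=> //=; first exact: hx.
  move=> v vJ; have : cut P v x by rewrite hF // -(hF w wJ).
  by case.
have W1a : aff W1 (p a) < 0.
  rewrite aff_sum (big_rem w1) //= w1F.
  apply: ltr_wnDr; last first.
    apply: r_other_apex; first by have /JP[] := w1J.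
    by move=> h; move: w1F; rewrite /isF; case: asboolP.
  rewrite big_seq_cond; apply: sumr_le0 => v /andP[/mem_rem/JP[vr _] vF].
  by apply/ltW/r_other_apex => // h; move: vF; rewrite /isF; case: asboolP.
have [[]|e [e0 e1 he]] := @small_step _ unit [:: tt] (fun=> aff W1 (p a))
    (fun=> aff W2 (p a)) => //.
pose W := W1 + e *: W2.
have Wa : aff W (p a) < 0 by rewrite affD affZ; apply: (he e _ tt) => //; rewrite lexx ltW.
have WE x : aff W x = \sum_(w <- J) (if isF w then e else 1) * aff w x.
  rewrite affD affZ !aff_sum [RHS](bigID isF) /= [LHS]addrC mulr_sumr; congr (_ + _).
    by apply: eq_bigr => w ->.
  by apply: eq_bigr => w /negbTE->; rewrite mul1r.
have Jt w x : w \in J -> P x -> (if isF w then e else 1) * aff w x <= 0.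
  by move=> /JP[wr _] Px; apply: mulr_ge0_le0; [case: ifP; rewrite ?ler01 ?ltW|exact: r_le].
have WP x : P x -> aff W x <= 0.
  by move=> Px; rewrite WE big_seq; apply: sumr_le0 => w /Jt; apply.
have WPG x : P x -> aff W x = 0 -> G x.
  move=> Px; rewrite WE big_seq => h; rewrite GE; split=> //= w wJ.
  have : - ((if isF w then e else 1) * aff w x) = 0.
    have h' : \sum_(w <- J | w \in J) - ((if isF w then e else 1) * aff w x) = 0.
      by rewrite sumrN h oppr0.
    apply/eqP; move/eqP: h'; rewrite psumr_eq0 => [/allP/(_ w wJ)|v vJ].
      by rewrite wJ.
    by rewrite oppr_ge0 Jt.
  move/eqP; rewrite oppr_eq0 mulf_eq0; case: ifP => _; last by rewrite oner_eq0 => /eqP.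
  by rewrite (gt_eqF e0) => /eqP.
have WD i' : aff W (p i') <= 0.
  have [->|ia] := eqVneq i' a; first exact: ltW.
  by apply/WP/FP/vertex_F.
apply/faceP; exists W => [x [/WP //|Dx]|]; first exact: (aff_le0_tight hl WD Dx).1.
apply/seteqP; split=> x.
  move=> Gx; split; first by left; move: Gx; rewrite GE => -[].
  rewrite /= WE big_seq big1 // => w /JP[_ wG]; by rewrite wG ?mulr0.
move=> [[Px|Dx] /= wx]; first exact: WPG.
apply: WPG => //; apply/FP/in_F => //.
by apply: (aff_le0_tight hl WD Dx).2 => //; rewrite lt_eqF.
Qed.

(** The vertex set S of G contains the apex, so [outer l S] adds up only facet inequalities of D
    that are valid on Q, and each of them cuts Q inside D. *)
Let face_D_extends G i : face D G -> has_dim G i -> (i < d)%N -> G (p a) -> face Q G.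
Proof.
move=> fG dG id Ga.
have [S GE SP] := simplex_faceP hl fG (has_dim_nonempty dG).
have aS : a \in S by rewrite SP; apply/asboolP.
have S_other j : j \notin S -> j != a by apply: contraNneq => ->.
apply/faceP; exists (outer l S) => [x Qx|].
  by rewrite aff_sum sumr_le0 // => j /S_other/D_other[h _]; exact: h.
have [i0 i0S] : exists j, j \notin S.
  apply: contrapT => h; have : #|S| = d.+1.
    rewrite -[RHS]card_ord; apply: eq_card => j; rewrite [RHS]inE.
    by apply: contrapT => /negP jS; apply: h; exists j.
  by move: dG; rewrite GE => /(dim_simplex_faceP hp hl) ->; lia.
have tight x : Q x -> aff (outer l S) x = 0 -> forall j, j \notin S -> aff (l j) x = 0.
  rewrite aff_outer => Qx /eqP; rewrite oppr_eq0 => /eqP h j jS.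
  have pos j' : j' \notin S -> 0 <= aff (l j') x.
    by move=> /S_other/D_other[h' _]; have := h' x Qx; rewrite affN oppr_le0.
  exact: (psumr_eq0P pos h).
apply/seteqP; split=> x.
  rewrite GE => -[Dx /= h]; split; first by right.
  by rewrite /= aff_outer big1 ?oppr0.
move=> [Qx /= h]; have hx := tight x Qx h.
have Dx : D x.
  have [_ E] := D_other (S_other _ i0S).
  have : cut Q (- l i0) x by split=> //=; rewrite affN hx ?oppr0.
  by rewrite E => -[].
by rewrite GE.
Qed.

Lemma faces_glue i : (i < d)%N ->
  [set G | face Q G /\ has_dim G i] =
  ([set G | face P G /\ has_dim G i] `\ F) `|`
  [set G | [/\ face D G, has_dim G i & G (p a)]].
Proof.
move=> id; apply/seteqP; split=> G /=.
  move=> [fG dG]; have [w Qw GE] := (faceP Q G).1 fG.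
  have [Ga|Ga] := pselect (G (p a)); [right|left].
    split=> //; apply/faceP; exists w; first by move=> x /DQ /Qw.
    exact: face_Q_apex GE dG id Ga.
  have [GP GF] := face_Q_no_apex Qw GE Ga; split=> //; split=> //.
  by apply/faceP; exists w => // x /PQ /Qw.
case=> [[[fG dG] GF]|[fG dG Ga]]; split=> //; first exact: face_P_extends fG dG id GF.
exact: face_D_extends fG dG id Ga.
Qed.

End Step.
End Gluing.

(** * Face numbers of stacked polytopes *)

Section StackedCount.
Variables (R : realType) (d : nat).
Implicit Types (P F G : set 'rV[R]_d).

Lemma face_number_unique P i m n :
  has_face_number P i m -> has_face_number P i n -> m = n.
Proof.
move=> hm hn; apply/card_eq_II; apply: card_eq_trans hn.
by rewrite card_eq_sym.
Qed.

(** The new i-faces are spanned by the apex and i further vertices of D, which gives C(d, i); for i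
    = d - 1 the facet F disappears, leaving C(d, d - 1) - 1 = d - 1. *)
Lemma face_number_glue P F p r l a i m : (0 < d) -> (i < d) ->
  affinely_independent p -> barycentric p l -> facet_presentation r P -> full P ->
  F = simplex_face p l (all_but a) -> facet P F -> P `&` hull p = F ->
  (forall G, facet P G \/ facet (hull p) G -> G <> F -> facet (P `|` hull p) G) ->
  has_face_number P i m ->
  has_face_number (P `|` hull p) i (m + if i.+1 == d then d - 1 else 'C(d, i)).
Proof.
move=> d0 id hp hl rP fP FE fPF PDF fQ /card_seqP[s [us sm sE]].
apply/card_seqP.
exists (rem F s ++ [seq simplex_face p l T | T <- enum (subsets_through i.+1 a)]); split.
- rewrite cat_uniq rem_uniq // map_inj_uniq ?enum_uniq ?andbT; last first.
    exact: simplex_face_inj.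
  apply/hasPn => _ /mapP[S Sa ->]; rewrite /= mem_rem_uniq // inE negb_and negbK.
  apply/orP; right; apply/negP => h.
  have : [set G | G \in s] (simplex_face p l S) by [].
  rewrite -sE => -[[u [c [_ E]]] _].
  apply: (apex_notin hl FE PDF); suff : simplex_face p l S (p a) by rewrite E => -[].
  apply/(simplex_face_vertex hl).
  by move: Sa; rewrite mem_enum in_subsets_through => /andP[].
- rewrite size_cat size_map -cardE card_subsets_through.
  have Fs : (F \in s) = (i.+1 == d).
    apply/idP/eqP => h.
      have : [set G | G \in s] F by [].
      rewrite -sE => -[_ dF]; rewrite (has_dim_unique dF fPF.2); lia.
    suff : [set G | G \in s] F by [].
    rewrite -sE; split; first exact: fPF.1. have -> : i = d.-1 by lia. exact: fPF.2.
  case: eqP Fs => [e|_] Fs.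
    rewrite size_rem // sm -e binSn; have : 0 < size s by case: (s) Fs.
    lia.
  by rewrite rem_id ?sm ?Fs.
rewrite (faces_glue d0 hp hl rP fP FE fPF PDF fQ id) sE (faces_of_simplex_through hp hl).
apply/seteqP; split=> G /=.
  rewrite mem_cat; case=> [[Gs GF]|[S Si <-]].
    by rewrite mem_rem_uniq // inE Gs andbT; apply/orP; left; apply/eqP.
  by apply/orP; right; apply: map_f; rewrite mem_enum.
rewrite mem_cat mem_rem_uniq // inE => /orP[/andP[/eqP GF Gs]|/mapP[S]]; first by left.
by rewrite mem_enum => Si ->; right; exists S.
Qed.

Lemma stacked_face_numbers P : 0 < d -> stacked_polytope P -> exists s, forall i, i < d ->
  has_face_number P i ('C(d.+1, i.+1) + s * if i.+1 == d then d - 1 else 'C(d, i)).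
Proof.
move=> d0 sP.
(* Strengthened for the induction: the next stacking step needs a facet presentation of a
   full-dimensional P. *)
suff [r [_ _ h]] : exists r, [/\ facet_presentation r P, full P & exists s, forall i, i < d ->
  has_face_number P i ('C(d.+1, i.+1) + s * if i.+1 == d then d - 1 else 'C(d, i))] by [].
elim: sP => {P} [_ [p hp ->]|P _ F _ _ [r [rP fP [s hs]]] [p hp ->] fPF fDF PDF _ _ _ fQ].
  have [l hl] := barycentric_exists hp.
  exists [seq (- l i)%R | i <- enum 'I_d.+1]; split.
  - exact: facet_presentation_simplex.
  - exact: full_hull hp hl.
  by exists 0 => i _; rewrite mul0n addn0; exact: face_number_simplex hp hl i.
have [l hl] := barycentric_exists hp.
have [S FE _] := simplex_faceP hl fDF.1 (has_dim_nonempty fDF.2).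
have [a Sa] : exists a, S = all_but a.
  apply: card_eq_all_but; have := fDF.2; rewrite FE => /(dim_simplex_faceP hp hl) ->.
  by rewrite prednK.
rewrite Sa in FE.
exists (glued_presentation P F r l a); split.
- exact: facet_presentation_glue.
- exact: full_glue.
exists s.+1 => i id; rewrite mulSn addnCA addnC.
exact: (face_number_glue d0 id hp hl rP fP FE fPF PDF fQ (hs i id)).
Qed.

Lemma stacked_face_number P n i : 2 < d -> i < d -> stacked_polytope P ->
  has_face_number P 0 n -> has_face_number P i (stacked_fnum n d i).
Proof.
move=> d3 id sP Pn; have d0 : 0 < d by lia.
have [s hs] := stacked_face_numbers d0 sP.
(* The case i = 0 identifies s, the number of stackings, as n - d - 1. *)
have nE : n = d.+1 + s.
  rewrite (face_number_unique Pn (hs 0 d0)) ifF ?bin0 ?bin1 ?muln1 //; lia.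
suff -> : stacked_fnum n d i = 'C(d.+1, i.+1) + s * if i.+1 == d then d - 1 else 'C(d, i).
  exact: hs.
rewrite /stacked_fnum nE; case: eqP => [e|_].
  have i1 : 1 < i by lia.
  by rewrite -e binSn; nia.
(* The identity (d + 1) C(d, i) = (i + 1) C(d + 1, i + 1) also shows that the truncated subtraction
   is exact. *)
have := mul_bin_diag d.+1 i; rewrite /=; nia.
Qed.

End StackedCount.

Theorem corollary1p4 (d n : nat) (V : finType) (K : {set {set V}})
    (k : fieldType) (R : realType)
    (hd : 3 <= d)
    (hK : simplicial_complex K)
    (hdim : dim_succ K = d)
    (hn : fnum K 0 = n)
    (h2cm : doubly_cohen_macaulay k K) :
  forall i : nat, i < d ->
    stacked_fnum n d i <= fnum K i /\
    (forall P : set 'rV[R]_d,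
       stacked_polytope P -> has_face_number P 0 n ->
       has_face_number P i (stacked_fnum n d i)).
Proof.
move=> i id; split=> [|P sP Pn]; last exact: stacked_face_number.
by rewrite -hn; apply: (fnum_lower_bound _ id hK h2cm hdim); exact: ltnW.
Qed.
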